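(* Fix $(\Sigma,h,[\Omega])$, the frame $(\eta_1,\eta_2,\eta_3)$ and $m>0$ as in the context. For $b\in(0,\infty)$ let $M_b=(-b,b)\times\Sigma$ be the ultrastatic slab with metric $dt\otimes dt-\mathrm{pr}_2^*h$. Then the set of $b\in(0,\infty)$ for which the normal ordered energy density $\varrho$ on $M_b$ has finite quantum fluctuations in the unsoftened FP-state of $M_b$ (the FP-state with $f=\chi_{(-b,b)}$, the characteristic function of $(-b,b)$) is of Lebesgue measure zero.
   Context: Geometry and spatial operator. $(\Sigma,h,[\Omega])$ is an oriented, connected, compact Riemannian $3$-manifold with a fixed smooth global oriented $h$-orthonormal frame $(\eta_1,\eta_2,\eta_3)$; $m>0$. $\gamma^0=\begin{pmatrix}\mathbb{1}&0\\0&-\mathbb{1}\end{pmatrix}$, $\gamma^i=\begin{pmatrix}0&\sigma_i\\-\sigma_i&0\end{pmatrix}$ ($\sigma_i$ Pauli matrices); $\nabla_{\eta_i}\eta_j=\Gamma^k_{ij}\eta_k$ (Levi-Civita), $\Gamma_i=-\frac14\sum_{j,k}\Gamma^k_{ij}\gamma^k\gamma^j$. On $C^\infty(\Sigma,\mathbb{C}^4)$, $H^{\mathrm{sp}}\chi=-\mathrm{i}\gamma^0\gamma^i(\eta_i(\chi)+\Gamma_i\chi)+m\gamma^0\chi$, symmetric for $\langle\chi\mid\chi'\rangle_2=\int_\Sigma\chi^*\chi'\,\mathrm{vol}_h$. The Dirac equation is $\gamma^0(-\mathrm{i}\partial_t+H^{\mathrm{sp}})\psi=0$. With $\mathbb{Z}'=\mathbb{Z}\setminus\{0\}$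 and $\mathbb{Z}^+=\{1,2,\dots\}$, fix an orthonormal basis $\{\chi_z\}_{z\in\mathbb{Z}'}$ of $L^2(\Sigma,\mathbb{C}^4;\mathrm{vol}_h)$ of smooth eigenfunctions, $H^{\mathrm{sp}}\chi_z=\lambda_z\chi_z$, with $m\le\lambda_1\le\lambda_2\le\cdots$, $\lambda_{-z}=-\lambda_z$, and $\langle\chi_w\mid\gamma^0\chi_z\rangle_2=m/\lambda_z$ if $w=z$, $\sqrt{1-m^2/\lambda_z^2}$ if $w=-z$, and $0$ otherwise (such a basis exists). Put $\kappa_z^\pm(t,x)=e^{-\mathrm{i}\lambda_{\pm z}t}\chi_{\pm z}(x)$. Modes of the FP-state. For nonnegative $f\in L^1(\mathbb{R})$, not a.e. zero, let $\hat f(\lambda)=\int f(t)e^{\mathrm{i}\lambda t}dt$ and, for $z\in\mathbb{Z}^+$, $$A_{f,z}=\begin{pmatrix}\hat f(0)m/\lambda_z&\hat f(2\lambda_z)\sqrt{1-m^2/\lambda_z^2}\\ \overline{\hat f(2\lambda_z)}\sqrt{1-m^2/\lambda_z^2}&-\hat f(0)m/\lambda_z\end{pmatrix}=\Xi_{f,z}\begin{pmatrix}\cos2\theta_{f,z}&e^{\mathrm{i}\phi_{f,z}}\sin2\theta_{f,z}\\ e^{-\mathrm{i}\phi_{f,z}}\sin2\theta_{f,z}&-\cos2\theta_{f,z}\end{pmatrix},$$ with $\Xi_{f,z}=\sqrt{|\hat f(2\lambda_z)|^2(1-m^2/\lambda_z^2)+\hat f(0)^2m^2/\lambda_z^2}>0$,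 $\theta_{f,z}\in[-\pi/2,\pi/2)$, $\phi_{f,z}\in[0,2\pi)$ (any such choice; necessarily $\cos2\theta_{f,z}>0$). Set $\kappa^+_{f,z}=\cos\theta_{f,z}\kappa_z^++e^{-\mathrm{i}\phi_{f,z}}\sin\theta_{f,z}\kappa_z^-$ and $\kappa^-_{f,z}=\cos\theta_{f,z}\kappa_z^--e^{\mathrm{i}\phi_{f,z}}\sin\theta_{f,z}\kappa_z^+$. These are eigenvectors, with eigenvalues $\pm\Xi_{f,z}$, of the operator $A_f$ on the Hilbert space of Dirac solutions (with inner product $\int_\Sigma\psi_t^*\varphi_t\,\mathrm{vol}_h$) representing the form $\int_{\mathbb{R}\times\Sigma}f\,\psi^*\gamma^0\varphi\,dt\,\mathrm{vol}_h$. The FP-state $\omega_{\mathrm{FP}_f}$ is the quasifree state of the Dirac CAR algebra whose GNS representation is the Fermi Fock space with vacuum $\Omega$ and annihilation operators $b_z,d_z$ ($z\in\mathbb{Z}^+$), $\{b_w,b_z^\dagger\}=\{d_w,d_z^\dagger\}=\delta_{wz}$, all other anticommutators vanishing, in which the Dirac field is $\Psi=\sum_{z\in\mathbb{Z}^+}(\kappa^+_{f,z}b_z+\kappa^-_{f,z}d_z^\dagger)$ and its Dirac adjoint is $\Psi^\dagger=\sum_{z\in\mathbb{Z}^+}(\kappa^{+\dagger}_{f,z}b^\dagger_z+\kappa^{-\dagger}_{f,z}d_z)$, where $\kappa^\dagger=\kappa^*\gamma^0$. Energy density and fluctuations. $\varrho=\frac{\mathrm{i}}{2}:\!\Psi^\dagger\gamma^0\dot\Psi-\dot\Psi^\dagger\gamma^0\Psi\!:$,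 normal ordered with respect to $\Omega$ (creation operators to the left). Smeared with $h\otimes g$, $h\in C_0^\infty((-b,b),\mathbb{C})$, $g\in C^\infty(\Sigma,\mathbb{C})$, it has vanishing expectation in $\Omega$ and $$\varrho(h\otimes g)\Omega=\sum_{w,z\in\mathbb{Z}^+}c_{wz}\,b_w^\dagger d_z^\dagger\Omega,\qquad c_{wz}=\frac{\mathrm{i}}{2}\int_{M_b}\big(\kappa^{+*}_{f,w}\dot\kappa^-_{f,z}-\dot\kappa^{+*}_{f,w}\kappa^-_{f,z}\big)h(t)g(x)\,dt\,\mathrm{vol}_h .$$ Its squared fluctuation is $\|\varrho(h\otimes g)\Omega\|^2=\sum_{w,z}|c_{wz}|^2\in[0,\infty]$. $\varrho$ has finite quantum fluctuations in the state if this is finite for all such $h$ and $g$. *)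

(* Defs.v *)
From HB Require Import structures.
From mathcomp Require Import all_boot all_order all_algebra.
From mathcomp Require Import finmap.
From mathcomp Require Import complex.
From mathcomp Require Import all_classical all_reals all_analysis.

Set Implicit Arguments.
Unset Strict Implicit.
Unset Printing Implicit Defensive.

Import Order.TTheory GRing.Theory Num.Theory.
Import numFieldNormedType.Exports.

Local Open Scope classical_set_scope.
Local Open Scope ring_scope.

Definition partial (R : realType) (j : 'I_3) (f : 'rV[R]_3 -> R) :
  'rV[R]_3 -> R := 'D_(delta_mx 0 j) f.

(* Only meaningful for open U. *)
Fixpoint Ck_on (R : realType) (k : nat) (U : set 'rV[R]_3)
    (f : 'rV[R]_3 -> R) : Prop :=
  (forall x, U x -> {for x, continuous f}) /\
  match k with
  | 0%N => True
  | l.+1 => forall j : 'I_3,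
      (forall x, U x -> derivable f x (delta_mx 0 j)) /\
      Ck_on l U (partial j f)
  end.

Definition smooth_on (R : realType) (U : set 'rV[R]_3) (f : 'rV[R]_3 -> R) :=
  forall k, Ck_on k U f.

(* [phi c] and [psi c] are total functions; only their restrictions to
   [dom c] and to [img] (see below) matter. *)
Record atlas3 (R : realType) (Sigma : ptopologicalType) := Atlas3 {
  chart : Type;
  dom : chart -> set Sigma;
  phi : chart -> Sigma -> 'rV[R]_3;
  psi : chart -> 'rV[R]_3 -> Sigma;
  chart_at : Sigma -> chart;
  dom_open : forall c, open (dom c);
  img_open : forall c, open (phi c @` dom c);
  phiK : forall c p, dom c p -> psi c (phi c p) = p;
  phi_cont : forall c p, dom c p -> {for p, continuous (phi c)};
  psi_cont : forall c x, (phi c @` dom c) x -> {for x, continuous (psi c)};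
  chart_atP : forall p, dom (chart_at p) p;
  compat : forall c d (l : 'I_3),
    smooth_on (phi c @` (dom c `&` dom d)) (fun x => phi d (psi c x) 0 l)
}.

Section Geometry.
Variables (R : realType) (Sigma : ptopologicalType) (M : atlas3 R Sigma).

Definition img (c : chart M) : set 'rV[R]_3 := phi c @` dom c.

(* Jacobian of the transition map, acting on row vectors from the right. *)
Definition jac (c d : chart M) (x : 'rV[R]_3) : 'M[R]_3 :=
  \matrix_(k, l) partial k (fun y => phi d (psi c y) 0 l) x.

Record vector_field := VectorField {
  vf : chart M -> 'rV[R]_3 -> 'rV[R]_3;
  vf_smooth : forall c l, smooth_on (img c) (fun x => vf c x 0 l);
  vf_trans : forall c d p, dom c p -> dom d p ->
    vf d (phi d p) = vf c (phi c p) *m jac c d (phi c p)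
}.

Record metric := Metric {
  mt : chart M -> 'rV[R]_3 -> 'M[R]_3;
  mt_smooth : forall c i j, smooth_on (img c) (fun x => mt c x i j);
  mt_sym : forall c x, img c x -> (mt c x)^T = mt c x;
  mt_pos : forall c x (v : 'rV[R]_3), img c x -> v != 0 ->
    0 < (v *m mt c x *m v^T) 0 0;
  mt_trans : forall c d p, dom c p -> dom d p ->
    mt c (phi c p) =
      jac c d (phi c p) *m mt d (phi d p) *m (jac c d (phi c p))^T
}.

(* A nowhere vanishing 3-form; in the chart c it is
   [vol3 c] dx^1 /\ dx^2 /\ dx^3. It represents the orientation. *)
Record volume_form := VolumeForm {
  vol3 : chart M -> 'rV[R]_3 -> R;
  vol3_smooth : forall c, smooth_on (img c) (vol3 c);
  vol3_neq0 : forall c x, img c x -> vol3 c x != 0;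
  vol3_trans : forall c d p, dom c p -> dom d p ->
    vol3 c (phi c p) = \det (jac c d (phi c p)) * vol3 d (phi d p)
}.

Definition smooth_fun (f : Sigma -> R) : Prop :=
  forall c : chart M, smooth_on (img c) (f \o psi c).

Definition vf_app (X : vector_field) (f : Sigma -> R) (p : Sigma) : R :=
  let c := chart_at M p in
  \sum_(j < 3) vf X c (phi c p) 0 j * partial j (f \o psi c) (phi c p).

Definition christoffel (g : metric) (c : chart M) (k i j : 'I_3)
    (x : 'rV[R]_3) : R :=
  2^-1 * \sum_(l < 3) invmx (mt g c x) k l *
    (partial i (fun y => mt g c y j l) x + partial j (fun y => mt g c y i l) x
     - partial l (fun y => mt g c y i j) x).

Definition cov_deriv (g : metric) (X Y : vector_field) (c : chart M)
    (x : 'rV[R]_3) : 'rV[R]_3 :=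
  \row_k (\sum_(i < 3) vf X c x 0 i * partial i (fun y => vf Y c y 0 k) x
          + \sum_(i < 3) \sum_(j < 3)
              christoffel g c k i j x * vf X c x 0 i * vf Y c x 0 j).

Definition frame_mx (eta : 'I_3 -> vector_field) (c : chart M)
    (x : 'rV[R]_3) : 'M[R]_3 :=
  \matrix_(i, l) vf (eta i) c x 0 l.

Definition orthonormal_frame (g : metric) (eta : 'I_3 -> vector_field) : Prop :=
  forall c x, img c x ->
    frame_mx eta c x *m mt g c x *m (frame_mx eta c x)^T = 1%:M.

Definition oriented_frame (Om : volume_form) (eta : 'I_3 -> vector_field) :
    Prop :=
  forall c x, img c x -> 0 < vol3 Om c x * \det (frame_mx eta c x).

(* [frame_Gamma g eta k i j] is the coefficient of eta_k in nabla_{eta_i} eta_j: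
   the row of chart components of nabla_{eta_i} eta_j equals the row
   of its frame coefficients times [frame_mx]. *)
Definition frame_Gamma (g : metric) (eta : 'I_3 -> vector_field)
    (k i j : 'I_3) (p : Sigma) : R :=
  let c := chart_at M p in let x := phi c p in
  (cov_deriv g (eta i) (eta j) c x *m invmx (frame_mx eta c x)) 0 k.

Definition borel : Type := g_sigma_algebraType (@open Sigma).

Definition leb3 := ((@lebesgue_measure R \x @lebesgue_measure R) \x
  @lebesgue_measure R)%E.

Definition vec3 (t : R * R * R) : 'rV[R]_3 :=
  \row_(j < 3) [:: t.1.1; t.1.2; t.2]`_j.

(* The Riemannian measure is characterized by its values in the charts; it is
   finite because Sigma is compact, hence the type of [vol] below. *)
Definition riemannian_measure (g : metric)
    (vol : {finite_measure set borel -> \bar R}) : Prop :=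
  forall (c : chart M) (A : set borel), measurable A -> A `<=` dom c ->
    vol A = (\int[leb3]_(t in [set t | (phi c @` A) (vec3 t)])
               (Num.sqrt (\det (mt g c (vec3 t))))%:E)%E.

End Geometry.

Local Open Scope complex_scope.

Definition normsq (R : realType) (z : R[i]) : R :=
  complex.Re z ^+ 2 + complex.Im z ^+ 2.

Definition cis (R : realType) (x : R) : R[i] := cos x +i* sin x.

Definition cint d (T : measurableType d) (R : realType)
    (mu : {measure set T -> \bar R}) (D : set T) (F : T -> R[i]) : R[i] :=
  Rintegral mu D (fun x => complex.Re (F x))
  +i* Rintegral mu D (fun x => complex.Im (F x)).

Definition cderive (R : realType) (F : R -> R[i]) (t : R) : R[i] :=
  derive1 (fun s => complex.Re (F s)) t
  +i* derive1 (fun s => complex.Im (F s)) t.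

Definition clim (R : realType) (u : nat -> R[i]) : R[i] :=
  limn (fun n => complex.Re (u n)) +i* limn (fun n => complex.Im (u n)).

Definition smooth_line (R : realType) (f : R -> R) : Prop :=
  forall n x, derivable (derive1n n f) x 1.

Definition test_function (R : realType) (b : R) (f : R -> R[i]) : Prop :=
  let supp := closure [set t | f t != 0] in
  [/\ smooth_line (fun t => complex.Re (f t)),
      smooth_line (fun t => complex.Im (f t)),
      compact supp & supp `<=` `]-b, b[].

Section Gamma.
Variable R : realType.

Definition mx2 (a b c d : R[i]) : 'M[R[i]]_2 :=
  \matrix_(i, j) (nth [::] [:: [:: a; b]; [:: c; d]] i)`_j.

Definition pauli (k : 'I_3) : 'M[R[i]]_2 :=
  [:: mx2 0 1 1 0; mx2 0 (- 'i%C) 'i%C 0; mx2 1 0 0 (-1)]`_k.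

Definition gamma0 : 'M[R[i]]_4 :=
  @block_mx _ 2 2 2 2 1%:M 0 0 (- 1%:M).

(* [gammas k] is gamma^{k+1}. *)
Definition gammas (k : 'I_3) : 'M[R[i]]_4 :=
  @block_mx _ 2 2 2 2 0 (pauli k) (- pauli k) 0.

Definition adj (n : nat) (v : 'cV[R[i]]_n) : 'rV[R[i]]_n :=
  (map_mx (@conjc R) v)^T.

Definition dirac_adj (v : 'cV[R[i]]_4) : 'rV[R[i]]_4 := adj v *m gamma0.

End Gamma.

Arguments gamma0 {R}.
Arguments gammas {R}.

Section Dirac.
Variables (R : realType) (Sigma : ptopologicalType) (M : atlas3 R Sigma).
Local Notation spinor := ('cV[R[i]]_4).

Definition smooth_cfun (f : Sigma -> R[i]) : Prop :=
  smooth_fun M (fun p => complex.Re (f p)) /\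
  smooth_fun M (fun p => complex.Im (f p)).

Definition smooth_spinor (chi : Sigma -> spinor) : Prop :=
  forall a, smooth_cfun (fun p => chi p a 0).

Definition vf_app_spinor (X : vector_field M) (chi : Sigma -> spinor)
    (p : Sigma) : spinor :=
  \col_a (vf_app X (fun q => complex.Re (chi q a 0)) p
          +i* vf_app X (fun q => complex.Im (chi q a 0)) p).

Variables (g : metric M) (eta : 'I_3 -> vector_field M).

Definition spin_Gamma (i : 'I_3) (p : Sigma) : 'M[R[i]]_4 :=
  - (4%:R^-1 *: \sum_(j < 3) \sum_(k < 3)
       (frame_Gamma g eta k i j p)%:C *: (gammas k *m gammas j)).

Definition Hsp (m : R) (chi : Sigma -> spinor) (p : Sigma) : spinor :=
  - ('i%C *: \sum_(i < 3) gamma0 *m gammas i *m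
       (vf_app_spinor (eta i) chi p + spin_Gamma i p *m chi p))
  + m%:C *: (gamma0 *m chi p).

End Dirac.

Section Eigenbasis.
Variables (R : realType) (Sigma : ptopologicalType) (M : atlas3 R Sigma).
Variable vol : {finite_measure set (borel Sigma) -> \bar R}.
Local Notation spinor := ('cV[R[i]]_4).

Definition inner2 (u v : Sigma -> spinor) : R[i] :=
  cint vol setT (fun x => (adj (u x) *m v x) 0 0).

Definition norm2sq (u : Sigma -> spinor) : \bar R :=
  (\int[vol]_x (\sum_(a < 4) normsq (u x a 0))%:E)%E.

Definition in_L2 (u : Sigma -> spinor) : Prop :=
  (forall a,
     measurable_fun [set: borel Sigma] (fun x => complex.Re (u x a 0)) /\
     measurable_fun [set: borel Sigma] (fun x => complex.Im (u x a 0))) /\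
  (norm2sq u < +oo)%E.

(* [chi] and [lam] are indexed by int; the value at 0 is irrelevant. *)
Record orthonormal_basis (chi : int -> Sigma -> spinor) : Prop := {
  onb_L2 : forall z, z != 0 -> in_L2 (chi z);
  onb_ortho : forall w z, w != 0 -> z != 0 ->
    inner2 (chi w) (chi z) = (w == z)%:R;
  onb_total : forall u, in_L2 u ->
    norm2sq (fun x => u x - \sum_(n < N)
       (inner2 (chi n.+1%:Z) u *: chi n.+1%:Z x
        + inner2 (chi (- n.+1%:Z)) u *: chi (- n.+1%:Z) x)) @[N --> \oo] --> 0%E
}.

Record dirac_eigenbasis (g : metric M) (eta : 'I_3 -> vector_field M) (m : R)
    (chi : int -> Sigma -> spinor) (lam : int -> R) : Prop := {
  deb_basis : orthonormal_basis chi;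
  deb_smooth : forall z, z != 0 -> smooth_spinor M (chi z);
  deb_eigen : forall z, z != 0 -> forall p,
    Hsp g eta m (chi z) p = (lam z)%:C *: chi z p;
  deb_ge_m : m <= lam 1;
  deb_mono : forall n : nat, lam n.+1%:Z <= lam n.+2%:Z;
  deb_opp : forall z, z != 0 -> lam (- z) = - lam z;
  deb_gamma0 : forall w z, w != 0 -> z != 0 ->
    inner2 (chi w) (fun x => gamma0 *m chi z x) =
      if w == z then (m / lam z)%:C
      else if w == - z then (Num.sqrt (1 - m ^+ 2 / lam z ^+ 2))%:C
      else 0
}.

End Eigenbasis.

(* From here on [n : nat] stands for the element z = n + 1 of Z^+, and a
   boolean sign [s] for + ([true]) or - ([false]). *)
Section FPModes.
Variable R : realType.

Definition fourier (f : R -> R) (l : R) : R[i] :=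
  cint lebesgue_measure setT (fun t => (f t)%:C * cis (l * t)).

Definition A_mx (m : R) (f : R -> R) (l : R) : 'M[R[i]]_2 :=
  let D := fourier f 0 * (m / l)%:C in
  let s := (Num.sqrt (1 - m ^+ 2 / l ^+ 2))%:C in
  mx2 D (fourier f (2 * l) * s) (conjc (fourier f (2 * l)) * s) (- D).

Definition Xi (m : R) (f : R -> R) (l : R) : R :=
  Num.sqrt (normsq (fourier f (2 * l)) * (1 - m ^+ 2 / l ^+ 2)
            + normsq (fourier f 0) * m ^+ 2 / l ^+ 2).

Definition FP_angles (m : R) (f : R -> R) (lam : int -> R)
    (theta ph : nat -> R) : Prop :=
  forall n : nat, let l := lam n.+1%:Z in
  [/\ - (pi / 2) <= theta n < pi / 2,
      0 <= ph n < 2 * pi &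
      A_mx m f l = (Xi m f l)%:C *:
        mx2 (cos (2 * theta n))%:C (cis (ph n) * (sin (2 * theta n))%:C)
            (cis (- ph n) * (sin (2 * theta n))%:C) (- (cos (2 * theta n))%:C)].

Variables (Sigma : ptopologicalType).
Variables (chi : int -> Sigma -> 'cV[R[i]]_4) (lam : int -> R).
Variables (theta ph : nat -> R).

Definition kappa (s : bool) (n : nat) (t : R) (x : Sigma) : 'cV[R[i]]_4 :=
  let z : int := if s then n.+1%:Z else - n.+1%:Z in
  cis (- (lam z * t)) *: chi z x.

Definition kappaf (s : bool) (n : nat) (t : R) (x : Sigma) : 'cV[R[i]]_4 :=
  if s then (cos (theta n))%:C *: kappa true n t x
            + (cis (- ph n) * (sin (theta n))%:C) *: kappa false n t x
  else (cos (theta n))%:C *: kappa false n t x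
       - (cis (ph n) * (sin (theta n))%:C) *: kappa true n t x.

Definition kappaf_dot (s : bool) (n : nat) (t : R) (x : Sigma) :
    'cV[R[i]]_4 :=
  \col_a cderive (fun t' => kappaf s n t' x a 0) t.

Variable vol : {finite_measure set (borel Sigma) -> \bar R}.

(* Smeared coefficient, over the slab ]-b, b[ x Sigma, of the product of the
   mode operators of signs s (from the adjoint field, index w) and
   s' (from the field, index z) in
   i/2 (Psi^+ gamma^0 Psi' - Psi'^+ gamma^0 Psi). *)
Definition rho_coef (b : R) (h : R -> R[i]) (g : Sigma -> R[i])
    (s s' : bool) (w z : nat) : R[i] :=
  cint (@lebesgue_measure R \x vol)%E (`]-b, b[ `*` [set: borel Sigma])
    (fun tx : R * borel Sigma => let t := tx.1 in let x := tx.2 in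
      'i%C / 2%:R *
      (dirac_adj (kappaf s w t x) *m gamma0 *m kappaf_dot s' z t x
       - dirac_adj (kappaf_dot s w t x) *m gamma0 *m kappaf s' z t x) 0 0
      * h t * g x).

End FPModes.

(* A Fock vector is given by its coefficients in the occupation number
   basis |S>, with S a finite set of modes. Normalizability is not imposed:
   the vector rho(h (x) g) Omega need not be normalizable. The mode number
   2n carries b_z and 2n + 1 carries d_z, where z = n + 1. *)
Section Fock.
Variable R : realType.
Local Open Scope fset_scope.

Definition fock := {fset nat} -> R[i].

Definition vacuum : fock := fun S => (S == fset0)%:R.

Definition jw_sign (k : nat) (S : {fset nat}) : R[i] :=
  (-1) ^+ #|` [fset j in S | (j < k)%N] |.

(* a_k |S> = jw_sign k S |S \ k> if k is in S, and 0 otherwise. *)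
Definition annih (k : nat) (v : fock) : fock :=
  fun S => if k \in S then 0 else jw_sign k S * v (k |` S).

Definition creat (k : nat) (v : fock) : fock :=
  fun S => if k \in S then jw_sign k S * v (S `\ k) else 0.

Definition b_an (n : nat) : fock -> fock := annih n.*2.
Definition b_cr (n : nat) : fock -> fock := creat n.*2.
Definition d_an (n : nat) : fock -> fock := annih n.*2.+1.
Definition d_cr (n : nat) : fock -> fock := creat n.*2.+1.

Definition fock_normsq (v : fock) : \bar R :=
  (\esum_(S in [set: {fset nat}]) (normsq (v S))%:E)%E.

(* Normal ordered expression
   sum_{w, z} C++ b_w^+ b_z + C+- b_w^+ d_z^+ + C-+ d_w b_z + C-- :d_w d_z^+:
   restricted to the modes below N. *)
Definition normal_ordered (C : bool -> bool -> nat -> nat -> R[i]) (N : nat)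
    (v : fock) : fock := fun S =>
  \sum_(w < N) \sum_(z < N)
    (C true true w z * b_cr w (b_an z v) S
     + C true false w z * b_cr w (d_cr z v) S
     + C false true w z * d_an w (b_an z v) S
     - C false false w z * d_cr z (d_an w v) S).

End Fock.

Section Fluctuations.
Variables (R : realType) (Sigma : ptopologicalType) (M : atlas3 R Sigma).
Variable vol : {finite_measure set (borel Sigma) -> \bar R}.
Variables (chi : int -> Sigma -> 'cV[R[i]]_4) (lam : int -> R).

Definition rho_Omega (theta ph : nat -> R) (b : R) (h : R -> R[i])
    (g : Sigma -> R[i]) : fock R := fun S =>
  clim (fun N => normal_ordered (rho_coef chi lam theta ph vol b h g) N
                   (@vacuum R) S).

Definition finite_fluctuations (theta ph : nat -> R) (b : R) : Prop :=
  forall (h : R -> R[i]) (g : Sigma -> R[i]),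
    test_function b h -> smooth_cfun M g ->
    (fock_normsq (rho_Omega theta ph b h g) < +oo)%E.

End Fluctuations.

(* Main.v *)
(* Testing finite fluctuations with g = 1 and a positive h, the coefficients c_nn tend to 0;
   they are computed exactly, and give lam_n sin (2 theta_n) -> 0. As the Fourier transform of
   the characteristic function of ]-b, b[ at 2 lam is sin (2 lam b) / lam, this forces
   sin (2 lam_n b) -> 0, unless every lam_n equals m. For a fixed nondecreasing sequence lam_n
   the set of such b is null: if lam_n is unbounded, then cos (4 lam_n b) -> 1 on it,
   contradicting the Riemann-Lebesgue lemma; otherwise sin (2 b lim lam_n) = 0.

   The eigenvalues are not all equal to +-m. Otherwise the third component of every positive
   mode vanishes, and the third row of the eigenvalue equation becomes one and the same
   homogeneous first order equation L u + beta u = 0 for the upper components u of all modes.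
   Three such u satisfy a determinant identity free of beta; integrating it by parts against a
   bump function in a chart, and using that the upper components are dense in L^2, one
   eliminates them one after the other and finds that the symbol of L vanishes. *)
Require Import Defs.
From HB Require Import structures.
From mathcomp Require Import all_boot all_order all_algebra.
From mathcomp Require Import finmap.
From mathcomp Require Import complex.
From mathcomp Require Import all_classical all_reals all_analysis.
From mathcomp Require Import measurable_realfun.
From mathcomp Require Import ring lra.
Set Implicit Arguments.
Unset Strict Implicit.
Unset Printing Implicit Defensive.
Import Order.TTheory GRing.Theory Num.Theory.
Import numFieldNormedType.Exports.
Local Open Scope classical_set_scope.
Local Open Scope ring_scope.
Local Open Scope complex_scope.

(** * Sequences of sines converging to zero *)

(** The eigenvalue m has to be set apart because 1 - m^2 / lam_n^2 multiplies the squared Fourier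
    coefficient at 2 lam_n: at lam_n = m the off-diagonal entry vanishes for every b and says
    nothing about b. One larger eigenvalue is enough, since monotonicity then bounds this factor
    from below.

    The obstacle in finding it is regularity. The coefficients beta come from the spin connection,
    which is computed at each point in a chart attached to that point, so they are at hand only
    pointwise and cannot be put under an integral; but they are common to all modes, and Cramer's
    rule removes them before anything is integrated. Moreover, the third component of a positive
    mode vanishes only in the L^2 sense. The determinant identity is therefore stated weakly, tested
    against continuous functions on a closed cube inside a chart, where Fubini and the fundamental
    theorem of calculus give the integration by parts. Each use of density replaces one mode by an
    arbitrary continuous pair of upper components. *)

Lemma integral_cos (R : realType) (a x y : R) : a != 0 -> x < y ->
  (\int[lebesgue_measure]_(t in `[x, y]) (cos (a * t))%:E =
   ((sin (a * y) - sin (a * x)) / a)%:E)%E.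
Proof.
move=> a0 xy.
have dF (t : R) : is_derive t (1 : R) (fun t => sin (a * t) / a) (cos (a * t)).
  apply: is_derive_eq.
  rewrite /GRing.scale /=.
  by field.
have cF (t : R) : {for t, continuous (fun t => sin (a * t) / a)}.
  by apply: differentiable_continuous; apply/derivable1_diffP; exact: ex_derive.
rewrite (@continuous_FTC2 _ (fun t => cos (a * t)) (fun t => sin (a * t) / a)) //.
- by rewrite -EFinD mulrBl.
- apply: continuous_subspaceT => t.
  apply: (@continuous_comp _ _ _ (fun t => a * t) cos).
    exact: mulrl_continuous.
  exact: continuous_cos.
- split => //.
  + exact/cvg_at_right_filter/cF.
  + exact/cvg_at_left_filter/cF.
- by move=> t _; rewrite derive1E; exact: derive_val.
Qed.

Lemma negligible_density (R : realType) (A : set R) (c : R) :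
  measurable A -> c < 1 ->
  (forall x r, 0 < r ->
    (lebesgue_measure (A `&` ball x r) <= (c * (r *+ 2))%:E)%E) ->
  (@lebesgue_measure R).-negligible A.
Proof.
move=> mA c1 Ac.
have [N [mN N0 sN]] := lebesgue_density mA.
exists N; split => // x Ax; apply: sN => /= cv.
move: cv; rewrite indicE mem_set //= => cv.
have : (1%:E <= c%:E :> \bar R)%E.
  apply: (cvge_le (F := 0^'+) _ cv); near=> r.
  have r0 : 0 < r by near: r; exact: nbhs_right_gt.
  have r20 : 0 < r *+ 2 by rewrite mulrn_wgt0.
  rewrite lebesgue_measure_ball ?(ltW r0) // inver gt_eqF //.
  apply: le_trans (lee_wpmul2r _ (Ac x r r0)) _.
    by rewrite lee_fin invr_ge0 ltW.
  by rewrite -EFinM lee_fin mulfK // gt_eqF.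
by rewrite lee_fin leNgt c1.
Unshelve. all: by end_near. Qed.

(** A single high frequency already cuts down the measure: over an interval long compared with the
    period, the cosine averages to nearly 0, so it is at least 1/2 on a proportion of little more
    than 2/3. The density criterion then applies with 3/4. *)
Lemma negligible_cos_ge_half (R : realType) (a : nat -> R) (N : nat) :
  a @ \oo --> +oo ->
  (@lebesgue_measure R).-negligible
    [set b | forall n, (N <= n)%N -> 2^-1 <= cos (a n * b)].
Proof.
move=> ay.
have mA n : measurable [set b : R | 2^-1 <= cos (a n * b)].
  rewrite (_ : [set b | _] = (fun b => cos (a n * b)) @^-1` `[2^-1, +oo[).
    rewrite -[X in measurable X]setTI.
    apply: (_ : measurable_fun setT (fun b => cos (a n * b))) => //.
    apply: continuous_measurable_fun => b.
    apply: (@continuous_comp _ _ _ (fun t => a n * t) cos).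
      exact: mulrl_continuous.
    exact: continuous_cos.
  by apply/seteqP; split => b /=; rewrite in_itv /= andbT.
have mA' : measurable [set b | forall n, (N <= n)%N -> 2^-1 <= cos (a n * b)].
  rewrite (_ : [set b | _] = \bigcap_n [set b | (N <= n)%N -> 2^-1 <= cos (a n * b)]).
    apply: bigcapT_measurable => k.
    have [Nk|kN] := boolP (N <= k)%N.
      by rewrite (_ : [set b | _] = [set b | 2^-1 <= cos (a k * b)]) //;
         apply/seteqP; split => b /=; auto.
    by rewrite (_ : [set b | _] = setT) //; apply/seteqP; split => b.
  by apply/seteqP; split => b H k; [move=> _|]; exact: H.
apply: (@negligible_density _ _ (3 / 4)) => //; first lra.
move=> x r r0.
(* With [2 / a n <= r / 8] the oscillating term contributes at most r / 12, and 4 r / 3 + r / 12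
   stays below (3/4) (2 r). *)
have [n [Nn an0 an]] : exists n, [/\ (N <= n)%N, 0 < a n & 2 / a n <= r / 8].
  have [M _ HM] := (cvgryPge a).1 ay (16 / r).
  exists (maxn N M); have := HM _ (leq_maxr N M); rewrite /= => aM.
  have a0 : 0 < a (maxn N M) by apply: lt_le_trans aM; rewrite divr_gt0.
  split => //; first exact: leq_maxl.
  rewrite ler_pdivrMr // mulrAC ler_pdivlMr //.
  move: aM; rewrite ler_pdivrMr // => aM; lra.
set A := [set b | _].
have xr : x - r < x + r by lra.
have cf : continuous (fun t => cos (a n * t)).
  move=> b; apply: (@continuous_comp _ _ _ (fun t => a n * t) cos).
    exact: mulrl_continuous.
  exact: continuous_cos.
pose I := `[x - r, x + r]%classic : set R.
pose B := [set b : R | 2^-1 <= cos (a n * b)].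
have AB : A `&` ball x r `<=` B `&` I.
  move=> b [Ab]; rewrite ball_itv /= in_itv /= => /andP[b1 b2].
  split; first exact: Ab.
  by rewrite /I /= in_itv /= (ltW b1) (ltW b2).
apply: (@le_trans _ _ (lebesgue_measure (B `&` I))).
  apply: le_measure => //; rewrite inE; apply: measurableI; [exact: mA'|exact: measurable_ball | exact: mA | exact: measurable_itv].
(* Markov's inequality, with [1_{cos >= 1/2} <= 2/3 (1 + cos)] *)
have mI : measurable I by exact: measurable_itv.
have mB : measurable B := mA n.
rewrite -(integral_indic lebesgue_measure mI mB).
have ic : lebesgue_measure.-integrable I (EFin \o (fun t => cos (a n * t))).
  apply: continuous_compact_integrable; first exact: segment_compact.
  exact: continuous_subspaceT.
have i1 : lebesgue_measure.-integrable I (EFin \o (fun t : R => 2 / 3 : R)).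
  apply: continuous_compact_integrable; first exact: segment_compact.
  apply: continuous_subspaceT => ?; exact: cvg_cst.
apply: (@le_trans _ _ (\int[lebesgue_measure]_(t in I)
   ((2/3)%:E + (2 / 3)%:E * (cos (a n * t))%:E))%E).
  apply: ge0_le_integral => //.
  - by apply/measurable_EFinP/measurable_indic.
  - apply: measurable_funTS; apply: emeasurable_funD => //.
    apply: measurable_funeM; apply/measurable_EFinP.
    exact: continuous_measurable_fun.
  - move=> t _; rewrite indicE -EFinM -EFinD lee_fin.
    have c1 := cos_geN1 (a n * t).
    have [/set_mem tB|_] := boolP (t \in B).
      have : 2^-1 <= cos (a n * t) := tB.
      rewrite mulr1n; lra.
    rewrite mulr0n; lra.
rewrite integralD //; last first.
  by apply: integrableZl.
rewrite integralZl // /I integral_cos ?gt_eqF // integral_cst //.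
have mIE : lebesgue_measure I = (r *+ 2)%:E.
  by rewrite /I lebesgue_measure_itv /= lte_fin xr -EFinB; congr EFin; ring.
rewrite [X in (_ * X + _)%E](_ : _ = (r *+ 2)%:E); last exact: mIE.
rewrite -!EFinM -EFinD lee_fin.
have := sin_le1 (a n * (x + r)); have := sin_geN1 (a n * (x - r)).
move=> s1 s2.
have : (sin (a n * (x + r)) - sin (a n * (x - r))) / a n <= 2 / a n.
  by rewrite ler_pM2r ?invr_gt0 //; lra.
rewrite mulr2n; lra.
Qed.

Lemma negligible_cos_cvg1 (R : realType) (a : nat -> R) : a @ \oo --> +oo ->
  (@lebesgue_measure R).-negligible [set b | cos (a n * b) @[n --> \oo] --> (1 : R)].
Proof.
move=> ay.
have H : (@lebesgue_measure R).-negligible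
    (\bigcup_N [set b | forall n, (N <= n)%N -> 2^-1 <= cos (a n * b)]).
  by apply: negligible_bigcup => N; exact: negligible_cos_ge_half.
apply: negligibleS H => b /= cb.
have [N _ HN] : \forall n \near \oo, 2^-1 < cos (a n * b).
  by apply: (cvgr_gt (1 : R)) => //; lra.
by exists N => // n Nn; exact/ltW/HN.
Qed.

(* Along a nondecreasing sequence of frequencies either [cos (4 lam_n b) -> 1]
   with [lam_n] unbounded, or [cos (4 L b) = 1] for the limit [L], hence
   [cos (4 k L b) = 1] for all [k]. *)
Lemma negligible_sin_cvg0 (R : realType) (lam : nat -> R) :
  0 < lam 0%N -> {homo lam : n k / (n <= k)%N >-> n <= k} ->
  (@lebesgue_measure R).-negligible
    [set b | sin (2 * (lam n) * b) @[n --> \oo] --> (0 : R)].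
Proof.
move=> lam0 ndlam.
have cos2 x : cos (4 * x) = 1 - 2 * sin (2 * x) ^+ 2 :> R.
  rewrite (_ : 4 * x = 2 * x + 2 * x); last by ring.
  by rewrite cosD -!expr2; have := cos2Dsin2 (2 * x); lra.
have [ub|nub] := pselect (has_ubound (range lam)).
  have cvl := nondecreasing_cvgn ndlam ub.
  set L := sup _ in cvl.
  have L0 : 0 < L.
    by apply: lt_le_trans lam0 _; apply: ub_le_sup => //; exists 0%N.
  have kL : (fun k => 4 * L * k%:R) @ \oo --> +oo.
    apply/cvgryPge => A; near=> k.
    rewrite mulrC -ler_pdivrMr ?mulr_gt0 //.
    near: k; exact: (cvgryPge (fun n : nat => n%:R)).1 cvgr_idn _.
  apply: negligibleS (negligible_cos_cvg1 kL) => b /= sb.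
  have s0 : sin (2 * L * b) = 0.
    apply: (cvg_unique _ _ sb) => //.
    apply: (cvg_comp (fun n => 2 * lam n * b) (@sin R)).
      by apply: cvgMr_tmp; apply: cvgMl_tmp; exact: cvl.
    exact: continuous_sin.
  have c1 : cos (4 * L * b) = 1.
    by rewrite -mulrA cos2 [2 * (L * b)]mulrA s0 expr0n /= mulr0 subr0.
  have s1 : sin (4 * L * b) = 0.
    apply/eqP; rewrite -sqrf_eq0; apply/eqP.
    by have := cos2Dsin2 (4 * L * b); rewrite c1 expr1n; lra.
  (* The sine is carried along because the addition formula for the cosine calls for it. *)
  have ck k : cos (4 * L * k%:R * b) = 1 /\ sin (4 * L * k%:R * b) = 0.
    elim: k => [|k [IH1 IH2]]; first by rewrite mulr0 mul0r cos0 sin0.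
    rewrite -[k.+1%:R]natr1 mulrDr mulr1 mulrDl cosD sinD IH1 IH2 c1 s1; split; ring.
  under eq_fun do rewrite (ck _).1.
  exact: cvg_cst.
have ylam : (fun n => 4 * lam n) @ \oo --> +oo.
  apply/cvgryPge => A.
  have [N NA] : exists N, A / 4 < lam N.
    apply: contrapT => H; apply: nub; exists (A / 4) => _ [n _ <-].
    by rewrite leNgt; apply/negP => An; apply: H; exists n.
  exists N => // n /= Nn; rewrite mulrC -ler_pdivrMr //.
  exact/ltW/(lt_le_trans NA)/ndlam.
apply: negligibleS (negligible_cos_cvg1 ylam) => b /= sb.
under eq_fun do rewrite -mulrA cos2 [2 * (lam _ * b)]mulrA.
have H : 1 - 2 * (sin (2 * lam n * b) * sin (2 * lam n * b))
    @[n --> \oo] --> (1 - 2 * (0 * 0) : R).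
  by apply: cvgB; [exact: cvg_cst | apply: cvgMl_tmp; exact: cvgM].
by move: H; rewrite !mulr0 subr0; under eq_fun do rewrite -expr2.
Unshelve. all: by end_near. Qed.

(** * Matrix elements on the vacuum *)

Lemma cvg_clim_eventually (R : realType) (u : nat -> R[i]) (N : nat) (l : R[i]) :
  (forall n, (N < n)%N -> u n = l) -> clim u = l.
Proof.
move=> ul; rewrite /clim.
have near_l : \forall n \near \oo, u n = l by exists N.+1.
have -> : limn (fun n => complex.Re (u n)) = complex.Re l.
  apply/cvg_lim => //; apply: cvg_near_cst.
  by apply: filterS near_l => n ->.
have -> : limn (fun n => complex.Im (u n)) = complex.Im l.
  apply/cvg_lim => //; apply: cvg_near_cst.
  by apply: filterS near_l => n ->.
by case: l {ul near_l}.
Qed.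

Section FockPairs.
Variable R : realType.
Local Open Scope fset_scope.

(** The modes of [b_cr n] and [d_cr n] are occupied; the coefficient of rho Omega in this state is
    c_nn. *)
Definition pair_state (n : nat) : {fset nat} := [fset n.*2; n.*2.+1].

Lemma pair_state_inj : injective pair_state.
Proof.
move=> n k /fsetP /(_ n.*2); rewrite !inE eqxx /= => /esym /orP[] /eqP.
  by move/double_inj.
by move=> /(congr1 odd); rewrite /= !odd_double.
Qed.

Lemma annih_vacuum k : annih k (@vacuum R) = fun=> 0.
Proof.
apply/funext => S; rewrite /annih /vacuum; case: ifP => // _.
suff -> : (k |` S == fset0) = false by rewrite mulr0.
by apply/negbTE/fset0Pn; exists k; rewrite !inE eqxx.
Qed.

Lemma creat0 k : creat k (fun=> 0 : R[i]) = fun=> 0.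
Proof. by apply/funext => S; rewrite /creat; case: ifP; rewrite ?mulr0. Qed.

Lemma annih0 k : annih k (fun=> 0 : R[i]) = fun=> 0.
Proof. by apply/funext => S; rewrite /annih; case: ifP; rewrite ?mulr0. Qed.

(** Both Jordan-Wigner signs are 1: the mode [n.*2.+1] is filled in the vacuum, and no occupied mode
    lies below [n.*2] afterwards. *)
Lemma b_cr_d_cr_vacuum w z n :
  b_cr w (d_cr z (@vacuum R)) (pair_state n) = ((w == n) && (z == n))%:R.
Proof.
rewrite /b_cr /d_cr /creat /vacuum /pair_state !inE.
have nodd (a b : nat) : (a.*2 == b.*2.+1) = false.
  by apply/eqP => /(congr1 odd); rewrite /= !odd_double.
rewrite nodd orbF !(inj_eq double_inj).
have [->|wn] := eqVneq w n; last by [].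
rewrite eqSS (eq_sym _.+1) nodd (inj_eq double_inj) /=.
have -> : [fset n.*2; n.*2.+1] `\ n.*2 = [fset n.*2.+1].
  apply/fsetP => k; rewrite !inE; case: eqVneq => //= ->; first by rewrite nodd.
rewrite /jw_sign.
have -> : [fset j in [fset n.*2; n.*2.+1] | (j < n.*2)%N] = fset0.
  apply/fsetP => k; rewrite !inE; apply/negbTE/negP.
  by move=> /andP[/orP[]/eqP-> ]; rewrite ?ltnn // ltnNge leqnSn.
rewrite cardfs0 expr0 mul1r.
have [->|//] := eqVneq z n.
have -> : [fset n.*2.+1] `\ n.*2.+1 = fset0.
  by apply/fsetP => k; rewrite !inE; case: eqVneq.
rewrite eqxx mulr1.
have -> : [fset j in [fset n.*2.+1] | (j < n.*2.+1)%N] = fset0.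
  apply/fsetP => k; rewrite !inE; apply/negbTE/negP.
  by move=> /andP[/eqP-> ]; rewrite ltnn.
by rewrite cardfs0 expr0.
Qed.

(** Terms with an annihilation operator on the right kill the vacuum, and among the pair creations
    only w = z = n reaches this state. The value is the same for all N > n, so the limit in
    [rho_Omega] is that of an eventually constant sequence. *)
Lemma normal_ordered_pair_state (C : bool -> bool -> nat -> nat -> R[i])
    (N n : nat) : (n < N)%N ->
  normal_ordered C N (@vacuum R) (pair_state n) = C true false n n.
Proof.
move=> nN; rewrite /normal_ordered.
rewrite (bigD1 (Ordinal nN)) //= [X in (_ + X)%R]big1 ?addr0; last first.
  move=> w wn; apply: big1 => z _.
  rewrite /b_an /d_an !annih_vacuum b_cr_d_cr_vacuum.
  rewrite /b_cr /d_cr !creat0 annih0.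
  have -> : (w == n :> nat) = false by apply: negbTE; exact: wn.
  by rewrite !mulr0 !addr0 subr0.
rewrite (bigD1 (Ordinal nN)) //= [X in (_ + X)%R]big1 ?addr0; last first.
  move=> z zn; rewrite /b_an /d_an !annih_vacuum b_cr_d_cr_vacuum.
  rewrite /b_cr /d_cr !creat0 annih0.
  have -> : (z == n :> nat) = false by apply: negbTE; exact: zn.
  by rewrite andbF !mulr0 !addr0 subr0.
rewrite /b_an /d_an !annih_vacuum b_cr_d_cr_vacuum.
rewrite /b_cr /d_cr !creat0 annih0 !eqxx.
by rewrite !mulr0 mulr1 add0r addr0 subr0.
Qed.
End FockPairs.

Lemma esum_lty_cvg0 (R : realType) (T : choiceType) (f : T -> R) (e : nat -> T) :
  injective e -> (forall x, 0 <= f x) ->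
  (\esum_(x in [set: T]) (f x)%:E < +oo)%E -> f (e n) @[n --> \oo] --> (0 : R).
Proof.
move=> inj f0 fy; apply: cvg_series_cvg_0.
apply: nnseries_is_cvg => [n|]; first exact: f0.
rewrite nneseries_esumT; last by move=> n; rewrite lee_fin.
rewrite -(@esum_image _ _ _ [set: nat] e (fun x => (f x)%:E)); last by move=> ? ? _ _ /inj.
apply: le_lt_trans fy.
rewrite [leLHS]esum_mkcond; apply: le_esum => x _.
by case: ifP => //; rewrite lee_fin.
Qed.

Lemma finite_fluctuations_cvg0 (R : realType) (Sigma : ptopologicalType)
    (M : atlas3 R Sigma) (vol : {finite_measure set (borel Sigma) -> \bar R})
    (chi : int -> Sigma -> 'cV[R[i]]_4) (lam : int -> R) (theta ph : nat -> R)
    (b : R) (h : R -> R[i]) (g : Sigma -> R[i]) :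
  finite_fluctuations M vol chi lam theta ph b ->
  test_function b h -> smooth_cfun M g ->
  normsq (rho_coef chi lam theta ph vol b h g true false n n) @[n --> \oo]
    --> (0 : R).
Proof.
move=> fin th sg; have := fin h g th sg.
move=> /(@esum_lty_cvg0 _ _ _ pair_state pair_state_inj).
under eq_fun do rewrite /rho_Omega
  (cvg_clim_eventually (fun N => @normal_ordered_pair_state R _ N _)).
by apply => x; rewrite /normsq addr_ge0 ?sqr_ge0.
Qed.

(** * Test functions *)

Section BumpSmooth.
Variable R : realType.

(** The derivative is taken on the inside, unlike in [derive1n], so that an induction can run
    through a class of functions stable under [derive1]. *)
Fixpoint Dn (n : nat) (f : R -> R) : Prop :=
  (forall x, derivable f x 1) /\ if n is k.+1 then Dn k (derive1 f) else True.

Lemma DnP f : (forall n, Dn n f) -> smooth_line f.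
Proof.
move=> H n; elim: n f H => [|n IH] f H x; first exact: (H 0%N).1.
rewrite /derive1n iterSr; apply: IH => k.
exact: (H k.+1).2.
Qed.

Lemma DnD n f g : Dn n f -> Dn n g -> Dn n (f \+ g).
Proof.
elim: n f g => [|n IH] f g /= [df Df] [dg Dg].
  by split => // x; exact: derivableD.
split; first by move=> x; exact: derivableD.
rewrite (_ : derive1 _ = (derive1 f) \+ (derive1 g)); first exact: IH.
by apply/funext => x; rewrite /= !derive1E deriveD.
Qed.

Variable a : R.
Hypothesis a0 : 0 < a.

(** For q = 1 and k = 0 this is the standard bump exp(-1/(a^2 - x^2)). The two parameters make the
    family stable under differentiation up to sums, so one computation of a derivative yields
    smoothness of all orders. *)
Definition bump_gen (q : {poly R}) (k : nat) (x : R) : R :=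
  if `|x| < a then q.[x] * (a ^+ 2 - x ^+ 2)^-1 ^+ k * expR (- (a ^+ 2 - x ^+ 2)^-1)
  else 0.

Lemma exp_pow_bound (k : nat) (r : R) : 0 <= r ->
  r ^+ k.+1 * expR (- r) <= k.+1`!%:R.
Proof.
move=> r0; rewrite expRN ler_pdivrMr ?expR_gt0 //.
have F0 : 0 < (k.+1`!%:R : R) by rewrite ltr0n fact_gt0.
have := expR_ge1Dxn k r0.
move=> H; rewrite [leRHS]mulrC -ler_pdivrMr //; apply: le_trans H; rewrite lerDr //.
Qed.

Lemma sqr_diff_gt0 (x : R) : `|x| < a -> 0 < a ^+ 2 - x ^+ 2.
Proof.
by move=> xa; rewrite subr_gt0 -(real_normK (num_real x)) ltr_sqr ?nnegrE ?(ltW a0).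
Qed.

(** The exponential beats every power of 1/(a^2 - x^2). Two powers of a^2 - x^2 are kept, which
    makes the function flat to first order at |x| = a. *)
Lemma bump_gen_bound (q : {poly R}) (k : nat) :
  exists2 C, 0 <= C & forall x, `|bump_gen q k x| <= C * (a ^+ 2 - x ^+ 2) ^+ 2.
Proof.
have [B qB] := poly_disk_bound q a.
have B0 : 0 <= B by apply: le_trans (qB 0 _); rewrite ?normr_ge0 // normr0 ltW.
exists (B * k.+2`!%:R) => [|x]; first by rewrite mulr_ge0.
rewrite /bump_gen; case: ifPn => xa; last first.
  by rewrite normr0 mulr_ge0 ?sqr_ge0 // mulr_ge0.
have d0 := sqr_diff_gt0 xa.
set d := a ^+ 2 - x ^+ 2 in d0 *.
have e0 := expR_gt0 (- d^-1).
rewrite !normrM -!mulrA; apply: ler_pM => //; first exact/qB/ltW.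
rewrite !ger0_norm ?exprn_ge0 ?invr_ge0 ?(ltW d0) ?(ltW e0) //.
have := exp_pow_bound k.+1 (_ : 0 <= d^-1).
rewrite invr_ge0 (ltW d0) => /(_ isT) H.
rewrite -(ler_pM2r (_ : 0 < d^-1 ^+ 2)) ?exprn_gt0 ?invr_gt0 //.
rewrite -[leRHS]mulrA -exprMn divff ?gt_eqF // expr1n mulr1.
by rewrite mulrAC -exprD addn2.
Qed.

Lemma bump_gen_inside (q : {poly R}) (k : nat) (x : R) : `|x| < a ->
  \forall y \near x, bump_gen q k y =
  q.[y] * (a ^+ 2 - y ^+ 2)^-1 ^+ k * expR (- (a ^+ 2 - y ^+ 2)^-1).
Proof.
move=> xa; have : \forall y \near x, `|y| < a.
  exact: (@cvgr_lt R R (nbhs x) _ (fun y : R => `|y|) `|x| (@norm_continuous _ R x) a xa).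
by apply: filterS => y ya; rewrite /bump_gen ya.
Qed.

Lemma is_derive_bump_gen (q : {poly R}) (k : nat) (x : R) :
  is_derive x 1 (bump_gen q k)
    (bump_gen q^`() k x + bump_gen (k%:R *: (q * (2%:R *: 'X))) k.+1 x
     + bump_gen (- (q * (2%:R *: 'X))) k.+2 x).
Proof.
have [xa|xa|xa] := ltgtP `|x| a.
- have d0 : a ^+ 2 - x ^+ 2 != 0.
    by rewrite gt_eqF // sqr_diff_gt0.
  apply: near_eq_is_derive.
    by apply: filterS (bump_gen_inside q k xa) => y ->.
  rewrite /bump_gen xa.
  set d := fun y : R => a ^+ 2 - y ^+ 2.
  have Hd : is_derive x 1 d (- (2 * x)).
    apply: is_derive_eq; rewrite /GRing.scale /=; ring.
  have Hr : is_derive x 1 (fun y => (d y)^-1) (2 * x * (d x)^-1 ^+ 2).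
    apply: (is_derive_eq (is_deriveV (d0 : d x != 0) Hd)).
    by rewrite /GRing.scale /= exprVn; ring.
  have He : is_derive x 1 (fun y => expR (- (d y)^-1))
      (expR (- (d x)^-1) * (- (2 * x * (d x)^-1 ^+ 2))).
    have Hn := is_deriveN Hr.
    exact: (is_derive1_comp (is_derive_expR _) Hn).
  have H := is_deriveM (is_deriveM (is_derive_poly q x) (is_deriveX k Hr)) He.
  rewrite [X in is_derive _ _ X](_ : _ = horner q * (fun y => (d y)^-1) ^+ k
    * (fun y => expR (- (d y)^-1))); last first.
    by apply/funext => y; rewrite !fctE.
  apply: (is_derive_eq H).
  rewrite (_ : (horner q * _) x = q.[x] * (d x)^-1 ^+ k); last by rewrite !fctE.
  rewrite (_ : (_ ^+ k) x = (d x)^-1 ^+ k); last by rewrite !fctE.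
  rewrite -/(d x) /GRing.scale /= !(hornerN, hornerZ, hornerM, hornerX).
  move: (d x)^-1 (expR _) q.[x] q^`().[x] => r e q0 q1.
  case: (k) => [|l]; first by rewrite mul0r; ring.
  by rewrite succnK; rewrite !exprS; move: (l.+1%:R : R) => z; ring.
- have -> : bump_gen q^`() k x + bump_gen (k%:R *: (q * (2%:R *: 'X))) k.+1 x
     + bump_gen (- (q * (2%:R *: 'X))) k.+2 x = 0.
    by rewrite /bump_gen ltNge (ltW xa) /= !addr0.
  apply: (near_eq_is_derive _ (is_derive_cst (0 : R) x 1)).
  have : \forall y \near x, a < `|y|.
    exact: (@cvgr_gt R R (nbhs x) _ (fun y : R => `|y|) `|x| (@norm_continuous _ R x) a xa).
  by apply: filterS => y ya; rewrite /bump_gen ltNge (ltW ya).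
- have -> : bump_gen q^`() k x + bump_gen (k%:R *: (q * (2%:R *: 'X))) k.+1 x
     + bump_gen (- (q * (2%:R *: 'X))) k.+2 x = 0.
    by rewrite /bump_gen xa ltxx /= !addr0.
  have [C C0 HC] := bump_gen_bound q k.
  have fx0 : bump_gen q k x = 0 by rewrite /bump_gen xa ltxx.
  have xx : x ^+ 2 = a ^+ 2 by rewrite -xa real_normK ?num_real.
  (* As x^2 = a^2, the bound at h + x is C h^2 (2x + h)^2, and |2x + h| <= 2a + 1 once |h| <= 1;
     hence the difference quotient is O(|h|). *)
  have cv : h^-1 *: (bump_gen q k (h *: 1 + x) - bump_gen q k x) @[h --> 0^'] --> (0 : R).
    apply/cvgr0Pnorm_le => e e0.
    near=> h.
    have h0 : h != 0 by near: h; exact: nbhs_dnbhs_neq.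
    have nh0 : 0 < `|h| by rewrite normr_gt0.
    have h1 : `|h| <= 1.
      by near: h; exact: dnbhs0_le.
    have he : `|h| <= e / (C * (2 * a + 1) ^+ 2 + 1).
      near: h; apply: dnbhs0_le.
      by rewrite divr_gt0 // ltr_wpDl // mulr_ge0 // sqr_ge0.
    rewrite fx0 subr0 /GRing.scale /= mulr1 normrM normfV ler_pdivrMl //.
    apply: (le_trans (HC _)).
    have -> : (a ^+ 2 - (h + x) ^+ 2) ^+ 2 = h ^+ 2 * (2 * x + h) ^+ 2.
      by rewrite -xx; ring.
    have hh : h ^+ 2 = `|h| * `|h| by rewrite -expr2 real_normK ?num_real.
    have H2 : (2 * x + h) ^+ 2 <= (2 * a + 1) ^+ 2.
      rewrite -[leLHS]real_normK ?num_real // ler_sqr ?nnegrE //; last first.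
        by rewrite addr_ge0 // mulr_ge0 // ltW.
      apply: (le_trans (ler_normD _ _)); apply: lerD => //.
      by rewrite normrM xa ger0_norm.
    rewrite hh -!mulrA mulrCA ler_pM2l // mulrCA.
    apply: (@le_trans _ _ (`|h| * (C * (2 * a + 1) ^+ 2 + 1))).
      rewrite ler_pM2l //; apply: (le_trans (ler_wpM2l C0 H2)); by rewrite lerDl.
    by rewrite -ler_pdivlMr // ltr_wpDl // mulr_ge0 // sqr_ge0.
  apply: DeriveDef; first by apply/cvg_ex; exists 0.
  by apply/cvg_lim.
Unshelve. all: by end_near. Qed.

Lemma smooth_bump_gen (q : {poly R}) (k : nat) : smooth_line (bump_gen q k).
Proof.
apply: DnP => n; elim: n q k => [|n IH] q k /=; split => //.
- by move=> x; apply: ex_derive; exact: is_derive_bump_gen.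
- by move=> x; apply: ex_derive; exact: is_derive_bump_gen.
have -> : derive1 (bump_gen q k) = (bump_gen q^`() k \+
    bump_gen (k%:R *: (q * (2%:R *: 'X))) k.+1)
    \+ bump_gen (- (q * (2%:R *: 'X))) k.+2.
  apply/funext => x; rewrite derive1E.
  by apply: derive_val; exact: is_derive_bump_gen.
by apply: DnD => //; apply: DnD.
Qed.
End BumpSmooth.

Lemma smooth_cst0 (R : realType) : smooth_line (cst (0 : R)).
Proof.
move=> n x; have -> : derive1n n (cst (0 : R)) = cst 0.
  elim: n => [//|n IH]; rewrite derive1nS IH.
  by apply/funext => y; rewrite derive1_cst.
exact: derivable_cst.
Qed.

Lemma continuous_integrable_oo (R : realType) (h : R -> R) (b : R) :
  continuous h -> lebesgue_measure.-integrable `]-b, b[ (EFin \o h).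
Proof.
move=> ch; apply: (@integrableS _ _ _ lebesgue_measure `[- b, b]%classic) => //.
  exact: subset_itv_oo_cc.
apply: continuous_compact_integrable; first exact: segment_compact.
exact: continuous_subspaceT.
Qed.

Lemma exists_test_function (R : realType) (b : R) : 0 < b ->
  exists h : R -> R, [/\ test_function b (fun t => (h t)%:C%C),
    forall t, 0 <= h t, continuous h &
    0 < Rintegral lebesgue_measure `]-b, b[ h].
Proof.
(* Half of the width keeps the closed support inside the open interval; the minimum over
   [[- (b / 4), b / 4]] later bounds the integral from below. *)
move=> b0; pose h := bump_gen (b / 2) 1 0.
have b20 : 0 < b / 2 by rewrite divr_gt0.
have sh : smooth_line h by exact: smooth_bump_gen.
have ch : continuous h.
  by move=> x; apply: differentiable_continuous; apply/derivable1_diffP; exact: (sh 0%N).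
have h0 x : 0 <= h x.
  by rewrite /h /bump_gen; case: ifP => // _; rewrite hornerC expr0 !mul1r expR_ge0.
have hpos x : `|x| < b / 2 -> 0 < h x.
  by move=> xb; rewrite /h /bump_gen xb hornerC expr0 !mul1r expR_gt0.
have hout x : h x != 0 -> x \in `[- (b / 2), b / 2].
  rewrite /h /bump_gen; case: ifPn; last by rewrite eqxx.
  by rewrite ltr_norml in_itv /= => /andP[/ltW -> /ltW ->].
have sub : closure [set t | (h t)%:C%C != 0] `<=` `[- (b / 2), b / 2].
  rewrite closureE; apply: smallest_sub; first exact: interval_closed.
  by move=> x /=; rewrite eq_complex /= eqxx andbT; exact: hout.
exists h; split => //.
- split => //=.
  + rewrite (_ : (fun t => _) = cst 0) //; exact: smooth_cst0.
  + apply: subclosed_compact (@segment_compact _ _ _) sub.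
    exact: closed_closure.
  + move=> x /sub /=; rewrite !in_itv /= => /andP[x1 x2]; apply/andP; split; lra.
- have [e e0 he] : exists2 e, 0 < e & forall x, x \in `[- (b / 4), b / 4] -> e <= h x.
    have b44 : - (b / 4) <= b / 4 by lra.
    have [c c1 hc] := EVT_min b44 (continuous_subspaceT ch).
    exists (h c) => //; apply: hpos; rewrite ltr_norml.
    by move: c1; rewrite in_itv /= => /andP[c1 c2]; apply/andP; split; lra.
  have mh A : measurable_fun A (EFin \o h).
    apply/measurable_EFinP/measurable_funTS; exact: continuous_measurable_fun.
  have ihb := continuous_integrable_oo b ch.
  pose Ib := `]-b, b[%classic : set R.
  pose Jb := `[- (b / 4), b / 4]%classic : set R.
  have : ((e * (b / 2))%:E <= \int[lebesgue_measure]_(x in Ib) (h x)%:E)%E.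
    apply: (@le_trans _ _ (\int[lebesgue_measure]_(x in Jb) (h x)%:E)%E); last first.
      apply: ge0_subset_integral; [exact: measurable_itv|exact: measurable_itv|exact: mh| |].
        by move=> x _; rewrite lee_fin.
      by move=> x; rewrite /Ib /Jb /= !in_itv /= => /andP[x1 x2]; apply/andP; split; lra.
    apply: (@le_trans _ _ (\int[lebesgue_measure]_(x in Jb) (cst e%:E x))%E); last first.
      apply: ge0_le_integral => //; first exact: measurable_itv.
      - by move=> x _; rewrite /= lee_fin ltW.
      - exact: mh.
    rewrite integral_cst; last exact: measurable_itv.
    have mJ : lebesgue_measure Jb = (b / 2)%:E.
      rewrite /Jb lebesgue_measure_itv /= lte_fin ifT; last by lra.
      by rewrite -EFinB; congr EFin; field.
    rewrite [X in (_ * X)%E](_ : _ = (b / 2)%:E); last exact: mJ.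
    by rewrite -EFinM.
  have finb : (\int[lebesgue_measure]_(x in Ib) (h x)%:E)%E \is a fin_num.
    by apply: integrable_fin_num ihb; exact: measurable_itv.
  rewrite -(fineK finb) lee_fin; apply: lt_le_trans; by rewrite mulr_gt0.
Qed.

(** * Diagonal matrix elements of the energy density *)

Section DiagonalCoefficient.
Variable R : realType.

Lemma cisD (x y : R) : cis (x + y) = cis x * cis y.
Proof. by rewrite /cis cosD sinD; apply/eqP; rewrite eq_complex /= eqxx addrC eqxx. Qed.

Lemma conjc_cis (x : R) : conjc (cis x) = cis (- x).
Proof. by rewrite /cis cosN sinN. Qed.

Lemma cisN_mul (x : R) : cis x * cis (- x) = 1.
Proof. by rewrite -cisD subrr /cis cos0 sin0. Qed.

Lemma conjcM (u v : R[i]) : conjc (u * v) = conjc u * conjc v.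
Proof. exact: rmorphM. Qed.

Lemma conjcN (u : R[i]) : conjc (- u) = - conjc u.
Proof. exact: rmorphN. Qed.

Lemma real_complexD (x y : R) : (x + y)%:C = x%:C + y%:C.
Proof. exact: rmorphD. Qed.

Lemma real_complexM (x y : R) : (x * y)%:C = x%:C * y%:C.
Proof. exact: rmorphM. Qed.

Lemma conjc_real (x : R) : conjc x%:C = x%:C.
Proof. by rewrite /= oppr0. Qed.

Lemma conjc_i : conjc 'i%C = - 'i%C :> R[i].
Proof. by apply/eqP; rewrite eq_complex /= oppr0 !eqxx. Qed.

Lemma normsqM (u v : R[i]) : normsq (u * v) = normsq u * normsq v.
Proof. by case: u => a b; case: v => c d; rewrite /normsq /=; ring. Qed.

Lemma normsqN (u : R[i]) : normsq (- u) = normsq u.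
Proof. by case: u => a b; rewrite /normsq /= !sqrrN. Qed.

Lemma normsq_cis (x : R) : normsq (cis x) = 1.
Proof. by rewrite /normsq /cis /= cos2Dsin2. Qed.

Lemma normsq_real (x : R) : normsq x%:C = x ^+ 2.
Proof. by rewrite /normsq /= expr0n addr0. Qed.

Lemma conjcM_self (u : R[i]) : conjc u * u = (normsq u)%:C.
Proof.
by case: u => a b; rewrite /normsq; apply/eqP; rewrite eq_complex /=;
  apply/andP; split; apply/eqP; ring.
Qed.

Lemma cderive_cis2 (z1 z2 : R[i]) (l1 l2 t : R) :
  cderive (fun s => z1 * cis (- (l1 * s)) + z2 * cis (- (l2 * s))) t =
  - 'i%C * l1%:C * z1 * cis (- (l1 * t)) - 'i%C * l2%:C * z2 * cis (- (l2 * t)).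
Proof.
case: z1 => a1 b1; case: z2 => a2 b2; rewrite /cderive /cis /=.
rewrite !derive1E.
have -> : 'D_1 (fun s : R => a1 * cos (- (l1 * s)) - b1 * sin (- (l1 * s)) +
  (a2 * cos (- (l2 * s)) - b2 * sin (- (l2 * s)))) t =
   l1 * (a1 * sin (- (l1 * t)) + b1 * cos (- (l1 * t)))
   + l2 * (a2 * sin (- (l2 * t)) + b2 * cos (- (l2 * t))).
  apply: derive_val; apply: is_derive_eq; rewrite /GRing.scale /=; ring.
have -> : 'D_1 (fun s : R => a1 * sin (- (l1 * s)) + b1 * cos (- (l1 * s)) +
  (a2 * sin (- (l2 * s)) + b2 * cos (- (l2 * s)))) t =
   l1 * (- a1 * cos (- (l1 * t)) + b1 * sin (- (l1 * t)))
   + l2 * (- a2 * cos (- (l2 * t)) + b2 * sin (- (l2 * t))).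
  apply: derive_val; apply: is_derive_eq; rewrite /GRing.scale /=; ring.
by apply/eqP; rewrite eq_complex /=; apply/andP; split; apply/eqP; ring.
Qed.

Lemma adjD n (u v : 'cV[R[i]]_n) : adj (u + v) = adj u + adj v.
Proof. by apply/matrixP => i j; rewrite !mxE raddfD. Qed.

Lemma adjZ n (c : R[i]) (u : 'cV[R[i]]_n) : adj (c *: u) = conjc c *: adj u.
Proof. by apply/matrixP => i j; rewrite !mxE rmorphM. Qed.

Lemma gamma0_sq : gamma0 *m gamma0 = 1%:M :> 'M[R[i]]_4.
Proof.
rewrite /gamma0 (@mulmx_block _ 2 2 2 2 2 2) !mul0mx !mulmx0 !addr0 !add0r.
by rewrite mulNmx mulmxN opprK !mulmx1 -scalar_mx_block.
Qed.

Lemma adj_self (u : 'cV[R[i]]_4) :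
  (adj u *m u) 0 0 = (\sum_(a < 4) normsq (u a 0))%:C.
Proof.
rewrite mxE rmorph_sum /=; apply: eq_bigr => a _.
by rewrite !mxE conjcM_self.
Qed.

(** The [gamma0] in the Dirac adjoint cancels the explicit one, which leaves the Hermitian product
    of C^4. *)
Lemma sesquilinear2 (a1 a2 b1 b2 : R[i]) (P M : 'cV[R[i]]_4) :
  (dirac_adj (a1 *: P + a2 *: M) *m gamma0 *m (b1 *: P + b2 *: M)) 0 0 =
  conjc a1 * b1 * (adj P *m P) 0 0 + conjc a1 * b2 * (adj P *m M) 0 0
  + conjc a2 * b1 * (adj M *m P) 0 0 + conjc a2 * b2 * (adj M *m M) 0 0.
Proof.
rewrite /dirac_adj -!mulmxA [gamma0 *m (_ *m _)]mulmxA gamma0_sq mul1mx.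
rewrite adjD !adjZ mulmxDl !mulmxDr -!scalemxAl -!scalemxAr.
have entry (k1 k2 k3 k4 : R[i]) (X1 X2 X3 X4 : 'M[R[i]]_1) :
    (k1 *: X1 + k2 *: X2 + (k3 *: X3 + k4 *: X4)) 0 0 =
    k1 * X1 0 0 + k2 * X2 0 0 + k3 * X3 0 0 + k4 * X4 0 0.
  by rewrite !mxE addrA.
rewrite !scalerA entry.
move: (adj P *m P) (adj P *m M) (adj M *m P) (adj M *m M) => PP PM MP MM; ring.
Qed.

Variables (Sigma : ptopologicalType).
Variables (chi : int -> Sigma -> 'cV[R[i]]_4) (lam : int -> R).
Variables (theta ph : nat -> R).
Variable n : nat.
Hypothesis lam_opp : lam (- n.+1%:Z) = - lam n.+1%:Z.

Let P := chi n.+1%:Z.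
Let M := chi (- n.+1%:Z).
Let l := lam n.+1%:Z.
Let c : R[i] := (cos (theta n))%:C.
Let s : R[i] := (sin (theta n))%:C.

Lemma kappaf_plusE t x : kappaf chi lam theta ph true n t x =
  (c * cis (- (l * t))) *: P x + (cis (- ph n) * s * cis (l * t)) *: M x.
Proof.
by rewrite /kappaf /kappa !scalerA lam_opp -/l -/P -/M mulNr opprK.
Qed.

Lemma kappaf_minusE t x : kappaf chi lam theta ph false n t x =
  (- (cis (ph n) * s * cis (- (l * t)))) *: P x + (c * cis (l * t)) *: M x.
Proof.
by rewrite /kappaf /kappa !scalerA lam_opp -/l -/P -/M mulNr opprK scaleNr addrC.
Qed.

Lemma kappaf_dot_plusE t x : kappaf_dot chi lam theta ph true n t x =
  (- 'i%C * l%:C * c * cis (- (l * t))) *: P x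
  + ('i%C * l%:C * cis (- ph n) * s * cis (l * t)) *: M x.
Proof.
apply/matrixP => a j; rewrite /kappaf_dot mxE.
rewrite (_ : (fun t' => _) = (fun t' => c * P x a 0 * cis (- (l * t'))
   + (cis (- ph n) * s * M x a 0) * cis (- (- l * t')))); last first.
  apply/funext => t'; rewrite kappaf_plusE !mxE.
  by rewrite (_ : - (- l * t') = l * t'); ring.
have e1 : - (- l * t) = l * t by ring.
have e2 : (- l)%:C = - l%:C by rewrite rmorphN.
by rewrite cderive_cis2 !mxE (ord1 j) e1 e2; ring.
Qed.

Lemma kappaf_dot_minusE t x : kappaf_dot chi lam theta ph false n t x =
  ('i%C * l%:C * cis (ph n) * s * cis (- (l * t))) *: P x
  + ('i%C * l%:C * c * cis (l * t)) *: M x.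
Proof.
apply/matrixP => a j; rewrite /kappaf_dot mxE.
rewrite (_ : (fun t' => _) = (fun t' => - (cis (ph n) * s * P x a 0) * cis (- (l * t'))
   + (c * M x a 0) * cis (- (- l * t')))); last first.
  apply/funext => t'; rewrite kappaf_minusE !mxE.
  by rewrite (_ : - (- l * t') = l * t'); ring.
have e1 : - (- l * t) = l * t by ring.
have e2 : (- l)%:C = - l%:C by rewrite rmorphN.
by rewrite cderive_cis2 !mxE (ord1 j) e1 e2; ring.
Qed.

(* The cross terms in [adj P *m M] cancel between the two summands, and the
   phases [cis (l * t)], [cis (- (l * t))] of the diagonal ones multiply to 1. *)
Lemma rho_density_diag t x :
  'i%C / 2%:R *
  (dirac_adj (kappaf chi lam theta ph true n t x) *m gamma0
     *m kappaf_dot chi lam theta ph false n t x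
   - dirac_adj (kappaf_dot chi lam theta ph true n t x) *m gamma0
     *m kappaf chi lam theta ph false n t x) 0 0 =
  - (l%:C * c * s * cis (ph n)) *
   (\sum_(a < 4) normsq (P x a 0) + \sum_(a < 4) normsq (M x a 0))%:C.
Proof.
rewrite mxE [X in _ + X]mxE kappaf_plusE kappaf_minusE kappaf_dot_plusE kappaf_dot_minusE.
rewrite !sesquilinear2 real_complexD -!adj_self.
rewrite !(conjcM, conjcN, conjc_cis, conjc_i) /c /s !conjc_real -/c -/s !opprK.
set E := cis (l * t); set E' := cis (- (l * t)).
set e := cis (ph n).
have EE : E * E' = 1 by exact: cisN_mul.
have i2 : 'i%C * 'i%C = -1 :> R[i] by rewrite -expr2 sqr_i.
set PP := (_ *m _) 0 0; set MM := (adj (M x) *m M x) 0 0.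
transitivity (('i%C * 'i%C) * (E * E') * (l%:C * c * s * e * (PP + MM))).
  by field.
by rewrite EE i2; ring.
Qed.
End DiagonalCoefficient.

Lemma cint_realZ d (T : measurableType d) (R : realType)
    (mu : {measure set T -> \bar R}) (D : set T) (K : R[i]) (f : T -> R) :
  measurable D -> mu.-integrable D (EFin \o f) ->
  cint mu D (fun x => K * (f x)%:C) = K * (Rintegral mu D f)%:C.
Proof.
move=> mD fi; rewrite /cint; case: K => a b /=.
rewrite (_ : (fun x => a * f x - b * 0) = (fun x => a * f x)); last first.
  by apply/funext => x; rewrite mulr0 subr0.
rewrite (_ : (fun x => a * 0 + b * f x) = (fun x => b * f x)); last first.
  by apply/funext => x; rewrite mulr0 add0r.
rewrite !RintegralZl //; apply/eqP; rewrite eq_complex /= !mulr0 subr0 add0r.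
by rewrite !eqxx.
Qed.

Lemma ge0_integral_prod d1 d2 (T1 : measurableType d1) (T2 : measurableType d2)
    (R : realType) (m1 : {sigma_finite_measure set T1 -> \bar R})
    (m2 : {sigma_finite_measure set T2 -> \bar R}) (D : set T1)
    (f : T1 -> R) (g : T2 -> R) :
  measurable D -> measurable_fun setT f -> measurable_fun setT g ->
  (forall x, 0 <= f x) -> (forall y, 0 <= g y) ->
  (\int[m1 \x m2]_(z in D `*` setT) (f z.1 * g z.2)%:E =
   \int[m1]_(x in D) (f x)%:E * \int[m2]_y (g y)%:E)%E.
Proof.
move=> mD mf mg f0 g0.
have mfE : measurable_fun setT ((EFin \o f) \_ D).
  by apply/(measurable_restrict _ mD measurableT); apply/measurable_funTS/measurable_EFinP.
have fE0 x : (0 <= ((EFin \o f) \_ D) x)%E.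
  by rewrite patchE; case: ifP => //= _; rewrite lee_fin.
rewrite integral_mkcond.
rewrite (_ : _ \_ _ = fun z => (((EFin \o f) \_ D) z.1 * (g z.2)%:E)%E); last first.
  apply/funext => -[x y] /=; rewrite !patchE in_setX /= in_setT andbT.
  by case: ifP => // _; rewrite mul0e.
rewrite fubini_tonelli1 //=; last 2 first.
- apply: emeasurable_funM.
    exact: (measurableT_comp mfE measurable_fst).
  by apply/measurable_EFinP; exact: (measurableT_comp mg measurable_snd).
- by move=> z; rewrite mule_ge0 // lee_fin.
rewrite [in RHS]integral_mkcond -ge0_integralZr //; last first.
  by apply: integral_ge0 => y _; rewrite lee_fin.
apply: eq_integral => x _; rewrite /fubini_F /= ge0_integralZl //.
- exact/measurable_EFinP.
- by move=> y _; rewrite lee_fin.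
Qed.

Section RhoCoef.
Variables (R : realType) (Sigma : ptopologicalType).
Variable vol : {finite_measure set (borel Sigma) -> \bar R}.
Variables (chi : int -> Sigma -> 'cV[R[i]]_4) (lam : int -> R).
Variables (theta ph : nat -> R).

Lemma measurable_density (u : Sigma -> 'cV[R[i]]_4) : in_L2 vol u ->
  measurable_fun [set: borel Sigma] (fun x => \sum_(a < 4) normsq (u x a 0)).
Proof.
move=> [mu _]; apply: measurable_sum => a.
by apply: measurable_funD; apply: measurable_funX; case: (mu a).
Qed.

Lemma density_ge0 (u : 'cV[R[i]]_4) : 0 <= \sum_(a < 4) normsq (u a 0).
Proof. by apply: sumr_ge0 => a _; rewrite addr_ge0 ?sqr_ge0. Qed.

Lemma norm2sq_inner2 (u : Sigma -> 'cV[R[i]]_4) : in_L2 vol u ->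
  norm2sq vol u = (complex.Re (inner2 vol u u))%:E.
Proof.
move=> uL; rewrite /inner2 /cint /= /Rintegral.
under eq_integral do rewrite adj_self /=.
rewrite fineK // ge0_fin_numE; first by case: uL.
by apply: integral_ge0 => x _; rewrite lee_fin density_ge0.
Qed.

(** The density depends on time only through h, so the integral factors; the 2 is the sum of the
    squared norms of the two modes. For nonnegative h, Tonelli's theorem gives the value and the
    integrability together. *)
Lemma rho_coef_diag (b : R) (h : R -> R) (n : nat) :
  lam (- n.+1%:Z) = - lam n.+1%:Z ->
  in_L2 vol (chi n.+1%:Z) -> in_L2 vol (chi (- n.+1%:Z)) ->
  inner2 vol (chi n.+1%:Z) (chi n.+1%:Z) = 1 ->
  inner2 vol (chi (- n.+1%:Z)) (chi (- n.+1%:Z)) = 1 ->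
  (forall t, 0 <= h t) -> continuous h ->
  rho_coef chi lam theta ph vol b (fun t => (h t)%:C) (fun=> 1) true false n n =
  - ((lam n.+1%:Z)%:C * (cos (theta n))%:C * (sin (theta n))%:C * cis (ph n)) *
   (Rintegral lebesgue_measure `]-b, b[ h * 2)%:C.
Proof.
move=> lo LP LM NP NM h0 ch.
set p := fun x : borel Sigma => \sum_(a < 4) normsq (chi n.+1%:Z x a 0)
  + \sum_(a < 4) normsq (chi (- n.+1%:Z) x a 0).
have mp : measurable_fun setT p.
  by apply: measurable_funD; exact: measurable_density.
have p0 x : 0 <= p x by rewrite addr_ge0 // density_ge0.
have mh : measurable_fun setT h by exact: continuous_measurable_fun.
have ip : (\int[vol]_x (p x)%:E)%E = (2 : R)%:E.
  under eq_integral do rewrite EFinD.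
  rewrite ge0_integralD //.
  - rewrite -/(norm2sq vol (chi n.+1%:Z)) -/(norm2sq vol (chi (- n.+1%:Z))).
    by rewrite !norm2sq_inner2 // NP NM -EFinD.
  - by move=> x _; rewrite lee_fin density_ge0.
  - by apply/measurable_EFinP; exact: measurable_density.
  - by move=> x _; rewrite lee_fin density_ge0.
  - by apply/measurable_EFinP; exact: measurable_density.
pose D := `]-b, b[%classic : set R.
have mD : measurable (D `*` [set: borel Sigma] : set (R * borel Sigma)).
  by apply: measurableX; [exact: measurable_itv|exact: measurableT].
have ih := continuous_integrable_oo b ch.
have hp : (\int[(lebesgue_measure \x vol)%E]_(z in D `*` [set: borel Sigma])
    ((h z.1 * p z.2)%R)%:E)%E = (Rintegral lebesgue_measure `]-b, b[ h * 2)%:E.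
  rewrite ge0_integral_prod //; last exact: measurable_itv.
  rewrite (_ : (\int[_]_y (p y)%:E)%E = (2 : R)%:E); last exact: ip.
  rewrite EFinM /Rintegral fineK //.
  exact: integrable_fin_num.
rewrite /rho_coef.
rewrite (_ : (fun tx : R * borel Sigma => _) = (fun tx : R * borel Sigma =>
   - ((lam n.+1%:Z)%:C * (cos (theta n))%:C * (sin (theta n))%:C * cis (ph n)) *
   (h tx.1 * p tx.2)%:C)); last first.
  apply/funext => -[t x] /=; rewrite rho_density_diag // -/(p x) real_complexM mulr1; ring.
rewrite cint_realZ //.
  by rewrite /Rintegral hp.
apply/integrableP; split.
  apply/measurable_EFinP; apply: measurable_funTS; apply: measurable_funM.
    exact: (measurableT_comp mh measurable_fst).
  exact: (measurableT_comp mp measurable_snd).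
under eq_integral do rewrite gee0_abs ?lee_fin ?mulr_ge0 //.
by rewrite hp ltry.
Qed.

(** The factor 2 turns cos theta sin theta into sin (2 theta), and the phase [cis (ph n)] has
    modulus 1. *)
Lemma normsq_rho_coef_diag (b : R) (h : R -> R) (n : nat) :
  lam (- n.+1%:Z) = - lam n.+1%:Z ->
  in_L2 vol (chi n.+1%:Z) -> in_L2 vol (chi (- n.+1%:Z)) ->
  inner2 vol (chi n.+1%:Z) (chi n.+1%:Z) = 1 ->
  inner2 vol (chi (- n.+1%:Z)) (chi (- n.+1%:Z)) = 1 ->
  (forall t, 0 <= h t) -> continuous h ->
  normsq (rho_coef chi lam theta ph vol b (fun t => (h t)%:C) (fun=> 1) true false n n) =
  lam n.+1%:Z ^+ 2 * sin (2 * theta n) ^+ 2 * Rintegral lebesgue_measure `]-b, b[ h ^+ 2.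
Proof.
move=> lo LP LM NP NM h0 ch; rewrite rho_coef_diag //.
rewrite normsqM normsqN !normsqM !normsq_real normsq_cis.
by rewrite mulr_natl sin_mulr2n; ring.
Qed.
End RhoCoef.

(** * Integration over coordinate boxes *)

Lemma row3_ballP (R : realType) (x : 'rV[R]_3) (P : set 'rV[R]_3) :
  nbhs x P <-> exists2 e, 0 < e &
    forall y : 'rV[R]_3, (forall j, `|x 0 j - y 0 j| < e) -> P y.
Proof.
split.
  move=> /nbhs_ballP[e /= e0 eP]; exists e => // y xy; apply: eP.
  by split => // i j; rewrite (ord1 i); exact: xy.
move=> [e e0 eP]; apply/nbhs_ballP; exists e => // y [_ xy].
by apply: eP => j; exact: xy.
Qed.

Lemma vec3E (R : realType) (t : R * R * R) :
  (vec3 t 0 0 = t.1.1) * (vec3 t 0 1 = t.1.2) * (vec3 t 0 2%:R = t.2).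
Proof. by rewrite /vec3 !mxE. Qed.

Lemma ord3P (P : 'I_3 -> Prop) : P 0 -> P 1 -> P 2%:R -> forall j, P j.
Proof.
move=> P0 P1 P2 [[|[|[|//]]] Hj].
- by rewrite (_ : Ordinal Hj = 0) //; apply: val_inj.
- by rewrite (_ : Ordinal Hj = 1) //; apply: val_inj.
- by rewrite (_ : Ordinal Hj = 2%:R) //; apply: val_inj.
Qed.

Lemma sum3E (V : zmodType) (F : 'I_3 -> V) : \sum_(k < 3) F k = F 0 + F 1 + F 2%:R.
Proof.
rewrite !big_ord_recr big_ord0 /= add0r; congr (F _ + F _ + F _); exact: val_inj.
Qed.

(** This links the topology of row vectors with the product sigma-algebra on triples: an open set is
    a countable union of cubes with rational centres, and each of these is a measurable product. *)
Lemma measurable_vec3_open (R : realType) (O : set 'rV[R]_3) : open O ->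
  measurable ((@vec3 R @^-1` O) : set (measurableTypeR R * measurableTypeR R * measurableTypeR R)).
Proof.
move=> oO.
pose B (q1 q2 q3 : rat) (n : nat) : set 'rV[R]_3 :=
  [set x | [/\ `|x 0 0 - ratr q1| < n.+1%:R^-1, `|x 0 1 - ratr q2| < n.+1%:R^-1 &
    `|x 0 2%:R - ratr q3| < n.+1%:R^-1]].
pose b (q : rat) (n : nat) : set (measurableTypeR R) := [set a : R | `|a - ratr q| < n.+1%:R^-1].
have mb q n : measurable (b q n).
  rewrite (_ : b q n = ball (ratr q : R) n.+1%:R^-1); first exact: measurable_ball.
  by apply/seteqP; split => a; rewrite /b /ball /= distrC.
rewrite (_ : _ @^-1` _ = \bigcup_q1 \bigcup_q2 \bigcup_q3 \bigcup_n
    ([set _ | B q1 q2 q3 n `<=` O] `&` ((b q1 n `*` b q2 n) `*` b q3 n))).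
  apply: bigcupT_measurable_rat => q1; apply: bigcupT_measurable_rat => q2.
  apply: bigcupT_measurable_rat => q3; apply: bigcupT_measurable => n.
  apply: measurableI; last by apply: measurableX; [apply: measurableX|]; exact: mb.
  have [BO|BO] := pselect (B q1 q2 q3 n `<=` O).
    by rewrite (_ : mkset _ = setT) //; apply/seteqP; split.
  by rewrite (_ : mkset _ = set0) //; apply/seteqP; split.
apply/seteqP; split; last first.
  move=> [[a1 a2] a3] [q1 _ [q2 _ [q3 _ [n _ [BO [[/= H1 H2] H3]]]]]]; apply: BO.
  by split; rewrite vec3E.
move=> [[a1 a2] a3] /= Oa.
have [e e0 eO] : exists2 e, 0 < e & forall y : 'rV[R]_3,
    (forall j, `|vec3 (a1, a2, a3) 0 j - y 0 j| < e) -> O y.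
  by apply/row3_ballP; move: oO; rewrite openE; apply.
(* A cube of this half-side that contains the point lies within distance e of it. *)
have [n ne] : exists n : nat, n.+1%:R^-1 < e / 2.
  have e20 : 0 < e / 2 by rewrite divr_gt0.
  have [n _ Hn] := near_infty_natSinv_lt (PosNum e20).
  by exists n; apply: (Hn n) => /=.
have n0 : 0 < n.+1%:R^-1 :> R by rewrite invr_gt0.
have rq (a : R) : exists q : rat, `|a - ratr q| < n.+1%:R^-1.
  have [q] : exists q : rat, ratr q \in `](a - n.+1%:R^-1), (a + n.+1%:R^-1)[.
    by apply: rat_in_itvoo; rewrite ltrBlDr -addrA ltrDl addr_gt0.
  by move=> qI; exists q; move: qI; rewrite in_itv /= ltr_distlC.
have [q1 H1] := rq a1; have [q2 H2] := rq a2; have [q3 H3] := rq a3.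
exists q1 => //; exists q2 => //; exists q3 => //; exists n => //.
split; last by split.
move=> x [x1 x2 x3]; apply: eO.
have tri (u v w : R) : `|u - w| < n.+1%:R^-1 -> `|v - w| < n.+1%:R^-1 -> `|u - v| < e.
  move=> uw vw; rewrite (_ : u - v = (u - w) - (v - w)); last by ring.
  apply: (le_lt_trans (ler_normB _ _)); rewrite (splitr e).
  by apply: ltrD; [exact: lt_trans uw ne|exact: lt_trans vw ne].
by apply: ord3P; rewrite vec3E /=; [apply: tri H1 x1|apply: tri H2 x2|apply: tri H3 x3].
Qed.

Section Box.
Variables (R : realType) (x0 : 'rV[R]_3) (r : R).
Hypothesis r0 : 0 < r.
Local Notation T3 := (measurableTypeR R * measurableTypeR R * measurableTypeR R)%type.

Definition box : set 'rV[R]_3 := [set x | forall j, `|x 0 j - x0 0 j| <= r].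

Definition box3 : set T3 := [set t | box (vec3 t)].

Definition side (j : 'I_3) : set (measurableTypeR R) :=
  `[x0 0 j - r, x0 0 j + r]%classic.

Lemma sideP j a : side j a <-> `|a - x0 0 j| <= r.
Proof.
by rewrite /side /= in_itv /= ler_distl.
Qed.

Lemma box3E : box3 = (side 0 `*` side 1) `*` side 2%:R.
Proof.
apply/seteqP; split => -[[a b] c]; rewrite /box3 /box /=.
  move=> H; split; first split; apply/sideP.
  - by have := H 0; rewrite vec3E.
  - by have := H 1; rewrite vec3E.
  - by have := H 2%:R; rewrite vec3E.
by move=> [[/sideP H1 /sideP H2] /sideP H3]; apply: ord3P; rewrite vec3E.
Qed.

Lemma measurable_side j : measurable (side j).
Proof. exact: measurable_itv. Qed.

Lemma measurable_box3 : measurable box3.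
Proof.
rewrite box3E; apply: measurableX; last exact: measurable_side.
by apply: measurableX; exact: measurable_side.
Qed.

Lemma measure_side j : lebesgue_measure (side j) = (r *+ 2)%:E.
Proof.
rewrite /side lebesgue_measure_itv /= lte_fin ltrBlDr -addrA ltrDl addr_gt0 //.
by rewrite -EFinB; congr EFin; ring.
Qed.

Lemma measure_box3 : leb3 box3 = (r *+ 2 * (r *+ 2) * (r *+ 2))%:E.
Proof.
have H2 : (lebesgue_measure \x lebesgue_measure)%E (side 0 `*` side 1) =
    (r *+ 2 * (r *+ 2))%:E.
  etransitivity; first by apply: product_measure1E; exact: measurable_side.
  by rewrite EFinM; congr (_ * _)%E; exact: measure_side.
rewrite box3E /leb3; etransitivity.
  apply: product_measure1E; last exact: measurable_side.
  by apply: measurableX; exact: measurable_side.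
by rewrite EFinM; congr (_ * _)%E; [exact: H2|exact: measure_side].
Qed.

Lemma box3_fin : (leb3 box3 < +oo)%E.
Proof. by rewrite measure_box3 ltry. Qed.

Lemma compact_box : compact box.
Proof.
rewrite (_ : box = [set v | forall i, side i (v ord0 i)]).
  by apply: rV_compact => i; exact: segment_compact.
by apply/seteqP; split => v H j; apply/sideP; have := H j => //; move/sideP.
Qed.

Definition ccon (U : set 'rV[R]_3) (F : 'rV[R]_3 -> R) :=
  forall x, U x -> {for x, continuous F}.

Lemma ccon_bounded U F : box `<=` U -> ccon U F ->
  exists2 B, 0 <= B & forall x, box x -> `|F x| <= B.
Proof.
move=> bU cF.
have wF : {within box, continuous (fun x => `|F x|)}.
  apply: continuous_in_subspaceT => x /set_mem bx.
  exact: (cvg_norm (cF x (bU x bx))).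
have box0 : box x0 by move=> j; rewrite subrr normr0 ltW.
have [c _ Hc] := EVT_max_rV (ex_intro _ x0 box0) compact_box wF.
by exists `|F c| => // x bx; apply: Hc; exact/mem_set.
Qed.

Lemma measurable_ccon U F : open U -> box `<=` U -> ccon U F ->
  measurable_fun box3 (F \o @vec3 R).
Proof.
move=> oU bU cF; apply: (measurability _ (RGenOpens.measurableE R)).
move=> _ [_ [a [b ->] <-]].
have -> : box3 `&` (F \o @vec3 R) @^-1` `]a, b[ =
    box3 `&` (@vec3 R) @^-1` (U `&` F @^-1` `]a, b[).
  apply/seteqP; split => t [bt] /=; first by move=> Ft; split => //; split => //; exact: bU.
  by move=> [].
apply: measurableI; first exact: measurable_box3.
apply: measurable_vec3_open; rewrite openE => x [Ux Fx].
apply: filterI; first by move: oU; rewrite openE; apply.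
by apply: (cF x Ux); apply: open_nbhs_nbhs; split => //; exact: interval_open.
Qed.

Lemma integrable_ccon U F : open U -> box `<=` U -> ccon U F ->
  (@leb3 R).-integrable box3 (EFin \o (F \o @vec3 R)).
Proof.
move=> oU bU cF; apply: measurable_bounded_integrable.
- exact: measurable_box3.
- exact: box3_fin.
- exact: (measurable_ccon oU bU cF).
have [B B0 HB] := ccon_bounded bU cF.
exists B; split; first exact: num_real.
by move=> M BM t bt; apply: le_trans (ltW BM); exact: HB.
Qed.

Lemma derive_line (F : 'rV[R]_3 -> R) (y e : 'rV[R]_3) (s0 : R) :
  derivable F (y + s0 *: e) e ->
  is_derive s0 1 (fun s : R => F (y + s *: e)) ('D_e F (y + s0 *: e)).
Proof.
have E : (fun h : R => h^-1 *: (F (y + (h *: 1 + s0) *: e) - F (y + s0 *: e))) =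
    (fun h : R => h^-1 *: (F (h *: e + (y + s0 *: e)) - F (y + s0 *: e))).
  apply/funext => h; congr (_ *: (F _ - _)).
  by rewrite scalerDl [h *: 1]mulr1 addrCA.
by move=> dF; apply: DeriveDef; rewrite /derivable /derive /= E.
Qed.

Definition C1r (U : set 'rV[R]_3) (F : 'rV[R]_3 -> R) := Ck_on 1 U F.

Lemma C1r_ccon U F : C1r U F -> ccon U F.
Proof. by case. Qed.

Lemma C1r_partial U F k : C1r U F -> ccon U (partial k F).
Proof. by case=> _ /(_ k)[_ []]. Qed.

Lemma C1r_derivable U F k x : C1r U F -> U x -> derivable F x (delta_mx 0 k).
Proof. by case=> _ /(_ k)[H _] Ux; exact: H. Qed.

Lemma integral_partial_line U F k (y : 'rV[R]_3) : C1r U F ->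
  (forall s, side k s -> U (y + s *: delta_mx 0 k)) ->
  F (y + (x0 0 k - r) *: delta_mx 0 k) = 0 ->
  F (y + (x0 0 k + r) *: delta_mx 0 k) = 0 ->
  (\int[lebesgue_measure]_(s in side k) (partial k F (y + s *: delta_mx 0 k))%:E = 0)%E.
Proof.
move=> FU sU Fa Fb; set a := x0 0 k - r; set b := x0 0 k + r.
have ab : a < b by rewrite /a /b ltrBlDr -addrA ltrDl addr_gt0.
have sab s : s \in `[a, b] -> side k s by [].
have dG s : s \in `[a, b] -> is_derive s 1 (fun s : R => F (y + s *: delta_mx 0 k))
    (partial k F (y + s *: delta_mx 0 k)).
  by move=> /sab /sU ys; apply: derive_line; exact: (@C1r_derivable U F k _ FU ys).
have cG s : s \in `[a, b] -> {for s, continuous (fun s : R => F (y + s *: delta_mx 0 k))}.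
  move=> /dG ds; apply: differentiable_continuous; apply/derivable1_diffP.
  exact: ex_derive.
have lineC : continuous (fun s : R => y + s *: (delta_mx 0 k : 'rV[R]_3)).
  move=> s; apply: cvgD; first exact: cvg_cst.
  by apply: cvgZr_tmp; exact: cvg_id.
rewrite (@continuous_FTC2 _ (fun s => partial k F (y + s *: delta_mx 0 k))
  (fun s => F (y + s *: delta_mx 0 k)) a b ab).
- by rewrite -EFinB Fa Fb subrr.
- apply: continuous_in_subspaceT => s /set_mem /sab /sU ys.
  apply: (@continuous_comp _ _ _ (fun s : R => y + s *: delta_mx 0 k) (partial k F)).
    exact: lineC.
  exact: (C1r_partial (k := k) FU).
- split.
  + move=> s sI; have := dG s (subset_itv_oo_cc sI) => ds; exact: ex_derive.
  + apply/cvg_at_right_filter/cG; rewrite in_itv /= lexx /=; exact: ltW.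
  + apply/cvg_at_left_filter/cG; rewrite in_itv /= lexx andbT; exact: ltW.
- move=> s sI; have := dG s (subset_itv_oo_cc sI) => ds.
  by rewrite derive1E; exact: derive_val.
Qed.

End Box.

(** * Fubini's theorem and integration by parts on cubes *)

Section FubiniZero.
Context d1 d2 (T1 : measurableType d1) (T2 : measurableType d2) (R : realType).
Variables (m1 : {sigma_finite_measure set T1 -> \bar R})
  (m2 : {sigma_finite_measure set T2 -> \bar R}).
Variables (D1 : set T1) (D2 : set T2) (H : T1 * T2 -> \bar R).
Hypothesis mD1 : measurable D1.
Hypothesis mD2 : measurable D2.
Hypothesis iH : (m1 \x m2)%E.-integrable (D1 `*` D2) H.

Let iH' : (m1 \x m2)%E.-integrable setT (H \_ (D1 `*` D2)).
Proof. by apply/(integrable_mkcond _ (measurableX mD1 mD2)). Qed.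

Lemma fubini_zero12 :
  (forall x, D1 x -> \int[m2]_(y in D2) H (x, y) = 0)%E ->
  (\int[m1 \x m2]_(z in D1 `*` D2) H z = 0)%E.
Proof.
move=> H0; rewrite integral_mkcond -integral12_prod_meas1 //.
apply: integral0_eq => x _; rewrite /fubini_F.
have [D1x|D1x] := pselect (D1 x).
  rewrite -[RHS](H0 x D1x) [RHS]integral_mkcond; apply: eq_integral => y _.
  by rewrite !patchE in_setX /= mem_set.
apply: integral0_eq => y _.
by rewrite patchE in_setX /= memNset.
Qed.

Lemma fubini_zero21 :
  (forall y, D2 y -> \int[m1]_(x in D1) H (x, y) = 0)%E ->
  (\int[m1 \x m2]_(z in D1 `*` D2) H z = 0)%E.
Proof.
move=> H0; rewrite integral_mkcond -integral21_prod_meas1 //.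
apply: integral0_eq => y _; rewrite /fubini_G.
have [D2y|D2y] := pselect (D2 y).
  rewrite -[RHS](H0 y D2y) [RHS]integral_mkcond; apply: eq_integral => x _.
  by rewrite !patchE in_setX /= [X in _ && X]mem_set // andbT.
apply: integral0_eq => x _.
by rewrite patchE in_setX /= [X in _ && X]memNset // andbF.
Qed.
End FubiniZero.

(* The library's canonical structures on product measures only cover
   subprobabilities; this alias carries the sigma-finite one. *)
Definition leb2 (R : realType) : set (measurableTypeR R * measurableTypeR R) -> \bar R :=
  (@lebesgue_measure R \x @lebesgue_measure R)%E.

HB.instance Definition _ (R : realType) := Measure.on (@leb2 R).

Lemma leb2_sigma_finite (R : realType) : sigma_finite setT (@leb2 R).
Proof.
have /sigma_finiteP[F [TF ndF Foo]] := sigma_finiteT (@lebesgue_measure R).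
exists (fun n => F n `*` F n).
  rewrite -setXTT TF predeqE => -[x y]; split.
    move=> [/= [n _ Fnx] [k _ Gky]]; exists (maxn n k) => //; split.
    - by move: x Fnx; exact/subsetPset/ndF/leq_maxl.
    - by move: y Gky; exact/subsetPset/ndF/leq_maxr.
  by move=> [n _ []/= ? ?]; split; exists n.
move=> k; have [mF yF] := Foo k.
split; first exact: measurableX.
rewrite /leb2 [X in (X < _)%E](_ : _ = lebesgue_measure (F k) * lebesgue_measure (F k))%E.
  by rewrite lte_mul_pinfty// ge0_fin_numE.
exact: product_measure1E.
Qed.

HB.instance Definition _ (R : realType) :=
  Measure_isSigmaFinite.Build _ _ _ (@leb2 R) (@leb2_sigma_finite R).

Section BoxDivergence.
Variables (R : realType) (x0 : 'rV[R]_3) (r : R).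
Hypothesis r0 : 0 < r.
Variables (U : set 'rV[R]_3) (F : 'rV[R]_3 -> R).
Hypothesis oU : open U.
Hypothesis bU : box x0 r `<=` U.
Hypothesis FU : C1r U F.
Hypothesis F0 : forall x : 'rV[R]_3, (exists j, `|x 0 j - x0 0 j| = r) -> F x = 0.
Local Notation side := (side x0 r).

Lemma vec3_line (k : 'I_3) (x : 'rV[R]_3) (s : R) :
  x - x 0 k *: delta_mx 0 k + s *: delta_mx 0 k = \row_j (if j == k then s else x 0 j).
Proof.
apply/matrixP => i j; rewrite (ord1 i) !mxE eqxx /= eq_sym.
by case: eqVneq => [->|_] /=; rewrite ?mulr1 ?mulr0; [ring|rewrite subr0 addr0].
Qed.

(** [v] is a line as Fubini presents it, through triples in which only the k-th coordinate
    varies. *)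
Lemma integral_partial_axis k (v : R -> 'rV[R]_3) :
  (forall s j, v s 0 j = if j == k then s else v 0 0 j) ->
  (forall j, j != k -> side j (v 0 0 j)) ->
  (\int[lebesgue_measure]_(s in side k) (partial k F (v s))%:E = 0)%E.
Proof.
move=> vE vside.
have vs s : v s = v 0 - v 0 0 k *: delta_mx 0 k + s *: delta_mx 0 k.
  rewrite vec3_line; apply/matrixP => i j; rewrite (ord1 i) mxE vE.
  by case: eqVneq.
under eq_integral do rewrite vs.
apply: (@integral_partial_line _ x0 r r0 U) => //.
- move=> s sk; rewrite -vs; apply: bU => j; rewrite vE.
  by case: eqVneq => [->|jk]; apply/sideP => //; exact: vside.
- apply: F0; exists k; rewrite -vs vE eqxx.
  by rewrite (_ : _ - _ = - r) ?normrN ?gtr0_norm //; ring.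
- apply: F0; exists k; rewrite -vs vE eqxx.
  by rewrite (_ : _ - _ = r) ?gtr0_norm //; ring.
Qed.

Lemma integrable_slice (k : 'I_3) (c : R) : side 2%:R c ->
  (lebesgue_measure \x lebesgue_measure)%E.-integrable (side 0 `*` side 1)
    (EFin \o (fun ab => partial k F (vec3 (ab, c)))).
Proof.
move=> sc; have cF := C1r_partial (k := k) FU.
apply: measurable_bounded_integrable.
- by apply: measurableX; exact: measurable_side.
- have mfin : (lebesgue_measure \x lebesgue_measure)%E (side 0 `*` side 1) =
    (r *+ 2 * (r *+ 2))%:E.
    etransitivity; first by apply: product_measure1E; exact: measurable_side.
    by rewrite EFinM; congr (_ * _)%E; exact: measure_side.
  by apply: (@eq_ind_r _ _ (fun x => x < +oo)%E _ _ mfin); rewrite ltry.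
- apply: (@measurable_comp _ _ _ _ _ _ (box3 x0 r) (partial k F \o @vec3 R)
      (side 0 `*` side 1) (fun ab => (ab, c))).
  + exact: measurable_box3.
  + by move=> _ [ab ab01 <-]; rewrite box3E.
  + exact: (measurable_ccon oU bU cF).
  + apply: measurable_funTS; apply/measurable_fun_pairP; split => /=.
      exact: measurable_id.
    exact: measurable_cst.
have [B B0 HB] := ccon_bounded r0 bU cF.
exists B; split; first exact: num_real.
move=> M BM ab ab01; apply: le_trans (ltW BM); apply: HB.
by have : box3 x0 r (ab, c) by rewrite box3E.
Qed.

Local Notation mu := (@lebesgue_measure R).

Let n01 : (0 == 1 :> 'I_3) = false. Proof. by []. Qed.
Let n02 : (0 == 2%:R :> 'I_3) = false. Proof. by []. Qed.
Let n12 : (1 == 2%:R :> 'I_3) = false. Proof. by []. Qed.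
Let n10 : (1 == 0 :> 'I_3) = false. Proof. by []. Qed.
Let n20 : (2%:R == 0 :> 'I_3) = false. Proof. by []. Qed.
Let n21 : (2%:R == 1 :> 'I_3) = false. Proof. by []. Qed.

Lemma integral_slice_partial0 c : side 2%:R c ->
  (\int[mu \x mu]_(ab in side 0%R `*` side 1%R) (EFin \o (fun ab => partial 0%R F (vec3 (ab, c)))) ab = 0)%E.
Proof.
move=> sc; apply: fubini_zero21; [exact: measurable_side|exact: measurable_side|
  exact: integrable_slice|].
move=> b sb; apply: (@integral_partial_axis 0 (fun a => vec3 (a, b, c))).
  by move=> s; apply: ord3P; rewrite !vec3E ?eqxx ?n10 ?n20.
by apply: ord3P; rewrite ?eqxx // => _; rewrite vec3E.
Qed.

Lemma integral_slice_partial1 c : side 2%:R c ->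
  (\int[mu \x mu]_(ab in side 0%R `*` side 1%R) (EFin \o (fun ab => partial 1%R F (vec3 (ab, c)))) ab = 0)%E.
Proof.
move=> sc; apply: fubini_zero12; [exact: measurable_side|exact: measurable_side|
  exact: integrable_slice|].
move=> a sa; apply: (@integral_partial_axis 1 (fun b => vec3 (a, b, c))).
  by move=> s; apply: ord3P; rewrite !vec3E ?eqxx ?n01 ?n21.
by apply: ord3P; rewrite ?eqxx // => _; rewrite vec3E.
Qed.

(** Integration in the k-th variable gives a difference of two values on opposite faces, both 0. As
    [leb3] is nested to the left, axis 2 is the inner integral of one Fubini step, whereas for axes
    0 and 1 the inner integral runs over a slice and is treated by Fubini again. *)
Lemma integral_partial_box k :
  (\int[@leb3 R]_(t in box3 x0 r) (EFin \o (partial k F \o @vec3 R)) t = 0)%E.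
Proof.
have iF := integrable_ccon r0 oU bU (C1r_partial (k := k) FU).
have m01 : measurable (side 0 `*` side 1).
  by apply: measurableX; exact: measurable_side.
have m2 : measurable (side 2%:R) by exact: measurable_side.
rewrite box3E in iF *.
elim/ord3P: k iF => iF.
- refine (@fubini_zero21 _ _ _ _ R (@leb2 R) mu _ _ (EFin \o (partial 0 F \o @vec3 R)) m01 m2 iF _) => c sc.
  exact: integral_slice_partial0.
- refine (@fubini_zero21 _ _ _ _ R (@leb2 R) mu _ _ (EFin \o (partial 1 F \o @vec3 R)) m01 m2 iF _) => c sc.
  exact: integral_slice_partial1.
- refine (@fubini_zero12 _ _ _ _ R (@leb2 R) mu _ _ (EFin \o (partial 2%:R F \o @vec3 R)) m01 m2 iF _) => -[a b] [sa sb].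
  apply: (@integral_partial_axis 2%:R (fun c => vec3 (a, b, c))).
    by move=> s; apply: ord3P; rewrite !vec3E ?eqxx ?n02 ?n12.
  by apply: ord3P; rewrite ?eqxx // => _; rewrite vec3E.
Qed.
End BoxDivergence.

(** * Functions of class C0 and C1 on open sets *)

Section RealClasses.
Variables (R : realType) (U : set 'rV[R]_3).
Hypothesis oU : open U.
Implicit Types F G : 'rV[R]_3 -> R.

Lemma near_open x : U x -> \forall y \near x, U y.
Proof. by move: oU; rewrite openE; apply. Qed.

Lemma eq_ccon F G : (forall x, U x -> F x = G x) -> ccon U F -> ccon U G.
Proof.
move=> FG cF x Ux.
have nFG : {near x, F =1 G} by apply: filterS (near_open Ux) => y; exact: FG.
have := cvg_trans (near_eq_cvg nFG) (cF x Ux) => /(_ (nbhs_filter x)).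
by rewrite (FG x Ux).
Qed.

Lemma ccon_cst (a : R) : ccon U (fun=> a).
Proof. by move=> x _; exact: cst_continuous. Qed.

Lemma cconD F G : ccon U F -> ccon U G -> ccon U (fun x => F x + G x).
Proof. by move=> cF cG x Ux; exact: (cvgD (cF x Ux) (cG x Ux)). Qed.

Lemma cconN F : ccon U F -> ccon U (fun x => - F x).
Proof. by move=> cF x Ux; exact: (cvgN (cF x Ux)). Qed.

Lemma cconB F G : ccon U F -> ccon U G -> ccon U (fun x => F x - G x).
Proof. by move=> cF cG; apply: cconD => //; exact: cconN. Qed.

Lemma cconM F G : ccon U F -> ccon U G -> ccon U (fun x => F x * G x).
Proof. by move=> cF cG x Ux; exact: (cvgM (cF x Ux) (cG x Ux)). Qed.

Lemma C1rP F : C1r U F <-> [/\ ccon U F,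
  forall k x, U x -> derivable F x (delta_mx 0 k) & forall k, ccon U (partial k F)].
Proof.
split=> [[cF H]|[cF dF pF]].
  by split => // k; [case: (H k)|case: (H k) => _ []].
by split => // k; split; [exact: dF|split; [exact: pF|]].
Qed.

Lemma partialD F G k x : C1r U F -> C1r U G -> U x ->
  partial k (fun x => F x + G x) x = partial k F x + partial k G x.
Proof.
move=> FU GU Ux; rewrite /partial deriveD //; exact: C1r_derivable Ux.
Qed.

Lemma partialN F k x : C1r U F -> U x ->
  partial k (fun x => - F x) x = - partial k F x.
Proof. by move=> FU Ux; rewrite /partial deriveN //; exact: C1r_derivable Ux. Qed.

Lemma partialM F G k x : C1r U F -> C1r U G -> U x ->
  partial k (fun x => F x * G x) x = partial k F x * G x + F x * partial k G x.
Proof.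
move=> FU GU Ux; rewrite /partial deriveM /GRing.scale /=; last 2 first.
- exact: C1r_derivable Ux.
- exact: C1r_derivable Ux.
by rewrite addrC [G x * _]mulrC.
Qed.

Lemma C1r_cst (a : R) : C1r U (fun=> a).
Proof.
apply/C1rP; split; first exact: ccon_cst.
  by move=> k x _; exact: derivable_cst.
move=> k; rewrite (_ : partial k _ = cst 0); first exact: ccon_cst.
by apply/funext => x; rewrite /partial derive_cst.
Qed.

Lemma C1rD F G : C1r U F -> C1r U G -> C1r U (fun x => F x + G x).
Proof.
move=> FU GU; apply/C1rP; split.
- by apply: cconD; exact: C1r_ccon.
- move=> k x Ux; apply: derivableD; exact: C1r_derivable Ux.
move=> k; apply: (@eq_ccon (fun x => partial k F x + partial k G x)).
  by move=> x Ux; rewrite partialD.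
by apply: cconD; exact: C1r_partial.
Qed.

Lemma C1rN F : C1r U F -> C1r U (fun x => - F x).
Proof.
move=> FU; apply/C1rP; split.
- by apply: cconN; exact: C1r_ccon.
- move=> k x Ux; apply: derivableN; exact: C1r_derivable Ux.
move=> k; apply: (@eq_ccon (fun x => - partial k F x)).
  by move=> x Ux; rewrite partialN.
by apply: cconN; exact: C1r_partial.
Qed.

Lemma C1rM F G : C1r U F -> C1r U G -> C1r U (fun x => F x * G x).
Proof.
move=> FU GU; apply/C1rP; split.
- by apply: cconM; exact: C1r_ccon.
- move=> k x Ux; apply: derivableM; exact: C1r_derivable Ux.
move=> k; apply: (@eq_ccon (fun x => partial k F x * G x + F x * partial k G x)).
  by move=> x Ux; rewrite partialM.
by apply: cconD; apply: cconM; first [exact: C1r_partial|exact: C1r_ccon].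
Qed.

Lemma is_derive_coord (j k : 'I_3) (x : 'rV[R]_3) :
  is_derive x (delta_mx 0 k) (fun y : 'rV[R]_3 => y 0 j) ((j == k)%:R : R).
Proof.
have cv : h^-1 *: ((h *: delta_mx 0 k + x : 'rV[R]_3) 0 j - x 0 j) @[h --> 0^']
    --> ((j == k)%:R : R).
  apply: cvg_near_cst; near=> h.
  have h0 : h != 0 by near: h; exact: nbhs_dnbhs_neq.
  by rewrite !mxE eqxx /= addrK /GRing.scale /= mulKf.
apply: DeriveDef; first by apply/cvg_ex; eexists; exact: cv.
by apply/cvg_lim => //; exact: cv.
Unshelve. all: by end_near. Qed.

Lemma C1r_coord (j : 'I_3) : C1r U (fun x => x 0 j).
Proof.
apply/C1rP; split.
- by move=> x _; exact: coord_continuous.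
- by move=> k x _; have H := is_derive_coord j k x; exact: ex_derive.
move=> k; rewrite (_ : partial k _ = cst (j == k)%:R); first exact: ccon_cst.
by apply/funext => x; have H := is_derive_coord j k x; exact: derive_val.
Qed.
End RealClasses.

Section ComplexClasses.
Variables (R : realType) (U : set 'rV[R]_3).
Hypothesis oU : open U.
Implicit Types F G : 'rV[R]_3 -> R[i].

Definition Cc (V : set 'rV[R]_3) F :=
  ccon V (fun x => complex.Re (F x)) /\ ccon V (fun x => complex.Im (F x)).

Definition C1c (V : set 'rV[R]_3) F :=
  C1r V (fun x => complex.Re (F x)) /\ C1r V (fun x => complex.Im (F x)).

Definition cpart (k : 'I_3) F (x : 'rV[R]_3) : R[i] :=
  partial k (fun y => complex.Re (F y)) x +i* partial k (fun y => complex.Im (F y)) x.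

Lemma ReM (z w : R[i]) :
  complex.Re (z * w) = complex.Re z * complex.Re w - complex.Im z * complex.Im w.
Proof. by case: z; case: w. Qed.

Lemma ImM (z w : R[i]) :
  complex.Im (z * w) = complex.Re z * complex.Im w + complex.Im z * complex.Re w.
Proof. by case: z; case: w. Qed.

Lemma ReD (z w : R[i]) : complex.Re (z + w) = complex.Re z + complex.Re w.
Proof. by case: z; case: w. Qed.

Lemma ImD (z w : R[i]) : complex.Im (z + w) = complex.Im z + complex.Im w.
Proof. by case: z; case: w. Qed.

Lemma ReN (z : R[i]) : complex.Re (- z) = - complex.Re z.
Proof. by case: z. Qed.

Lemma ImN (z : R[i]) : complex.Im (- z) = - complex.Im z.
Proof. by case: z. Qed.

Lemma complexP (z w : R[i]) :
  complex.Re z = complex.Re w -> complex.Im z = complex.Im w -> z = w.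
Proof. by case: z => ? ?; case: w => ? ? /= -> ->. Qed.

Lemma CcD F G : Cc U F -> Cc U G -> Cc U (fun x => F x + G x).
Proof.
move=> [F1 F2] [G1 G2]; split.
  by under eq_fun do rewrite ReD; exact: cconD.
by under eq_fun do rewrite ImD; exact: cconD.
Qed.

Lemma CcN F : Cc U F -> Cc U (fun x => - F x).
Proof.
move=> [F1 F2]; split.
  by under eq_fun do rewrite ReN; exact: cconN.
by under eq_fun do rewrite ImN; exact: cconN.
Qed.

Lemma CcB F G : Cc U F -> Cc U G -> Cc U (fun x => F x - G x).
Proof. by move=> FU GU; apply: CcD => //; exact: CcN. Qed.

Lemma CcM F G : Cc U F -> Cc U G -> Cc U (fun x => F x * G x).
Proof.
move=> [F1 F2] [G1 G2]; split.
  by under eq_fun do rewrite ReM; apply: cconB; exact: cconM.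
by under eq_fun do rewrite ImM; apply: cconD; exact: cconM.
Qed.

Lemma Cc_cst (a : R[i]) : Cc U (fun=> a).
Proof. by split; exact: ccon_cst. Qed.

Lemma Cc_conj F : Cc U F -> Cc U (fun x => conjc (F x)).
Proof.
move=> [F1 F2]; split.
  by rewrite (_ : (fun x => _) = (fun x => complex.Re (F x))) //; apply/funext => x; case: (F x).
rewrite (_ : (fun x => _) = (fun x => - complex.Im (F x))); first exact: cconN.
by apply/funext => x; case: (F x).
Qed.

Lemma Cc_real (f : 'rV[R]_3 -> R) : ccon U f -> Cc U (fun x => (f x)%:C).
Proof. by move=> cf; split; [exact: cf|exact: ccon_cst]. Qed.

Lemma Cc_sum (I : Type) (s : seq I) (F : I -> 'rV[R]_3 -> R[i]) :
  (forall i, Cc U (F i)) -> Cc U (fun x => \sum_(i <- s) F i x).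
Proof.
move=> FU; elim: s => [|i s IH].
  by under eq_fun do rewrite big_nil; exact: Cc_cst.
by under eq_fun do rewrite big_cons; exact: CcD.
Qed.

Lemma C1c_Cc F : C1c U F -> Cc U F.
Proof. by move=> [F1 F2]; split; exact: C1r_ccon. Qed.

Lemma Cc_cpart F k : C1c U F -> Cc U (cpart k F).
Proof. by move=> [F1 F2]; split; exact: C1r_partial. Qed.

Lemma C1cD F G : C1c U F -> C1c U G -> C1c U (fun x => F x + G x).
Proof.
move=> [F1 F2] [G1 G2]; split.
  by under eq_fun do rewrite ReD; exact: C1rD.
by under eq_fun do rewrite ImD; exact: C1rD.
Qed.

Lemma C1cN F : C1c U F -> C1c U (fun x => - F x).
Proof.
move=> [F1 F2]; split.
  by under eq_fun do rewrite ReN; exact: C1rN.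
by under eq_fun do rewrite ImN; exact: C1rN.
Qed.

Lemma C1cM F G : C1c U F -> C1c U G -> C1c U (fun x => F x * G x).
Proof.
move=> [F1 F2] [G1 G2]; split.
  have H := C1rD oU (C1rM oU F1 G1) (C1rN oU (C1rM oU F2 G2)).
  by under eq_fun do rewrite ReM; exact: H.
have H := C1rD oU (C1rM oU F1 G2) (C1rM oU F2 G1).
by under eq_fun do rewrite ImM; exact: H.
Qed.

Lemma C1c_real (f : 'rV[R]_3 -> R) : C1r U f -> C1c U (fun x => (f x)%:C).
Proof. by move=> cf; split; [exact: cf|exact: C1r_cst]. Qed.

Lemma cpart_real (f : 'rV[R]_3 -> R) k x : cpart k (fun x => (f x)%:C) x = (partial k f x)%:C.
Proof. by rewrite /cpart /=; congr (_ +i* _); rewrite /partial derive_cst. Qed.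

Lemma cpartD F G k x : C1c U F -> C1c U G -> U x ->
  cpart k (fun x => F x + G x) x = cpart k F x + cpart k G x.
Proof.
move=> [F1 F2] [G1 G2] Ux; rewrite /cpart.
have -> : (fun y => complex.Re (F y + G y)) = (fun y => complex.Re (F y) + complex.Re (G y)).
  by apply/funext => y; rewrite ReD.
have -> : (fun y => complex.Im (F y + G y)) = (fun y => complex.Im (F y) + complex.Im (G y)).
  by apply/funext => y; rewrite ImD.
by rewrite (partialD k F1 G1 Ux) (partialD k F2 G2 Ux).
Qed.

Lemma cpartM F G k x : C1c U F -> C1c U G -> U x ->
  cpart k (fun x => F x * G x) x = cpart k F x * G x + F x * cpart k G x.
Proof.
move=> [F1 F2] [G1 G2] Ux.
have e1 : partial k (fun y => complex.Re (F y * G y)) x =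
  partial k (fun y => complex.Re (F y) * complex.Re (G y)) x
  - partial k (fun y => complex.Im (F y) * complex.Im (G y)) x.
  rewrite (_ : (fun y => complex.Re (F y * G y)) = (fun y =>
    complex.Re (F y) * complex.Re (G y) + - (complex.Im (F y) * complex.Im (G y)))).
    rewrite (partialD k (C1rM oU F1 G1) (C1rN oU (C1rM oU F2 G2)) Ux).
    by rewrite (partialN k (C1rM oU F2 G2) Ux).
  by apply/funext => y; rewrite ReM.
have e2 : partial k (fun y => complex.Im (F y * G y)) x =
  partial k (fun y => complex.Re (F y) * complex.Im (G y)) x
  + partial k (fun y => complex.Im (F y) * complex.Re (G y)) x.
  rewrite (_ : (fun y => complex.Im (F y * G y)) = (fun y =>
    complex.Re (F y) * complex.Im (G y) + complex.Im (F y) * complex.Re (G y))).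
    by rewrite (partialD k (C1rM oU F1 G2) (C1rM oU F2 G1) Ux).
  by apply/funext => y; rewrite ImM.
rewrite (partialM k F1 G1 Ux) (partialM k F2 G2 Ux) in e1.
rewrite (partialM k F1 G2 Ux) (partialM k F2 G1 Ux) in e2.
rewrite /cpart e1 e2; apply: complexP; rewrite ?(ReD, ImD, ReM, ImM).
  by rewrite /=; ring.
by rewrite /=; ring.
Qed.
End ComplexClasses.

(** * Integrals of complex functions over a cube *)

Section BoxIntegral.
Variables (R : realType) (x0 : 'rV[R]_3) (r : R) (U : set 'rV[R]_3).
Hypothesis r0 : 0 < r.
Hypothesis oU : open U.
Hypothesis bU : box x0 r `<=` U.
Implicit Types F G : 'rV[R]_3 -> R[i].

Definition rI (f : 'rV[R]_3 -> R) : R := Rintegral (@leb3 R) (box3 x0 r) (f \o @vec3 R).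

Definition cI F : R[i] := rI (fun x => complex.Re (F x)) +i* rI (fun x => complex.Im (F x)).

Lemma eq_rI (f g : 'rV[R]_3 -> R) : (forall x, box x0 r x -> f x = g x) -> rI f = rI g.
Proof.
by move=> fg; apply: eq_Rintegral => t /set_mem bt; rewrite /= fg.
Qed.

Lemma eq_cI F G : (forall x, box x0 r x -> F x = G x) -> cI F = cI G.
Proof. by move=> FG; rewrite /cI; congr (_ +i* _); apply: eq_rI => x bx; rewrite FG. Qed.

Lemma rID f g : ccon U f -> ccon U g -> rI (fun x => f x + g x) = rI f + rI g.
Proof.
move=> cf cg; apply: RintegralD; first exact: measurable_box3.
- exact: (integrable_ccon r0 oU bU cf).
- exact: (integrable_ccon r0 oU bU cg).
Qed.

Lemma rIZ a f : ccon U f -> rI (fun x => a * f x) = a * rI f.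
Proof.
move=> cf; apply: RintegralZl; first exact: measurable_box3.
exact: (integrable_ccon r0 oU bU cf).
Qed.

Lemma rIN f : ccon U f -> rI (fun x => - f x) = - rI f.
Proof.
by move=> cf; under eq_fun do rewrite -mulN1r; rewrite rIZ // mulN1r.
Qed.

Lemma cID F G : Cc U F -> Cc U G -> cI (fun x => F x + G x) = cI F + cI G.
Proof.
move=> [F1 F2] [G1 G2]; rewrite /cI.
under eq_fun do rewrite ReD; under [in X in _ +i* X]eq_fun do rewrite ImD.
by rewrite !rID.
Qed.

Lemma cIZ (a : R[i]) F : Cc U F -> cI (fun x => a * F x) = a * cI F.
Proof.
move=> [F1 F2]; rewrite /cI.
have H (b c : R) (f g : 'rV[R]_3 -> R) : ccon U f -> ccon U g ->
    rI (fun x => b * f x + c * g x) = b * rI f + c * rI g.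
  by move=> cf cg; rewrite rID ?rIZ //; apply: cconM => //; exact: ccon_cst.
apply: complexP; rewrite ?(ReM, ImM) /=.
  under eq_fun do rewrite ReM -mulNr; by rewrite H // mulNr.
by under eq_fun do rewrite ImM; rewrite H.
Qed.

Lemma cIN F : Cc U F -> cI (fun x => - F x) = - cI F.
Proof.
by move=> FU; under eq_fun do rewrite -mulN1r; rewrite cIZ // mulN1r.
Qed.

Lemma cI_sum (I : Type) (s : seq I) (F : I -> 'rV[R]_3 -> R[i]) :
  (forall i, Cc U (F i)) ->
  cI (fun x => \sum_(i <- s) F i x) = \sum_(i <- s) cI (F i).
Proof.
move=> FU; elim: s => [|i s IH].
  under eq_fun do rewrite big_nil.
  have E := cIZ 0 (@Cc_cst _ U 0).
  rewrite big_nil -[RHS](mul0r (cI (fun=> 0))) -E; congr cI.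
  by apply/funext => x /=; rewrite mul0r.
under eq_fun do rewrite big_cons.
by rewrite cID ?IH ?big_cons //; exact: Cc_sum.
Qed.

Lemma cI_cpart F k : C1c U F ->
  (forall x : 'rV[R]_3, (exists j, `|x 0 j - x0 0 j| = r) -> F x = 0) ->
  cI (cpart k F) = 0.
Proof.
move=> [F1 F2] F0; apply: complexP; rewrite /cI /= /rI /Rintegral.
  by rewrite (integral_partial_box r0 oU bU F1) // => x /F0 ->.
by rewrite (integral_partial_box r0 oU bU F2) // => x /F0 ->.
Qed.

(** By compactness f has a positive minimum on the concentric cube of half the size, whose volume is
    r^3. *)
Lemma rI_gt0 f : ccon U f -> (forall x, box x0 r x -> 0 <= f x) ->
  (forall x, box x0 (r / 2) x -> 0 < f x) -> 0 < rI f.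
Proof.
move=> cf f0 fpos.
have r20 : 0 < r / 2 by rewrite divr_gt0.
have bb : box x0 (r / 2) `<=` box x0 r.
  by move=> x bx j; apply: le_trans (bx j) _; lra.
have wf : {within box x0 (r / 2), continuous f}.
  by apply: continuous_in_subspaceT => x /set_mem bx; exact: (cf x (bU (bb _ bx))).
have b0 : box x0 (r / 2) x0 by move=> j; rewrite subrr normr0 ltW.
have [c cb Hc] := EVT_min_rV (ex_intro _ x0 b0) (@compact_box R x0 (r / 2)) wf.
have fc0 : 0 < f c by apply: fpos; exact/set_mem.
have i1 := integrable_ccon r0 oU bU cf.
have m1 := measurable_ccon oU bU cf.
have b3 : box3 x0 (r / 2) `<=` box3 x0 r by move=> t; exact: bb.
have le1 : ((f c * (r * r * r))%:E <= \int[@leb3 R]_(t in box3 x0 r) (EFin \o (f \o @vec3 R)) t)%E.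
  apply: (@le_trans _ _ (\int[@leb3 R]_(t in box3 x0 (r / 2)) (EFin \o (f \o @vec3 R)) t)%E); last first.
    apply: ge0_subset_integral => //; [exact: measurable_box3|exact: measurable_box3| |].
    - by apply/measurable_EFinP.
    - by move=> t bt; rewrite lee_fin; exact: f0.
  apply: (@le_trans _ _ (\int[@leb3 R]_(t in box3 x0 (r / 2)) (cst (f c)%:E t))%E); last first.
    apply: ge0_le_integral; first exact: measurable_box3.
    - by move=> t _; rewrite lee_fin ltW.
    - exact: measurable_cst.
    - by apply/measurable_EFinP; apply: measurable_funS m1 => //; exact: measurable_box3.
    - by move=> t bt; rewrite lee_fin; apply: Hc; exact/mem_set.
  rewrite integral_cst; last exact: measurable_box3.
  rewrite [X in (_ <= _ * X)%E](_ : _ = (r * r * r)%:E); first by rewrite -EFinM.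
  etransitivity; first exact: measure_box3.
  by congr EFin; field.
have fin : (\int[@leb3 R]_(t in box3 x0 r) (EFin \o (f \o @vec3 R)) t)%E \is a fin_num.
  by apply: integrable_fin_num i1; exact: measurable_box3.
rewrite /rI /Rintegral; move: le1; rewrite -(fineK fin) lee_fin; apply: lt_le_trans.
by rewrite !mulr_gt0.
Qed.
End BoxIntegral.

(** * The chain rule *)

(* Increment along the coordinate axes one after the other, by the mean value theorem. *)
Section ChainRule.
Variables (R : realType) (U : set 'rV[R]_3) (F : 'rV[R]_3 -> R) (y : 'rV[R]_3).
Hypothesis oU : open U.
Hypothesis FU : C1r U F.
Hypothesis Uy : U y.

Lemma near_box : exists2 e, 0 < e & box y e `<=` U.
Proof.
have : nbhs y U by move: oU; rewrite openE; apply.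
move=> /row3_ballP [e e0 eU]; exists (e / 2); first by rewrite divr_gt0.
move=> x bx; apply: eU => j; rewrite distrC; apply: le_lt_trans (bx j) _.
by rewrite ltr_pdivrMr // ltr_pMr // ltr1n.
Qed.

Definition upd (x : 'rV[R]_3) (j : 'I_3) (a : R) : 'rV[R]_3 :=
  x - x 0 j *: delta_mx 0 j + a *: delta_mx 0 j.

Lemma updE x j a k : upd x j a 0 k = if k == j then a else x 0 k.
Proof. by rewrite /upd vec3_line mxE. Qed.

Lemma mean_value_axis (x : 'rV[R]_3) (j : 'I_3) (a : R) :
  (forall s, `|s - y 0 j| <= Num.max `|a - y 0 j| `|x 0 j - y 0 j| -> U (upd x j s)) ->
  exists2 c, `|c - y 0 j| <= Num.max `|a - y 0 j| `|x 0 j - y 0 j| &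
    F (upd x j a) - F x = partial j F (upd x j c) * (a - x 0 j).
Proof.
move=> xU; have updx : upd x j (x 0 j) = x.
  by apply/matrixP => i k; rewrite (ord1 i) updE; case: eqVneq => // ->.
have mv (p q : R) : p <= q ->
    `|p - y 0 j| <= Num.max `|a - y 0 j| `|x 0 j - y 0 j| ->
    `|q - y 0 j| <= Num.max `|a - y 0 j| `|x 0 j - y 0 j| ->
    exists2 c, `|c - y 0 j| <= Num.max `|a - y 0 j| `|x 0 j - y 0 j| &
    F (upd x j q) - F (upd x j p) = partial j F (upd x j c) * (q - p).
  move=> pq p0 q0.
  have bnd s : s \in `[p, q] -> `|s - y 0 j| <= Num.max `|a - y 0 j| `|x 0 j - y 0 j|.
    rewrite in_itv /= => /andP[ps sq]; move: p0 q0; rewrite !ler_norml.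
    by move=> /andP[p1 p2] /andP[q1 q2]; apply/andP; split; lra.
  have dF s : s \in `[p, q] -> is_derive s 1 (fun s : R => F (upd x j s)) (partial j F (upd x j s)).
    by move=> /bnd /xU H; apply: derive_line; exact: (C1r_derivable FU H).
  have cF : {within `[p, q], continuous (fun s : R => F (upd x j s))}.
    apply: continuous_in_subspaceT => s /set_mem /dF ds.
    by apply: differentiable_continuous; apply/derivable1_diffP; exact: ex_derive.
  have dF' s : s \in `]p, q[ -> is_derive s 1 (fun s : R => F (upd x j s)) (partial j F (upd x j s)).
    by move=> sI; apply: dF; exact: subset_itv_oo_cc.
  have [c cI cE] := MVT_segment pq dF' cF.
  by exists c => //; exact: bnd.
have la : `|a - y 0 j| <= Num.max `|a - y 0 j| `|x 0 j - y 0 j| by rewrite le_max lexx.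
have lx : `|x 0 j - y 0 j| <= Num.max `|a - y 0 j| `|x 0 j - y 0 j|.
  by rewrite le_max lexx orbT.
have [ax|xa] := leP a (x 0 j).
  have [c c1 c2] := mv _ _ ax la lx; exists c => //.
  by rewrite updx in c2; rewrite -opprB c2; ring.
by have [c c1 c2] := mv _ _ (ltW xa) lx la; exists c => //; rewrite updx in c2.
Qed.

(** Caratheodory's form of differentiability: the increment is an exact sum with factors tending to
    the partial derivatives, so it can be composed with any map that tends to y. *)
Lemma caratheodory : exists Q : 'I_3 -> 'rV[R]_3 -> R,
  (forall j, Q j z @[z --> y] --> partial j F y) /\
  \forall z \near y, F z - F y = \sum_(j < 3) Q j z * (z 0 j - y 0 j).
Proof.
have [e e0 eU] := near_box.
have xi z : box y e z -> exists q : 'rV[R]_3 * 'rV[R]_3 * 'rV[R]_3,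
  [/\ (forall k, `|q.1.1 0 k - y 0 k| <= `|z 0 k - y 0 k|),
      (forall k, `|q.1.2 0 k - y 0 k| <= `|z 0 k - y 0 k|),
      (forall k, `|q.2 0 k - y 0 k| <= `|z 0 k - y 0 k|) &
  F z - F y = partial 0 F q.1.1 * (z 0 0 - y 0 0) + partial 1 F q.1.2 * (z 0 1 - y 0 1)
    + partial 2%:R F q.2 * (z 0 2%:R - y 0 2%:R)].
  (* The path from y to z changes the coordinates 0, 1, 2 in turn; the triple sought consists of the
     three mean value points. *)
  move=> bz; pose z1 := upd y 0 (z 0 0); pose z2 := upd z1 1 (z 0 1).
  have z3 : upd z2 2%:R (z 0 2%:R) = z.
    apply/matrixP => i k; rewrite (ord1 i) updE; elim/ord3P: k => //=.
      by rewrite /z2 updE /= /z1 updE.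
    by rewrite /z2 updE.
  have step (x : 'rV[R]_3) (j : 'I_3) :
      (forall k, `|x 0 k - y 0 k| <= `|z 0 k - y 0 k|) -> x 0 j = y 0 j ->
      exists2 q : 'rV[R]_3, (forall k, `|q 0 k - y 0 k| <= `|z 0 k - y 0 k|) &
      F (upd x j (z 0 j)) - F x = partial j F q * (z 0 j - y 0 j).
    move=> xz xj.
    have mx : Num.max `|z 0 j - y 0 j| `|x 0 j - y 0 j| = `|z 0 j - y 0 j|.
      by rewrite xj subrr normr0 max_l.
    have qz s : `|s - y 0 j| <= `|z 0 j - y 0 j| ->
        forall k, `|upd x j s 0 k - y 0 k| <= `|z 0 k - y 0 k|.
      by move=> sz k; rewrite updE; case: eqVneq => [->|].
    have xU s : `|s - y 0 j| <= Num.max `|z 0 j - y 0 j| `|x 0 j - y 0 j| -> U (upd x j s).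
      by rewrite mx => /qz H; apply: eU => k; exact: le_trans (H k) (bz k).
    have [c] := mean_value_axis xU.
    by rewrite mx xj => /qz H1 H2; exists (upd x j c).
  have b0 k : `|y 0 k - y 0 k| <= `|z 0 k - y 0 k| by rewrite subrr normr0.
  have b1 k : `|z1 0 k - y 0 k| <= `|z 0 k - y 0 k|.
    by rewrite /z1 updE; case: eqVneq => [->|_].
  have b2 k : `|z2 0 k - y 0 k| <= `|z 0 k - y 0 k|.
    by rewrite /z2 updE; case: eqVneq => [->|_].
  have [q0 q0b q0E] := step y 0 b0 erefl.
  have [q1 q1b q1E] : exists2 q : 'rV[R]_3, (forall k, `|q 0 k - y 0 k| <= `|z 0 k - y 0 k|) &
      F z2 - F z1 = partial 1 F q * (z 0 1 - y 0 1).
    by apply: step => //; rewrite /z1 updE.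
  have [q2 q2b q2E] := step z2 2%:R b2 (ltac:(by rewrite /z2 /z1 !updE)).
  exists (q0, q1, q2); split => //=.
  rewrite -q0E -q1E -q2E z3 -/z1; ring.
(* The default outside the cube is harmless, since only points near y matter. *)
pose q z := if pselect (box y e z) is left bz then projT1 (cid (xi z bz)) else (y, y, y).
have qP z : box y e z ->
  [/\ (forall k, `|(q z).1.1 0 k - y 0 k| <= `|z 0 k - y 0 k|),
      (forall k, `|(q z).1.2 0 k - y 0 k| <= `|z 0 k - y 0 k|),
      (forall k, `|(q z).2 0 k - y 0 k| <= `|z 0 k - y 0 k|) &
  F z - F y = partial 0 F (q z).1.1 * (z 0 0 - y 0 0) + partial 1 F (q z).1.2 * (z 0 1 - y 0 1)
    + partial 2%:R F (q z).2 * (z 0 2%:R - y 0 2%:R)].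
  by move=> bz; rewrite /q; case: pselect => // bz'; exact: (projT2 (cid (xi z bz'))).
have near_e : \forall z \near y, box y e z.
  apply/row3_ballP; exists e => // z H j; rewrite distrC; exact/ltW/H.
have cvq (p : 'rV[R]_3 -> 'rV[R]_3) :
    (forall z, box y e z -> forall k, `|p z 0 k - y 0 k| <= `|z 0 k - y 0 k|) ->
    p z @[z --> y] --> y.
  move=> pz A /row3_ballP[d d0 dA].
  have : \forall z \near y, box y e z /\ (forall j, `|y 0 j - z 0 j| < d).
    apply: filterI => //; apply/row3_ballP; exists d => //.
  apply: filterS => z [bz dz]; apply: dA => j; rewrite distrC.
  by apply: le_lt_trans (pz z bz j) _; rewrite distrC.
have cP j : {for y, continuous (partial j F)} by exact: (C1r_partial FU Uy).
exists (fun j z => if j == 0 then partial 0 F (q z).1.1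
  else if j == 1 then partial 1 F (q z).1.2 else partial 2%:R F (q z).2); split.
  apply: ord3P => /=.
  - apply: (cvg_comp (fun z => (q z).1.1) (partial 0 F)); last exact: cP.
    by apply: cvq => z /qP[].
  - apply: (cvg_comp (fun z => (q z).1.2) (partial 1 F)); last exact: cP.
    by apply: cvq => z /qP[].
  - apply: (cvg_comp (fun z => (q z).2) (partial 2%:R F)); last exact: cP.
    by apply: cvq => z /qP[].
by apply: filterS near_e => z /qP[_ _ _ ->]; rewrite sum3E.
Qed.
End ChainRule.

(** The differentiability is carried by [F]. For [T] a derivative along the one axis suffices: it
    also gives the continuity of [T] along that line. *)
Lemma partial_comp (R : realType) (U : set 'rV[R]_3) (F : 'rV[R]_3 -> R)
    (T : 'rV[R]_3 -> 'rV[R]_3) (x : 'rV[R]_3) (k : 'I_3) :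
  open U -> C1r U F -> U (T x) ->
  (forall l, derivable (fun y => T y 0 l) x (delta_mx 0 k)) ->
  partial k (F \o T) x =
  \sum_(l < 3) partial k (fun y => T y 0 l) x * partial l F (T x).
Proof.
move=> oU FU UT dT.
have [Q [cQ QE]] := caratheodory oU FU UT.
pose c (h : R) := T (h *: delta_mx 0 k + x).
have cl l : (c h 0 l : R) @[h --> (0 : R)^'] --> (T x 0 l : R).
  have D := dT l.
  have Q1 : (h * (h^-1 *: (c h 0 l - T x 0 l)) : R) @[h --> (0 : R)^'] -->
      (0 * 'D_(delta_mx 0 k) (fun y => T y 0 l) x : R).
    apply: cvgM; last exact: D.
    by apply: cvg_within; exact: cvg_id.
  rewrite mul0r in Q1.
  have Q2 : (T x 0 l + h * (h^-1 *: (c h 0 l - T x 0 l)) : R) @[h --> (0 : R)^'] --> (T x 0 l + 0).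
    by apply: cvgD => //; exact: cvg_cst.
  rewrite addr0 in Q2; apply: cvg_trans Q2; apply: near_eq_cvg; near=> h.
  have h0 : h != 0 by near: h; exact: nbhs_dnbhs_neq.
  by rewrite /GRing.scale /= mulrA divff // mul1r addrC subrK.
have cT : c h @[h --> (0 : R)^'] --> T x.
  move=> A /row3_ballP[d d0 dA].
  have H l : \forall h \near (0 : R)^', `|T x 0 l - c h 0 l| < d.
    by have /cvgrPdist_lt /(_ _ d0) := cl l.
  change (\forall h \near (0 : R)^', A (c h)).
  by near=> h; apply: dA; apply: ord3P; near: h; exact: H.
have lim : h^-1 *: ((F \o T) (h *: delta_mx 0 k + x) - (F \o T) x) @[h --> (0 : R)^'] -->
    (\sum_(l < 3) partial k (fun y => T y 0 l) x * partial l F (T x) : R).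
  have L : (\sum_(l < 3) (h^-1 *: (c h 0 l - T x 0 l)) * Q l (c h) : R) @[h --> (0 : R)^'] -->
    (\sum_(l < 3) partial k (fun y => T y 0 l) x * partial l F (T x) : R).
    under eq_cvg do rewrite sum3E; rewrite sum3E.
    have M l : ((h^-1 *: (c h 0 l - T x 0 l)) * Q l (c h) : R) @[h --> (0 : R)^'] -->
        (partial k (fun y => T y 0 l) x * partial l F (T x) : R).
      apply: cvgM; first exact: (dT l).
      by apply: (cvg_comp c (Q l)); [exact: cT|exact: cQ].
    by apply: cvgD; [apply: cvgD|].
  apply: cvg_trans L; apply: near_eq_cvg.
  have : \forall h \near (0 : R)^', F (c h) - F (T x) = \sum_(j < 3) Q j (c h) * (c h 0 j - T x 0 j).
    exact: (cT _ QE).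
  apply: filterS => h E; rewrite /= -/(c h) E /GRing.scale /= mulr_sumr.
  by apply: eq_bigr => l _; ring.
by rewrite /partial; apply/cvg_lim => //; exact: lim.
Unshelve. all: by end_near. Qed.

(** * The Riemannian measure in charts *)

Section ContinuityMore.
Variables (R : realType) (U : set 'rV[R]_3).

Lemma ccon_sum (I : Type) (s : seq I) (F : I -> 'rV[R]_3 -> R) :
  (forall i, ccon U (F i)) -> ccon U (fun x => \sum_(i <- s) F i x).
Proof.
move=> FU; elim: s => [|i s IH].
  by under eq_fun do rewrite big_nil; exact: ccon_cst.
by under eq_fun do rewrite big_cons; exact: cconD.
Qed.

Lemma ccon_prod (I : Type) (s : seq I) (F : I -> 'rV[R]_3 -> R) :
  (forall i, ccon U (F i)) -> ccon U (fun x => \prod_(i <- s) F i x).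
Proof.
move=> FU; elim: s => [|i s IH].
  by under eq_fun do rewrite big_nil; exact: ccon_cst.
by under eq_fun do rewrite big_cons; exact: cconM.
Qed.

Lemma ccon_det (A : 'rV[R]_3 -> 'M[R]_3) :
  (forall i j, ccon U (fun x => A x i j)) -> ccon U (fun x => \det (A x)).
Proof.
move=> AU; apply: ccon_sum => s; apply: cconM; first exact: ccon_cst.
by apply: ccon_prod => i; exact: AU.
Qed.

Lemma ccon_normsq (F : 'rV[R]_3 -> R[i]) : Cc U F -> ccon U (fun x => normsq (F x)).
Proof.
move=> [F1 F2]; rewrite /normsq; apply: cconD.
  by under eq_fun do rewrite expr2; exact: cconM.
by under eq_fun do rewrite expr2; exact: cconM.
Qed.
End ContinuityMore.

(** * Vanishing of integrals by weighted estimates *)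

Section SmallIntegrals.
Variables (R : realType) (x0 : 'rV[R]_3) (r : R) (U : set 'rV[R]_3).
Hypothesis r0 : 0 < r.
Hypothesis oU : open U.
Hypothesis bU : box x0 r `<=` U.
Local Notation cI := (cI x0 r).
Local Notation rI := (rI x0 r).

Lemma le_rI f g : ccon U f -> ccon U g -> (forall x, box x0 r x -> f x <= g x) ->
  rI f <= rI g.
Proof.
move=> cf cg fg; apply: le_Rintegral; first exact: measurable_box3.
- exact: (integrable_ccon r0 oU bU cf).
- exact: (integrable_ccon r0 oU bU cg).
- by move=> t; exact: fg.
Qed.

Lemma normr_rI f g : ccon U f -> ccon U g -> (forall x, box x0 r x -> `|f x| <= g x) ->
  `|rI f| <= rI g.
Proof.
move=> cf cg fg; rewrite ler_norml; apply/andP; split.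
  rewrite -(rIN r0 oU bU cg); apply: le_rI => //; first exact: cconN.
  by move=> x bx; have := fg x bx; rewrite ler_norml => /andP[].
by apply: le_rI => // x bx; have := fg x bx; rewrite ler_norml => /andP[].
Qed.

(** A weighted inequality between means in the role of Cauchy-Schwarz; the free weight [e] later
    tends to 0. *)
Lemma normr_ReM (K G : R[i]) (e : R) : 0 < e ->
  `|complex.Re (K * G)| <= e * normsq K + e^-1 * normsq G.
Proof.
move=> e0; case: K => a b; case: G => c d; rewrite /normsq /=.
have amgm (p q : R) : `|p * q| <= e * p ^+ 2 + e^-1 * q ^+ 2.
  have es : e * e^-1 = 1 by rewrite divff // gt_eqF.
  set s := e^-1 in es *.
  have s0 : 0 < s by rewrite invr_gt0.
  (* The squares of p + q / (2e) and p - q / (2e), weighted by e, have the mixed terms p q and - p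
     q. *)
  have h1 : 0 <= e * (p + s * q / 2) ^+ 2 by rewrite mulr_ge0 ?sqr_ge0 // ltW.
  have h2 : 0 <= e * (p - s * q / 2) ^+ 2 by rewrite mulr_ge0 ?sqr_ge0 // ltW.
  have h3 : 0 <= s * q ^+ 2 by rewrite mulr_ge0 ?sqr_ge0 // ltW.
  have E1 : e * (p + s * q / 2) ^+ 2 = e * p ^+ 2 + (e * s) * (p * q) + (e * s) * (s * q ^+ 2) / 4.
    by field.
  have E2 : e * (p - s * q / 2) ^+ 2 = e * p ^+ 2 - (e * s) * (p * q) + (e * s) * (s * q ^+ 2) / 4.
    by field.
  rewrite E1 es !mul1r in h1; rewrite E2 es !mul1r in h2.
  by rewrite ler_norml; apply/andP; split; lra.
apply: le_trans (ler_normB _ _) _.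
have := amgm a c; have := amgm b d; rewrite !mulrDr; lra.
Qed.

Lemma normr_rI_ReM K0 K1 G0 G1 e : 0 < e -> Cc U K0 -> Cc U K1 -> Cc U G0 -> Cc U G1 ->
  `|rI (fun x => complex.Re (K0 x * G0 x + K1 x * G1 x))| <=
  e * rI (fun x => normsq (K0 x) + normsq (K1 x))
  + e^-1 * rI (fun x => normsq (G0 x) + normsq (G1 x)).
Proof.
move=> e0 K0c K1c G0c G1c.
have cK : ccon U (fun x => normsq (K0 x) + normsq (K1 x)).
  by apply: cconD; exact: ccon_normsq.
have cG : ccon U (fun x => normsq (G0 x) + normsq (G1 x)).
  by apply: cconD; exact: ccon_normsq.
rewrite -(rIZ r0 oU bU e cK) -(rIZ r0 oU bU e^-1 cG).
have cK' := cconM (@ccon_cst R U e) cK; have cG' := cconM (@ccon_cst R U e^-1) cG.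
rewrite -(rID r0 oU bU cK' cG'); apply: normr_rI.
- by case: (CcD (CcM K0c G0c) (CcM K1c G1c)).
- exact: cconD.
move=> x _; rewrite ReD; apply: le_trans (ler_normD _ _) _.
have := normr_ReM (K0 x) (G0 x) e0; have := normr_ReM (K1 x) (G1 x) e0.
rewrite !mulrDr; lra.
Qed.

Lemma small_eq0 (a A : R) : (forall e, 0 < e -> `|a| <= e * A) -> a = 0.
Proof.
move=> H; apply/eqP; rewrite -normr_eq0 eq_le normr_ge0 andbT.
apply/ler_addgt0Pr => e e0; rewrite add0r.
have A1 : 0 < `|A| + 1 by rewrite ltr_wpDl.
apply: le_trans (H (e / (`|A| + 1)) _) _; first by rewrite divr_gt0.
rewrite mulrAC ler_pdivrMr // ler_pM2l //.
by apply: le_trans (ler_norm A) _; rewrite lerDl.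
Qed.

(** The imaginary part of w is the real part of -i w, so for a class [P] of coefficient pairs stable
    under complex multiples it is enough to treat real parts. *)
Lemma cI_eq0_of_Re K0 K1 (P : ('rV[R]_3 -> R[i]) -> ('rV[R]_3 -> R[i]) -> Prop) G0 G1 :
  Cc U K0 -> Cc U K1 -> Cc U G0 -> Cc U G1 -> P K0 K1 ->
  (forall K0 K1 (a : R[i]), P K0 K1 -> P (fun x => a * K0 x) (fun x => a * K1 x)) ->
  (forall K0 K1, Cc U K0 -> Cc U K1 -> P K0 K1 ->
    rI (fun x => complex.Re (K0 x * G0 x + K1 x * G1 x)) = 0) ->
  cI (fun x => K0 x * G0 x + K1 x * G1 x) = 0.
Proof.
move=> K0c K1c G0c G1c PK PZ H; apply: complexP; first exact: H.
rewrite -[RHS](H (fun x => - 'i%C * K0 x) (fun x => - 'i%C * K1 x)); last exact: PZ.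
- apply: eq_rI => x _; move: (K0 x) (G0 x) (K1 x) (G1 x) => [a b] [c d] [p q] [u v] /=.
  by ring.
- by apply: CcM => //; exact: Cc_cst.
- by apply: CcM => //; exact: Cc_cst.
Qed.

(** In the weighted estimate the large factor 1/e meets the integral 0, and the other summand tends
    to 0 with e. *)
Lemma cI_null K G : Cc U K -> Cc U G -> rI (fun x => normsq (G x)) = 0 ->
  cI (fun x => K x * G x) = 0.
Proof.
move=> Kc Gc G0.
have zc : Cc U (fun=> 0 : R[i]) by exact: Cc_cst.
have -> : (fun x => K x * G x) = (fun x => K x * G x + 0 * 0).
  by apply/funext => x; rewrite mul0r addr0.
apply: (@cI_eq0_of_Re K (fun=> 0) (fun _ K1 => K1 = fun=> 0) G (fun=> 0)) => //.
  by move=> _ _ a ->; apply/funext => x; rewrite mulr0.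
move=> K0 _ K0c _ ->.
apply: (@small_eq0 _ (rI (fun x => normsq (K0 x) + normsq (0 : R[i])))) => e e0.
apply: le_trans (normr_rI_ReM e0 K0c zc Gc zc) _.
rewrite (_ : rI (fun x => normsq (G x) + _) = 0) ?mulr0 ?addr0 //.
by rewrite -[RHS]G0; apply: eq_rI => x _; rewrite {2}/normsq /= expr0n /= !addr0.
Qed.
End SmallIntegrals.

(** * Comparison of Lebesgue measure on a cube with the Riemannian measure *)

Section ChartMeasure.
Variables (R : realType) (Sigma : ptopologicalType) (M : atlas3 R Sigma).
Variables (h : metric M) (eta : 'I_3 -> vector_field M).
Hypothesis eta_orthonormal : orthonormal_frame h eta.
Variable vol : {finite_measure set (borel Sigma) -> \bar R}.
Hypothesis vol_h : riemannian_measure h vol.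
Variables (c : chart M) (x0 : 'rV[R]_3) (r : R).
Hypothesis r0 : 0 < r.
Local Notation U := (img c).
Hypothesis bU : box x0 r `<=` U.
Local Notation T3 := (measurableTypeR R * measurableTypeR R * measurableTypeR R)%type.

Lemma open_img : open U. Proof. exact: img_open. Qed.

Lemma dom_psi x : U x -> dom c (psi c x).
Proof. by move=> [p dp <-]; rewrite phiK. Qed.

Lemma phi_psi x : U x -> phi c (psi c x) = x.
Proof. by move=> [p dp <-]; rewrite phiK. Qed.

(** For the frame matrix E, orthonormality E h E^T = 1 gives det h (det E)^2 = 1. *)
Lemma det_metric_gt0 x : U x -> 0 < \det (mt h c x).
Proof.
move=> Ux; have := congr1 determinant (eta_orthonormal Ux).
rewrite !det_mulmx det_tr det1 => E.
have E2 : \det (mt h c x) * \det (frame_mx eta c x) ^+ 2 = 1 by rewrite -[RHS]E; ring.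
have f0 : 0 < \det (frame_mx eta c x) ^+ 2.
  rewrite lt_neqAle sqr_ge0 andbT eq_sym; apply/eqP => e.
  by move: E2; rewrite e mulr0 => /eqP; rewrite eq_sym oner_eq0.
by rewrite -(pmulr_lgt0 _ f0) E2.
Qed.

Lemma ccon_det_metric : ccon U (fun x => \det (mt h c x)).
Proof. by apply: ccon_det => i j; exact: (mt_smooth h c i j 0).1. Qed.

Lemma ccon_sqrt_det : ccon U (fun x => Num.sqrt (\det (mt h c x))).
Proof.
move=> x Ux; apply: (@continuous_comp _ _ _ (fun x => \det (mt h c x)) Num.sqrt).
  exact: ccon_det_metric.
exact: sqrt_continuous.
Qed.

Definition chart_box : set (borel Sigma) := dom c `&` phi c @^-1` box x0 r.

Lemma open_borel (O : set Sigma) : open O -> measurable (O : set (borel Sigma)).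
Proof. exact: sub_sigma_algebra. Qed.

Lemma closed_box : closed (box x0 r).
Proof. by apply: compact_closed; [exact: norm_hausdorff|exact: compact_box]. Qed.

Lemma open_dom_preimage (O : set 'rV[R]_3) : open O -> open (dom c `&` phi c @^-1` O).
Proof.
move=> oO; rewrite openE => p [dp Op]; apply: filterI.
  by have := dom_open c; rewrite openE; apply.
by apply: (phi_cont dp); move: oO; rewrite openE; apply.
Qed.

Lemma measurable_chart_box : measurable chart_box.
Proof.
rewrite (_ : chart_box = (dom c : set (borel Sigma)) `\` (dom c `&` phi c @^-1` (~` box x0 r))).
  apply: measurableD; first by apply: open_borel; exact: dom_open.
  by apply: open_borel; apply: open_dom_preimage; rewrite openC; exact: closed_box.
apply/seteqP; split => p.
  by move=> [dp bp]; split => // -[_ /(_ bp)].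
by move=> [dp nb]; split => //; apply: contrapT => nbp; apply: nb.
Qed.

Definition chart_param (t : T3) : borel Sigma := psi c (vec3 t).

Lemma measurable_chart_param : measurable_fun (box3 x0 r) chart_param.
Proof.
apply: (measurability _ (erefl (@measurable _ (borel Sigma)))).
move=> _ [V oV <-].
rewrite (_ : _ `&` _ = box3 x0 r `&` (@vec3 R) @^-1` (U `&` psi c @^-1` V)).
  apply: measurableI; first exact: measurable_box3.
  apply: measurable_vec3_open; rewrite openE => x [Ux Vx]; apply: filterI.
    by have := open_img; rewrite openE; apply.
  by apply: (psi_cont Ux); move: oV; rewrite openE; apply.
apply/seteqP; split => t [bt] /=; first by move=> Vt; split => //; split => //; exact: bU.
by move=> [].
Qed.

Lemma image_chart_box (A : set (borel Sigma)) :
  [set t : T3 | (phi c @` (A `&` chart_box)) (vec3 t)] = box3 x0 r `&` chart_param @^-1` A.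
Proof.
apply/seteqP; split => t.
  move=> [p [Ap [dp bp]] pt]; split; first by rewrite /box3 /= -pt.
  by rewrite /chart_param /= -pt phiK.
move=> [bt At]; have Ut := bU bt.
exists (chart_param t); last exact: phi_psi.
by split => //; split; [exact: dom_psi|rewrite /= phi_psi].
Qed.

(** On the compact cube the density sqrt(det h) has a positive minimum s, and C = 1/s. This
    direction of the comparison carries smallness in L^2 of Sigma over to the chart. *)
Lemma leb3_le_vol : exists2 C, 0 < C & forall A : set (borel Sigma), measurable A ->
  (leb3 (box3 x0 r `&` chart_param @^-1` A) <= C%:E * vol A)%E.
Proof.
have b0 : box x0 r x0 by move=> j; rewrite subrr normr0 ltW.
have wf : {within box x0 r, continuous (fun x => Num.sqrt (\det (mt h c x)))}.
  by apply: continuous_in_subspaceT => x /set_mem bx; exact: (ccon_sqrt_det (bU bx)).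
have [y yb Hy] := EVT_min_rV (ex_intro _ x0 b0) (@compact_box R x0 r) wf.
set s := Num.sqrt _ in Hy.
have s0 : 0 < s by rewrite sqrtr_gt0; apply/det_metric_gt0/bU/set_mem.
exists s^-1; first by rewrite invr_gt0.
move=> A mA.
have mE : measurable (box3 x0 r `&` chart_param @^-1` A).
  exact: measurable_chart_param (measurable_box3 x0 r) _ mA.
have mAb : measurable (A `&` chart_box) by apply: measurableI => //; exact: measurable_chart_box.
have volE := vol_h mAb (fun p H => H.2.1).
have le1 : (s%:E * leb3 (box3 x0 r `&` chart_param @^-1` A) <= vol A)%E.
  apply: (@le_trans _ _ (vol (A `&` chart_box))); last first.
    by apply: le_measure; rewrite ?inE //; exact: subIsetl.
  rewrite volE image_chart_box -integral_cst //.
  apply: ge0_le_integral => //.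
  - by move=> t _; rewrite /= lee_fin ltW.
  - apply/measurable_EFinP; apply: (@measurable_funS _ _ _ _ (box3 x0 r)) => //.
    + exact: measurable_box3.
    + exact: (measurable_ccon open_img bU ccon_sqrt_det).
  - by move=> t [bt _]; rewrite lee_fin; apply: Hy; exact/mem_set.
rewrite -lee_pdivrMl ?invr_gt0 // invrK; exact: le1.
Qed.

(** The comparison passes from sets to integrals by pushing Lebesgue measure on the cube forward to
    Sigma, where it is dominated by C vol. *)
Lemma integral_box_le_vol : exists2 C, 0 < C & forall f : Sigma -> R,
  measurable_fun [set: borel Sigma] f -> (forall p, 0 <= f p) ->
  (\int[@leb3 R]_(t in box3 x0 r) (f (psi c (vec3 t)))%:E <= C%:E * \int[vol]_p (f p)%:E)%E.
Proof.
have [C C0 HC] := leb3_le_vol.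
exists C => // f mf f0.
(* A total extension of the parametrization. The value [point] off the cube has no effect, as the
   measure [m0] below does not charge the complement of the cube. *)
pose Psi' (t : T3) : borel Sigma := if t \in box3 x0 r then chart_param t else point.
have mb := measurable_box3 x0 r.
have mPsi' : measurable_fun setT Psi'.
  move=> _ Y mY; rewrite setTI.
  have -> : Psi' @^-1` Y = (box3 x0 r `&` chart_param @^-1` Y) `|`
      (~` box3 x0 r `&` [set _ | Y point]).
    apply/seteqP; split => t; rewrite /Psi' /=.
      have [/set_mem bt Yt|/negP nb Yt] := boolP (t \in box3 x0 r); first by left.
      by right; split => // bt; apply: nb; exact/mem_set.
    by move=> [[bt Yt]|[nb Yt]]; rewrite ?(mem_set bt) ?(memNset nb).
  apply: measurableU; first exact: measurable_chart_param.
  apply: measurableI; first exact: measurableC.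
  have [Yp|Yp] := pselect (Y point).
    by rewrite (_ : mkset _ = setT) //; apply/seteqP; split.
  by rewrite (_ : mkset _ = set0) //; apply/seteqP; split.
have [m0 m0E] : exists m0 : {measure set T3 -> \bar R}, forall A, m0 A = leb3 (A `&` box3 x0 r).
  by exists (mrestr (@leb3 R) mb).
pose m1 : {measure set (borel Sigma) -> \bar R} :=
  measure_function_pushforward__canonical__measure_function_Measure m0 mPsi'.
pose C' := NngNum (ltW C0).
pose m2 : {measure set (borel Sigma) -> \bar R} := mscale C' vol.
have mfE : measurable_fun [set: borel Sigma] (EFin \o f) by apply/measurable_EFinP.
have m12 A : measurable A -> (m1 A <= m2 A)%E.
  move=> mA; apply: le_trans (HC A mA).
  rewrite /m1 /= /pushforward m0E le_eqVlt; apply/orP; left; apply/eqP; congr leb3.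
  apply/seteqP; split => t; rewrite /Psi' /=.
    by move=> [+ bt]; rewrite (mem_set bt).
  by move=> [bt At]; rewrite (mem_set bt).
have H := ge0_le_measure_integral m12 measurableT (fun p => (f0 p : (0 <= (f p)%:E)%E)) mfE.
have E2 : (\int[m2]_p (f p)%:E = C%:E * \int[vol]_p (f p)%:E)%E.
  rewrite /m2 ge0_integral_mscale //.
  by move=> p _; rewrite lee_fin.
rewrite -E2; apply: le_trans H.
have E3 : (\int[m1]_p (f p)%:E = \int[m0]_(t in Psi' @^-1` setT) ((EFin \o f) \o Psi') t)%E.
  by apply: (ge0_integral_pushforward mPsi' m0 measurableT mfE) => p _; rewrite lee_fin.
rewrite E3 preimage_setT.
apply: (@le_trans _ _ (\int[m0]_(t in box3 x0 r) ((EFin \o f) \o Psi') t)%E); last first.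
  apply: ge0_subset_integral; first exact: mb.
  - exact: measurableT.
  - exact: (measurableT_comp mfE mPsi').
  - by move=> t _; rewrite lee_fin.
  - by move=> t _.
rewrite le_eqVlt; apply/orP; left; apply/eqP.
transitivity (\int[m0]_(t in box3 x0 r) (f (psi c (vec3 t)))%:E)%E.
  apply: eq_measure_integral => A mA Ab; rewrite m0E.
  by rewrite (setIidl Ab).
by apply: eq_integral => t tb; rewrite /Psi' /= tb.
Qed.
End ChartMeasure.

(** * Elimination of the zeroth order terms *)

(* [u z = (u0 z, u1 z)] are solutions of one scalar first order equation
   [sum_k s0 k * d_k u0 + s1 k * d_k u1 + beta0 * u0 + beta1 * u1 = 0] whose zeroth order
   coefficients are eliminated through the determinant of three solutions. *)
Section Elimination.
Variables (R : realType) (x0 : 'rV[R]_3) (r : R) (U : set 'rV[R]_3).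
Hypothesis r0 : 0 < r.
Hypothesis oU : open U.
Hypothesis bU : box x0 r `<=` U.
Variables (s0 s1 : 'I_3 -> 'rV[R]_3 -> R[i]).
Hypothesis s0U : forall k, C1c U (s0 k).
Hypothesis s1U : forall k, C1c U (s1 k).
Variables (Z : Type) (u0 u1 : Z -> 'rV[R]_3 -> R[i]).
Hypothesis u0U : forall z, C1c U (u0 z).
Hypothesis u1U : forall z, C1c U (u1 z).
Local Notation cI := (cI x0 r).

Definition principal_part (z : Z) (x : 'rV[R]_3) : R[i] :=
  \sum_(k < 3) (s0 k x * cpart k (u0 z) x + s1 k x * cpart k (u1 z) x).

Definition wedge (v w : Z) (x : 'rV[R]_3) : R[i] := u0 v x * u1 w x - u1 v x * u0 w x.

(** Expansion along the first column of the 3 x 3 determinant whose rows are (principal part, u0,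
    u1) for z, v, w. Adding beta0 u0 + beta1 u1 to the first column leaves it unchanged. *)
Definition det3 (z v w : Z) (x : 'rV[R]_3) : R[i] :=
  principal_part z x * wedge v w x - principal_part v x * wedge z w x + principal_part w x * wedge z v x.

Hypothesis rel : forall (f : 'rV[R]_3 -> R[i]) z v w, Cc U f ->
  cI (fun x => f x * det3 z v w x) = 0.
Hypothesis dens : forall adjoint0 adjoint1 : 'rV[R]_3 -> R[i], Cc U adjoint0 -> Cc U adjoint1 ->
  (forall z, cI (fun x => adjoint0 x * u0 z x + adjoint1 x * u1 z x) = 0) ->
  forall f0 f1, Cc U f0 -> Cc U f1 -> cI (fun x => adjoint0 x * f0 x + adjoint1 x * f1 x) = 0.
Hypothesis nondeg : forall x, U x -> 0 < normsq (s0 0 x) + normsq (s1 0 x).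

Let wU v w : C1c U (wedge v w).
Proof.
exact: (C1cD oU (C1cM oU (u0U v) (u1U w)) (C1cN oU (C1cM oU (u1U v) (u0U w)))).
Qed.

Lemma Cc_principal_part z : Cc U (principal_part z).
Proof.
apply: Cc_sum => k; apply: CcD; apply: CcM.
- by apply: C1c_Cc; exact: s0U.
- by apply: Cc_cpart; exact: u0U.
- by apply: C1c_Cc; exact: s1U.
- by apply: Cc_cpart; exact: u1U.
Qed.

Section FixedPair.
Variables v w : Z.
Local Notation d := (wedge v w).

Definition symbol_div (s : 'I_3 -> 'rV[R]_3 -> R[i]) (x : 'rV[R]_3) : R[i] :=
  \sum_(k < 3) (cpart k d x * s k x + d x * cpart k (s k) x).

(** [adjoint0 f] and [adjoint1 f] are the two components of minus the formal transpose, applied to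
    f, of the first order operator which maps u to the determinant with u in the place of mode z. *)
Definition adjoint0 (f : 'rV[R]_3 -> R[i]) (x : 'rV[R]_3) : R[i] :=
  \sum_(k < 3) (cpart k f x * d x * s0 k x)
  + f x * (symbol_div s0 x + principal_part v x * u1 w x - principal_part w x * u1 v x).

Definition adjoint1 (f : 'rV[R]_3 -> R[i]) (x : 'rV[R]_3) : R[i] :=
  \sum_(k < 3) (cpart k f x * d x * s1 k x)
  + f x * (symbol_div s1 x - principal_part v x * u0 w x + principal_part w x * u0 v x).

Lemma Cc_symbol_div s : (forall k, C1c U (s k)) -> Cc U (symbol_div s).
Proof.
move=> sU; apply: Cc_sum => k; apply: CcD; apply: CcM.
- by apply: Cc_cpart; exact: wU.
- by apply: C1c_Cc; exact: sU.
- by apply: C1c_Cc; exact: wU.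
- by apply: Cc_cpart; exact: sU.
Qed.

Lemma Cc_adjoint0 f : C1c U f -> Cc U (adjoint0 f).
Proof.
move=> fU; apply: CcD.
  apply: Cc_sum => k; apply: CcM; last by apply: C1c_Cc; exact: s0U.
  by apply: CcM; [apply: Cc_cpart|apply: C1c_Cc; exact: wU].
apply: CcM; first exact: C1c_Cc.
apply: CcB; first apply: CcD; first exact: Cc_symbol_div.
  by apply: CcM; [exact: Cc_principal_part|apply: C1c_Cc; exact: u1U].
by apply: CcM; [exact: Cc_principal_part|apply: C1c_Cc; exact: u1U].
Qed.

Lemma Cc_adjoint1 f : C1c U f -> Cc U (adjoint1 f).
Proof.
move=> fU; apply: CcD.
  apply: Cc_sum => k; apply: CcM; last by apply: C1c_Cc; exact: s1U.
  by apply: CcM; [apply: Cc_cpart|apply: C1c_Cc; exact: wU].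
apply: CcM; first exact: C1c_Cc.
apply: CcD; first apply: CcB; first exact: Cc_symbol_div.
  by apply: CcM; [exact: Cc_principal_part|apply: C1c_Cc; exact: u0U].
by apply: CcM; [exact: Cc_principal_part|apply: C1c_Cc; exact: u0U].
Qed.

Definition flux (f : 'rV[R]_3 -> R[i]) z k (x : 'rV[R]_3) : R[i] :=
  f x * (d x * (s0 k x * u0 z x + s1 k x * u1 z x)).

Let sum_uU z k : C1c U (fun x => s0 k x * u0 z x + s1 k x * u1 z x).
Proof. exact: (C1cD oU (C1cM oU (s0U k) (u0U z)) (C1cM oU (s1U k) (u1U z))). Qed.

Let dsumU z k : C1c U (fun x => d x * (s0 k x * u0 z x + s1 k x * u1 z x)).
Proof. exact: (C1cM oU (wU v w) (sum_uU z k)). Qed.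

Lemma C1c_flux f z k : C1c U f -> C1c U (flux f z k).
Proof. by move=> fU; exact: (C1cM oU fU (dsumU z k)). Qed.

Lemma cpart_flux f z k x : C1c U f -> U x -> cpart k (flux f z k) x =
  cpart k f x * d x * (s0 k x * u0 z x + s1 k x * u1 z x)
  + f x * (cpart k d x * (s0 k x * u0 z x + s1 k x * u1 z x)
      + d x * (cpart k (s0 k) x * u0 z x + s0 k x * cpart k (u0 z) x
        + (cpart k (s1 k) x * u1 z x + s1 k x * cpart k (u1 z) x))).
Proof.
move=> fU Ux; rewrite (cpartM oU k fU (dsumU z k) Ux).
rewrite (cpartM oU k (wU v w) (sum_uU z k) Ux).
rewrite (cpartD k (C1cM oU (s0U k) (u0U z)) (C1cM oU (s1U k) (u1U z)) Ux).
rewrite (cpartM oU k (s0U k) (u0U z) Ux) (cpartM oU k (s1U k) (u1U z) Ux).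
by rewrite mulrA.
Qed.

(** Lagrange's identity: the operator and its transpose differ by a divergence. *)
Lemma divergence_flux f z x : C1c U f -> U x ->
  \sum_(k < 3) cpart k (flux f z k) x =
  f x * det3 z v w x + (adjoint0 f x * u0 z x + adjoint1 f x * u1 z x).
Proof.
move=> fU Ux; under eq_bigr do rewrite cpart_flux //.
rewrite /adjoint0 /adjoint1 /symbol_div /det3 {1}/principal_part.
rewrite (_ : \sum_(k < 3) _ = f x * d x * (\sum_(k < 3) (s0 k x * cpart k (u0 z) x + s1 k x * cpart k (u1 z) x))
  + u0 z x * (\sum_(k < 3) (cpart k f x * d x * s0 k x)
      + f x * \sum_(k < 3) (cpart k d x * s0 k x + d x * cpart k (s0 k) x))
  + u1 z x * (\sum_(k < 3) (cpart k f x * d x * s1 k x)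
      + f x * \sum_(k < 3) (cpart k d x * s1 k x + d x * cpart k (s1 k) x))); last first.
  rewrite !mulr_sumr -!big_split /= !mulr_sumr -!big_split /=.
  by apply: eq_bigr => k _; ring.
move: (\sum_(k < 3) (s0 k x * _ + _)) => Lz.
move: (\sum_(k < 3) (cpart k f x * d x * s0 k x)) (\sum_(k < 3) (cpart k f x * d x * s1 k x)).
move: (\sum_(k < 3) (cpart k d x * s0 k x + _)) (\sum_(k < 3) (cpart k d x * s1 k x + _)).
move: (principal_part v x) (principal_part w x) => Lv Lw a b c e; rewrite /wedge.
move: (f x) (u0 z x) (u1 z x) (u0 v x) (u1 v x) (u0 w x) (u1 w x) => F A0 A1 B0 B1 C0 C1.
ring.
Qed.

(** The flux integrates to 0 because f vanishes on the faces, and [rel] disposes of the determinant.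
    What is left is a pairing with the arbitrary mode z, to which density applies. *)
Lemma cI_adjoint f z : C1c U f ->
  (forall x : 'rV[R]_3, (exists j, `|x 0 j - x0 0 j| = r) -> f x = 0) ->
  cI (fun x => adjoint0 f x * u0 z x + adjoint1 f x * u1 z x) = 0.
Proof.
move=> fU f0.
have Kc : Cc U (fun x => adjoint0 f x * u0 z x + adjoint1 f x * u1 z x).
  apply: CcD; apply: CcM.
  - exact: Cc_adjoint0.
  - by apply: C1c_Cc; exact: u0U.
  - exact: Cc_adjoint1.
  - by apply: C1c_Cc; exact: u1U.
have Dc : Cc U (fun x => f x * det3 z v w x).
  apply: CcM; first exact: C1c_Cc.
  by apply: CcD; first apply: CcB; apply: CcM; [exact: Cc_principal_part|apply: C1c_Cc; exact: wU|exact: Cc_principal_part|apply: C1c_Cc; exact: wU|exact: Cc_principal_part|apply: C1c_Cc; exact: wU].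
have S0 : cI (fun x => \sum_(k < 3) cpart k (flux f z k) x) = 0.
  rewrite (cI_sum r0 oU bU); last by move=> k; apply: Cc_cpart; exact: C1c_flux.
  apply: big1 => k _; apply: (cI_cpart r0 oU bU); first exact: C1c_flux.
  by move=> x xj; rewrite /flux f0 // mul0r.
have E := cID r0 oU bU Dc Kc; rewrite (rel z v w (C1c_Cc fU)) add0r in E.
rewrite -E -[RHS]S0; apply: eq_cI => x bx; rewrite divergence_flux //; exact: bU.
Qed.
End FixedPair.

(** A polynomial that vanishes on the faces and is positive inside is enough for one integration by
    parts. It is written with sums, opposites and products so as to match the closure properties of
    [C1r]. *)
Definition box_bump (x : 'rV[R]_3) : R :=
  (r ^+ 2 + - (x 0 0 + - x0 0 0) * (x 0 0 + - x0 0 0))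
  * (r ^+ 2 + - (x 0 1 + - x0 0 1) * (x 0 1 + - x0 0 1))
  * (r ^+ 2 + - (x 0 2%:R + - x0 0 2%:R) * (x 0 2%:R + - x0 0 2%:R)).

Lemma box_bumpE x : box_bump x = \prod_(j < 3) (r ^+ 2 - (x 0 j - x0 0 j) ^+ 2).
Proof.
rewrite !big_ord_recr big_ord0 /= mul1r /box_bump.
rewrite (_ : widen_ord _ _ = 0); last exact: val_inj.
rewrite (_ : widen_ord _ _ = 1); last exact: val_inj.
rewrite (_ : ord_max = 2%:R); last exact: val_inj.
by rewrite !expr2 !mulNr.
Qed.

Lemma C1r_box_bump : C1r U box_bump.
Proof.
have cU j : C1r U (fun x => x 0 j + - x0 0 j).
  by apply: C1rD => //; [exact: C1r_coord|exact: C1r_cst].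
have qU j : C1r U (fun x => r ^+ 2 + - (x 0 j + - x0 0 j) * (x 0 j + - x0 0 j)).
  apply: (C1rD oU (C1r_cst U (r ^+ 2))).
  exact: (C1rM oU (C1rN oU (cU j)) (cU j)).
exact: (C1rM oU (C1rM oU (qU 0) (qU 1)) (qU 2%:R)).
Qed.

Lemma box_bump_eq0 (x : 'rV[R]_3) : (exists j, `|x 0 j - x0 0 j| = r) -> box_bump x = 0.
Proof.
move=> [j xj]; rewrite box_bumpE (bigD1 j) //=.
by rewrite -(real_normK (num_real (x 0 j - x0 0 j))) xj subrr mul0r.
Qed.

Lemma box_bump_ge0 x : box x0 r x -> 0 <= box_bump x.
Proof.
move=> bx; rewrite box_bumpE; apply: prodr_ge0 => j _.
by rewrite subr_ge0 -(real_normK (num_real _)) ler_sqr ?nnegrE ?(ltW r0).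
Qed.

Lemma box_bump_gt0 x : box x0 (r / 2) x -> 0 < box_bump x.
Proof.
move=> bx; rewrite box_bumpE; apply: prodr_gt0 => j _.
rewrite subr_gt0 -(real_normK (num_real _)) ltr_sqr ?nnegrE ?(ltW r0) //.
by apply: le_lt_trans (bx j) _; rewrite ltr_pdivrMr // ltr_pMr // ltr1n.
Qed.

Definition box_bumpC (x : 'rV[R]_3) : R[i] := (box_bump x)%:C.
Definition x_box_bumpC (x : 'rV[R]_3) : R[i] := (x 0 0 * box_bump x)%:C.

Let bumpU : C1c U box_bumpC. Proof. by apply: C1c_real; exact: C1r_box_bump. Qed.
Let xbumpU : C1c U x_box_bumpC.
Proof. by apply: C1c_real; apply: C1rM => //; [exact: C1r_coord|exact: C1r_box_bump]. Qed.

Lemma cpart_x_box_bumpC k x : U x ->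
  cpart k x_box_bumpC x = (0 == k)%:R * box_bumpC x + (x 0 0)%:C * cpart k box_bumpC x.
Proof.
move=> Ux; rewrite /x_box_bumpC /box_bumpC !cpart_real (partialM k (C1r_coord U 0) C1r_box_bump Ux).
have -> : partial k (fun y : 'rV[R]_3 => y 0 0) x = (0 == k)%:R.
  by have H := is_derive_coord 0 k x; exact: derive_val.
by rewrite rmorphD !rmorphM rmorph_nat.
Qed.

(* Multiplication by [x_0] turns the first order part of the equation into its symbol
   in the direction [dx_0]. *)
Lemma cI_symbol v w f0 f1 : Cc U f0 -> Cc U f1 ->
  cI (fun x => box_bumpC x * wedge v w x * (s0 0 x * f0 x + s1 0 x * f1 x)) = 0.
Proof.
move=> f0U f1U.
have x0U : Cc U (fun x => (x 0 0)%:C).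
  by apply: Cc_real; apply: C1r_ccon; exact: C1r_coord.
(* In [H1] the factor x_0 sits inside the transpose, in [H2] outside of it. The difference is the
   commutator of the transpose with x_0, which is of order zero. *)
have H1 := dens (Cc_adjoint0 v w xbumpU) (Cc_adjoint1 v w xbumpU) (fun z => cI_adjoint v w z xbumpU _) f0U f1U.
have H2 := dens (Cc_adjoint0 v w bumpU) (Cc_adjoint1 v w bumpU) (fun z => cI_adjoint v w z bumpU _)
  (CcM x0U f0U) (CcM x0U f1U).
have {}H1 : cI (fun x => adjoint0 v w x_box_bumpC x * f0 x + adjoint1 v w x_box_bumpC x * f1 x) = 0.
  by apply: H1 => x /box_bump_eq0 e; rewrite /x_box_bumpC e mulr0.
have {}H2 : cI (fun x => adjoint0 v w box_bumpC x * ((x 0 0)%:C * f0 x)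
    + adjoint1 v w box_bumpC x * ((x 0 0)%:C * f1 x)) = 0.
  by apply: H2 => x /box_bump_eq0 e; rewrite /box_bumpC e.
have c1 : Cc U (fun x => adjoint0 v w x_box_bumpC x * f0 x + adjoint1 v w x_box_bumpC x * f1 x).
  by apply: CcD; apply: CcM => //; [exact: Cc_adjoint0|exact: Cc_adjoint1].
have c2 : Cc U (fun x => adjoint0 v w box_bumpC x * ((x 0 0)%:C * f0 x)
    + adjoint1 v w box_bumpC x * ((x 0 0)%:C * f1 x)).
  by apply: CcD; apply: CcM; [exact: Cc_adjoint0|exact: CcM|exact: Cc_adjoint1|exact: CcM].
rewrite -[RHS](subr0 0) -{1}H1 -H2 -(cIN r0 oU bU c2) -(cID r0 oU bU c1 (CcN c2)).
apply: eq_cI => x /bU Ux; rewrite /adjoint0 /adjoint1.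
have xbumpE : x_box_bumpC x = (x 0 0)%:C * box_bumpC x by rewrite /x_box_bumpC /box_bumpC rmorphM.
rewrite !sum3E !cpart_x_box_bumpC // xbumpE.
move: (cpart 0 box_bumpC x) (cpart 1 box_bumpC x) (cpart 2%:R box_bumpC x) => p0 p1 p2.
move: (s0 0 x) (s0 1 x) (s0 2%:R x) (s1 0 x) (s1 1 x) (s1 2%:R x) => a0 a1 a2 b0 b1 b2.
move: (symbol_div v w s0 x + _ - _) (symbol_div v w s1 x - _ + _) => A B.
move: (wedge v w x) (box_bumpC x) (f0 x) (f1 x) ((x 0 0)%:C) => D F g0 g1 y.
rewrite (_ : (0 == 0 :> 'I_3)%:R = 1) // (_ : (0 == 1 :> 'I_3)%:R = 0) //.
ring.
Qed.

(** With the conjugate symbol as test pair, N times [wedge v w] integrates to 0, where N is the bump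
    times the squared norm of the symbol. The wedge is linear in each mode, so density replaces mode
    v by (1, 0) and then w by (0, 1); this leaves the integral of N, which is positive. *)
Lemma elimination_absurd : False.
Proof.
pose n x := normsq (s0 0 x) + normsq (s1 0 x).
pose N x : R[i] := box_bumpC x * (n x)%:C.
have s0c : Cc U (s0 0) := C1c_Cc (s0U 0).
have s1c : Cc U (s1 0) := C1c_Cc (s1U 0).
have nN x : (n x)%:C = s0 0 x * conjc (s0 0 x) + s1 0 x * conjc (s1 0 x).
  rewrite /n rmorphD /normsq; move: (s0 0 x) (s1 0 x) => [a b] [a' b'].
  by apply: complexP; rewrite /=; ring.
have bumpc : Cc U box_bumpC by exact: C1c_Cc.
have Nc : Cc U N.
  apply: CcM => //; rewrite (_ : (fun x => (n x)%:C) =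
    (fun x => s0 0 x * conjc (s0 0 x) + s1 0 x * conjc (s1 0 x))); last exact/funext.
  by apply: CcD; apply: CcM => //; exact: Cc_conj.
have u0c z : Cc U (u0 z) := C1c_Cc (u0U z).
have u1c z : Cc U (u1 z) := C1c_Cc (u1U z).
have c0 : Cc U (fun=> 0 : R[i]) by exact: Cc_cst.
have c1 : Cc U (fun=> 1 : R[i]) by exact: Cc_cst.
have H1 v w : cI (fun x => N x * u1 w x * u0 v x + - (N x * u0 w x) * u1 v x) = 0.
  rewrite -[RHS](cI_symbol v w (Cc_conj s0c) (Cc_conj s1c)).
  by apply: eq_cI => x _; rewrite /N nN /wedge; ring.
have H2 w : cI (fun x => N x * u1 w x) = 0.
  rewrite -[RHS](dens (CcM Nc (u1c w)) (CcN (CcM Nc (u0c w))) (H1^~ w) c1 c0).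
  by apply: eq_cI => x _; ring.
have H3 : cI N = 0.
  rewrite -[RHS](dens c0 Nc _ c0 c1).
    by apply: eq_cI => x _; ring.
  by move=> w; rewrite -[RHS](H2 w); apply: eq_cI => x _; ring.
have : 0 < rI x0 r (fun x => box_bump x * n x).
  apply: (rI_gt0 r0 oU bU).
  - rewrite (_ : (fun x => _) = (fun x => complex.Re (N x))); first by case: Nc.
    by apply/funext => x; rewrite /N /box_bumpC /= mul0r subr0.
  - move=> x bx; rewrite mulr_ge0 ?box_bump_ge0 //; exact/ltW/nondeg/bU.
  - move=> x bx; rewrite mulr_gt0 ?box_bump_gt0 //; apply/nondeg/bU => j.
    by apply: le_trans (bx j) _; rewrite ler_pdivrMr // ler_pMr // ler1n.
rewrite (_ : rI x0 r _ = complex.Re (cI N)); first by rewrite H3 ltxx.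
by apply: eq_rI => x _; rewrite /N /box_bumpC /= mul0r subr0.
Qed.
End Elimination.

(** * The Dirac operator in charts *)

Section DiracInCharts.
Variables (R : realType) (Sigma : ptopologicalType) (M : atlas3 R Sigma).

Lemma near_overlap (c d : chart M) x : img c x -> dom d (psi c x) ->
  \forall y \near x, (phi c @` (dom c `&` dom d)) y.
Proof.
move=> Ux dx.
have n1 : \forall y \near x, img c y by have := @open_img _ _ _ c; rewrite openE; apply.
have n2 : \forall y \near x, dom d (psi c y).
  by apply: (psi_cont Ux); have := dom_open d; rewrite openE; apply.
near=> y; have Uy : img c y by near: y.
exists (psi c y); last exact: phi_psi.
by split; [exact: dom_psi|near: y].
Unshelve. all: by end_near. Qed.

(** [vf_app] differentiates in the chart attached to the point, which may change from point to
    point. The Jacobian from the chain rule is absorbed by the transformation law of the vector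
    field, so a fixed chart can be used. *)
Lemma vf_app_chart (X : vector_field M) (f : Sigma -> R) (c : chart M) (p : Sigma) :
  smooth_fun M f -> dom c p ->
  vf_app X f p =
  \sum_(j < 3) vf X c (phi c p) 0 j * partial j (f \o psi c) (phi c p).
Proof.
move=> fs dp; rewrite /vf_app; set d := chart_at M p; set x := phi c p.
have Ux : img c x by exists p.
have pd : dom d p := chart_atP M p.
have xp : psi c x = p by rewrite /x phiK.
pose T y := phi d (psi c y).
have Tx : T x = phi d p by rewrite /T xp.
have inter : (phi c @` (dom c `&` dom d)) x by exists p.
have nE : \forall y \near x, (f \o psi c) y = ((f \o psi d) \o T) y.
  have := @near_overlap c d x Ux (ltac:(by rewrite xp)); apply: filterS => y [q [cq dq] <-].
  by rewrite /= /T (phiK cq) (phiK dq).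
have pE j : partial j (f \o psi c) x =
    \sum_(l < 3) partial j (fun y => T y 0 l) x * partial l (f \o psi d) (phi d p).
  rewrite -Tx -(@partial_comp R (img d) (f \o psi d) T x j).
  - by rewrite /partial; exact: near_eq_derive.
  - exact: open_img.
  - exact: (fs d 1%N).
  - by rewrite Tx; exists p.
  - by move=> l; exact: ((compat c d l 1%N).2 j).1.
under eq_bigr do rewrite (vf_trans X dp pd) mxE mulr_suml.
rewrite exchange_big; apply: eq_bigr => j _; rewrite pE mulr_sumr.
by apply: eq_bigr => l _; rewrite mxE mulrA.
Qed.

Lemma vf_app_spinor_chart (X : vector_field M) (chi : Sigma -> 'cV[R[i]]_4) c x a :
  smooth_spinor M chi -> img c x ->
  vf_app_spinor X chi (psi c x) a 0 =
  \sum_(j < 3) (vf X c x 0 j)%:C * cpart j (fun y => chi (psi c y) a 0) x.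
Proof.
move=> chis Ux; have dp := dom_psi Ux.
rewrite mxE (vf_app_chart X (chis a).1 dp) (vf_app_chart X (chis a).2 dp) phi_psi //.
rewrite /cpart; elim/big_rec3: _ => // j z b d _ <-; case: z => b' d'.
by apply: complexP => /=; rewrite ?mul0r ?subr0 ?addr0.
Qed.

Lemma gamma0_gammas k : gamma0 *m gammas k =
  @block_mx _ 2 2 2 2 0 (pauli R k) (pauli R k) 0 :> 'M[R[i]]_4.
Proof.
rewrite /gamma0 /gammas (@mulmx_block _ 2 2 2 2 2 2) !mul0mx !mulmx0 !mul1mx.
by rewrite mulNmx mulmxN mul1mx opprK !addr0 !add0r.
Qed.

Lemma gammas_mul k j : gammas k *m gammas j =
  @block_mx _ 2 2 2 2 (- (pauli R k *m pauli R j)) 0 0 (- (pauli R k *m pauli R j)) :> 'M[R[i]]_4.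
Proof.
rewrite /gammas (@mulmx_block _ 2 2 2 2 2 2) !mul0mx !mulmx0.
by rewrite mulNmx mulmxN !addr0 !add0r.
Qed.

Variables (g : metric M) (eta : 'I_3 -> vector_field M).

(** A product of two gamma matrices is block diagonal with equal blocks, and this form is stable
    under linear combinations; so the connection does not mix upper and lower components. *)
Lemma spin_Gamma_block i p :
  exists G : 'M[R[i]]_2, spin_Gamma g eta i p = @block_mx _ 2 2 2 2 G 0 0 G.
Proof.
pose P (A : 'M[R[i]]_4) := exists G : 'M[R[i]]_2, A = @block_mx _ 2 2 2 2 G 0 0 G.
have PZ a A : P A -> P (a *: A).
  by move=> [G ->]; exists (a *: G); rewrite (@scale_block_mx _ 2 2 2 2) !scaler0.
have PD A B : P A -> P B -> P (A + B).
  by move=> [G ->] [G' ->]; exists (G + G'); rewrite (@add_block_mx _ 2 2 2 2) !addr0.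
have P1 : P 1%:M by exists 1%:M; rewrite -(@scalar_mx_block _ 2 2).
have P0 : P 0 by rewrite -(scale0r 1%:M); exact: PZ.
rewrite /spin_Gamma -scaleN1r; apply: (PZ); apply: (PZ).
apply: big_ind => // j _; apply: big_ind => // k _; apply: PZ.
by rewrite gammas_mul; eexists.
Qed.

Lemma block_antidiag_row2 (A : 'M[R[i]]_2) (v : 'cV[R[i]]_4) :
  (@block_mx _ 2 2 2 2 0 A A 0 *m v) 2%:R 0 = A 0 0 * v 0 0 + A 0 1 * v 1 0.
Proof.
have -> : (2%:R : 'I_4) = rshift 2 (0 : 'I_2) by exact: val_inj.
rewrite -{1}(@vsubmxK _ 2 2 1 v) (@mul_block_col _ 2 2 2 2 1) (@col_mxEd _ 2 2).
rewrite mul0mx addr0 mxE big_ord_recl big_ord1 !mxE.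
by congr (A _ _ * v _ _ + A _ _ * v _ _); exact: val_inj.
Qed.

Lemma block_diag_row (G : 'M[R[i]]_2) (v : 'cV[R[i]]_4) (a : 'I_2) :
  (@block_mx _ 2 2 2 2 G 0 0 G *m v) (lshift 2 a) 0 = G a 0 * v 0 0 + G a 1 * v 1 0.
Proof.
rewrite -{1}(@vsubmxK _ 2 2 1 v) (@mul_block_col _ 2 2 2 2 1) (@col_mxEu _ 2 2).
rewrite mul0mx addr0 mxE big_ord_recl big_ord1 !mxE.
by congr (G a _ * v _ _ + G a _ * v _ _); exact: val_inj.
Qed.

Lemma block_diag_row0 (G : 'M[R[i]]_2) (v : 'cV[R[i]]_4) :
  (@block_mx _ 2 2 2 2 G 0 0 G *m v) 0 0 = G 0 0 * v 0 0 + G 0 1 * v 1 0.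
Proof.
by rewrite -block_diag_row; congr fun_of_matrix; exact: val_inj.
Qed.

Lemma block_diag_row1 (G : 'M[R[i]]_2) (v : 'cV[R[i]]_4) :
  (@block_mx _ 2 2 2 2 G 0 0 G *m v) 1 0 = G 1 0 * v 0 0 + G 1 1 * v 1 0.
Proof.
by rewrite -block_diag_row; congr fun_of_matrix; exact: val_inj.
Qed.

Lemma pauli_row0 :
  (pauli R 0 0 0 = 0) * (pauli R 0 0 1 = 1) * (pauli R 1 0 0 = 0) * (pauli R 1 0 1 = - 'i%C)
  * (pauli R 2%:R 0 0 = 1) * (pauli R 2%:R 0 1 = 0).
Proof. by rewrite /pauli /mx2 /=; do ?split; rewrite mxE. Qed.

Lemma gamma0_row2 (v : 'cV[R[i]]_4) : (gamma0 *m v) 2%:R 0 = - v 2%:R 0.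
Proof.
have -> : (2%:R : 'I_4) = rshift 2 (0 : 'I_2) by exact: val_inj.
rewrite -{1}(@vsubmxK _ 2 2 1 v) /gamma0 (@mul_block_col _ 2 2 2 2 1) (@col_mxEd _ 2 2).
by rewrite mul0mx add0r mulNmx mul1mx !mxE.
Qed.

Lemma Hsp_row2 p : exists b0 b1 : R[i], forall (m : R) (chi : Sigma -> 'cV[R[i]]_4),
  Hsp g eta m chi p 2%:R 0 =
  - ('i%C * (vf_app_spinor (eta 2%:R) chi p 0 0 + vf_app_spinor (eta 0) chi p 1 0
             - 'i%C * vf_app_spinor (eta 1) chi p 1 0
             + b0 * chi p 0 0 + b1 * chi p 1 0))
  - m%:C * chi p 2%:R 0.
Proof.
have [G GE] := choice (fun i => spin_Gamma_block i p).
exists (G 2%:R 0 0 + G 0 1 0 - 'i%C * G 1 1 0), (G 2%:R 0 1 + G 0 1 1 - 'i%C * G 1 1 1) => m chi.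
have lin (a b : R[i]) (S V : 'cV[R[i]]_4) i : (- (a *: S) + b *: V) i 0 = - (a * S i 0) + b * V i 0.
  by rewrite !mxE.
have addE (V W : 'cV[R[i]]_4) i : (V + W) i 0 = V i 0 + W i 0 by rewrite mxE.
have col i : (gamma0 *m gammas i *m
      (vf_app_spinor (eta i) chi p + spin_Gamma g eta i p *m chi p)) 2%:R 0 =
    pauli R i 0 0 * (vf_app_spinor (eta i) chi p 0 0 + (G i 0 0 * chi p 0 0 + G i 0 1 * chi p 1 0)) +
    pauli R i 0 1 * (vf_app_spinor (eta i) chi p 1 0 + (G i 1 0 * chi p 0 0 + G i 1 1 * chi p 1 0)).
  rewrite GE gamma0_gammas block_antidiag_row2 !addE.
  by rewrite block_diag_row0 block_diag_row1.
rewrite /Hsp lin gamma0_row2 summxE (eq_bigr _ (fun i _ => col i)) sum3E.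
have [[[[[p1 p2] p3] p4] p5] p6] := pauli_row0.
rewrite p1 p2 p3 p4 p5 p6.
move: (vf_app_spinor (eta 0) chi p) => v0.
move: (vf_app_spinor (eta 1) chi p) => v1.
move: (vf_app_spinor (eta 2%:R) chi p) (chi p) => v2 c.
ring.
Qed.

Definition symb0 (c : chart M) (k : 'I_3) (x : 'rV[R]_3) : R[i] := (vf (eta 2%:R) c x 0 k)%:C.
Definition symb1 (c : chart M) (k : 'I_3) (x : 'rV[R]_3) : R[i] :=
  (vf (eta 0) c x 0 k)%:C - 'i%C * (vf (eta 1) c x 0 k)%:C.

(** The inhomogeneity i (l + m) chi_2 is 0 for l = -m, and for l = m it is governed by the third
    component alone. [b0] and [b1] are quantified before the mode, as the elimination demands. *)
Lemma dirac_row2 c x : img c x -> exists b0 b1 : R[i],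
  forall (m l : R) (chi : Sigma -> 'cV[R[i]]_4), smooth_spinor M chi ->
  (forall p, Hsp g eta m chi p = l%:C *: chi p) ->
  \sum_(k < 3) (symb0 c k x * cpart k (fun y => chi (psi c y) 0 0) x
                + symb1 c k x * cpart k (fun y => chi (psi c y) 1 0) x) =
  'i%C * (l + m)%:C * chi (psi c x) 2%:R 0
  - b0 * chi (psi c x) 0 0 - b1 * chi (psi c x) 1 0.
Proof.
move=> Ux; have [b0 [b1 H]] := Hsp_row2 (psi c x); exists b0, b1 => m l chi chis chiE.
have := H m chi; rewrite chiE mxE !(vf_app_spinor_chart _ _ chis Ux) !sum3E /symb0 /symb1.
set A0 := cpart 0 _ _; set A1 := cpart 1 _ _; set A2 := cpart 2%:R _ _.
set B0 := cpart 0 _ _; set B1 := cpart 1 _ _; set B2 := cpart 2%:R _ _.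
rewrite rmorphD /= => E.
have i2 : 'i%C * 'i%C = -1 :> R[i] by rewrite -expr2 sqr_i.
have E' : 'i%C * ((l%:C + m%:C) * chi (psi c x) 2%:R 0) =
    'i%C * (l%:C * chi (psi c x) 2%:R 0 + m%:C * chi (psi c x) 2%:R 0).
  by rewrite mulrDl.
rewrite -mulrA E' E subrK mulrN mulrA i2 mulN1r opprK; ring.
Qed.
End DiracInCharts.

(** * Density of the eigenspinors in charts *)

Section MeasurableComplex.
Variables (R : realType) (Sigma : ptopologicalType).
Implicit Types F G : Sigma -> R[i].

Definition cmeas F :=
  measurable_fun [set: borel Sigma] (fun p => complex.Re (F p)) /\
  measurable_fun [set: borel Sigma] (fun p => complex.Im (F p)).

Lemma cmeas0 : cmeas (fun=> 0).
Proof. by split; exact: measurable_cst. Qed.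

Lemma cmeasD F G : cmeas F -> cmeas G -> cmeas (fun p => F p + G p).
Proof.
move=> [F1 F2] [G1 G2]; split.
  by under eq_fun do rewrite ReD; exact: measurable_funD.
by under eq_fun do rewrite ImD; exact: measurable_funD.
Qed.

Lemma cmeasZ (a : R[i]) F : cmeas F -> cmeas (fun p => a * F p).
Proof.
move=> [F1 F2]; split.
  under eq_fun do rewrite ReM; apply: measurable_funB;
    by apply: measurable_funM => //; exact: measurable_cst.
under eq_fun do rewrite ImM; apply: measurable_funD;
  by apply: measurable_funM => //; exact: measurable_cst.
Qed.

Lemma cmeas_sum (I : Type) (s : seq I) (F : I -> Sigma -> R[i]) :
  (forall i, cmeas (F i)) -> cmeas (fun p => \sum_(i <- s) F i p).
Proof.
move=> FU; elim: s => [|i s IH].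
  by under eq_fun do rewrite big_nil; exact: cmeas0.
by under eq_fun do rewrite big_cons; exact: cmeasD.
Qed.

Lemma measurable_normsq F : cmeas F ->
  measurable_fun [set: borel Sigma] (fun p => normsq (F p)).
Proof.
move=> [F1 F2]; rewrite /normsq; apply: measurable_funD.
  by under eq_fun do rewrite expr2; exact: measurable_funM.
by under eq_fun do rewrite expr2; exact: measurable_funM.
Qed.
End MeasurableComplex.

Section DenseSpan.
Variables (R : realType) (Sigma : ptopologicalType) (M : atlas3 R Sigma).
Variables (h : metric M) (eta : 'I_3 -> vector_field M).
Hypothesis eta_orthonormal : orthonormal_frame h eta.
Variable vol : {finite_measure set (borel Sigma) -> \bar R}.
Hypothesis vol_h : riemannian_measure h vol.
Variables (c : chart M) (x0 : 'rV[R]_3) (r : R).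
Hypothesis r0 : 0 < r.
Local Notation U := (img c).
Hypothesis bU : box x0 r `<=` U.
Variable chi : int -> Sigma -> 'cV[R[i]]_4.
Hypothesis chi_onb : orthonormal_basis vol chi.
Hypothesis chi_smooth : forall z, z != 0 -> smooth_spinor M (chi z).
Local Notation cI := (cI x0 r).
Local Notation rI := (rI x0 r).
Let oU : open U := @open_img _ _ _ c.

Definition mode_index (z : bool * nat) : int := if z.1 then z.2.+1%:Z else - z.2.+1%:Z.

Lemma mode_index_neq0 z : mode_index z != 0.
Proof. by case: z => [[] n]. Qed.

Definition chart_mode (a : 'I_4) (z : bool * nat) (x : 'rV[R]_3) : R[i] := chi (mode_index z) (psi c x) a 0.

Lemma C1c_chart_mode a z : C1c U (chart_mode a z).
Proof.
have [H1 H2] := chi_smooth (mode_index_neq0 z) a.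
by split; [exact: (H1 c 1%N)|exact: (H2 c 1%N)].
Qed.

Definition chart_ext (f : 'rV[R]_3 -> R[i]) (p : Sigma) : R[i] :=
  if p \in chart_box c x0 r then f (phi c p) else 0.

Lemma measurable_chart_ext (F : 'rV[R]_3 -> R) : ccon U F ->
  measurable_fun [set: borel Sigma]
    (fun p => if p \in chart_box c x0 r then F (phi c p) else 0).
Proof.
move=> Fc.
have mF : measurable_fun (chart_box c x0 r) (fun p : borel Sigma => F (phi c p)).
  apply: (measurability _ (RGenOpens.measurableE R)) => _ [_ [a [b ->] <-]].
  rewrite (_ : _ `&` _ = chart_box c x0 r `&`
      ((dom c `&` phi c @^-1` (U `&` F @^-1` `]a, b[)) : set (borel Sigma))).
    apply: measurableI; first exact: measurable_chart_box.
    apply: open_borel; apply: open_dom_preimage; rewrite openE => x [Ux Fx].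
    apply: filterI; first by move: oU; rewrite openE; apply.
    by apply: (Fc x Ux); apply: open_nbhs_nbhs; split => //; exact: interval_open.
  apply/seteqP; split => p [[dp bp]] /=; first by move=> Fp; do !split => //; exact: bU.
  by move=> [_ [_ Fp]]; do !split.
have := (measurable_restrict (fun p : borel Sigma => F (phi c p))
  (measurable_chart_box c x0 r) measurableT).1.
by rewrite setTI => /(_ mF); congr measurable_fun.
Qed.

Lemma cmeas_chart_ext f : Cc U f -> cmeas (chart_ext f).
Proof.
move=> [f1 f2]; split.
  rewrite (_ : (fun p => _) = (fun p => if p \in chart_box c x0 r
    then complex.Re (f (phi c p)) else 0)); first exact: (measurable_chart_ext f1).
  by apply/funext => p; rewrite /chart_ext; case: ifP.
rewrite (_ : (fun p => _) = (fun p => if p \in chart_box c x0 r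
  then complex.Im (f (phi c p)) else 0)); first exact: (measurable_chart_ext f2).
by apply/funext => p; rewrite /chart_ext; case: ifP.
Qed.

Lemma chart_ext_psi f x : box x0 r x -> chart_ext f (psi c x) = f x.
Proof.
move=> bx; have Ux := bU bx; rewrite /chart_ext mem_set ?phi_psi //.
by split; [exact: dom_psi|rewrite /= phi_psi].
Qed.

Definition chart_spinor (f0 f1 : 'rV[R]_3 -> R[i]) (p : Sigma) : 'cV[R[i]]_4 :=
  \col_(a < 4) (if a == 0 then chart_ext f0 p else if a == 1 then chart_ext f1 p else 0).

Lemma cmeas_chart_spinor f0 f1 a : Cc U f0 -> Cc U f1 -> cmeas (fun p => chart_spinor f0 f1 p a 0).
Proof.
move=> f0c f1c; under eq_fun do rewrite mxE.
case: (a == 0); first exact: cmeas_chart_ext.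
case: (a == 1); first exact: cmeas_chart_ext.
exact: cmeas0.
Qed.

Lemma normsq0 : normsq (0 : R[i]) = 0.
Proof. by rewrite /normsq /= expr0n addr0. Qed.

Lemma normsq_ge0 (z : R[i]) : 0 <= normsq z.
Proof. by rewrite addr_ge0 // sqr_ge0. Qed.

Lemma in_L2_chart_spinor f0 f1 : Cc U f0 -> Cc U f1 -> in_L2 vol (chart_spinor f0 f1).
Proof.
move=> f0c f1c; split; first by move=> a; exact: cmeas_chart_spinor.
have [B0 B00 HB0] := ccon_bounded r0 bU (ccon_normsq f0c).
have [B1 B10 HB1] := ccon_bounded r0 bU (ccon_normsq f1c).
have extB f B : 0 <= B -> (forall x, box x0 r x -> `|normsq (f x)| <= B) ->
    forall p, normsq (chart_ext f p) <= B.
  move=> BB HB p; rewrite /chart_ext; case: ifPn => [/set_mem[dp bp]|_]; last by rewrite normsq0.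
  exact: le_trans (ler_norm _) (HB _ bp).
have e0 := extB _ _ B00 HB0; have e1 := extB _ _ B10 HB1.
apply: (@le_lt_trans _ _ (\int[vol]_(p in [set: borel Sigma]) (cst (B0 + B1)%:E p))%E).
  apply: ge0_le_integral => //.
  - by move=> p _; rewrite lee_fin sumr_ge0 // => a _; exact: normsq_ge0.
  - apply/measurable_EFinP; apply: measurable_sum => a.
    by apply: measurable_normsq; exact: cmeas_chart_spinor.
  - move=> p _; rewrite lee_fin 4!big_ord_recl big_ord0 !mxE /= !normsq0 !addr0.
    exact: lerD.
rewrite integral_cst //.
have fv : (vol setT < +oo)%E by rewrite ltey_eq fin_num_measure.
by apply: lte_mul_pinfty => //; rewrite lee_fin addr_ge0.
Qed.

Lemma rI_le_vol : exists2 C, 0 < C & forall (v : Sigma -> 'cV[R[i]]_4) G0 G1,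
  (forall a, cmeas (fun p => v p a 0)) -> Cc U G0 -> Cc U G1 ->
  (forall x, box x0 r x -> v (psi c x) 0 0 = G0 x) ->
  (forall x, box x0 r x -> v (psi c x) 1 0 = G1 x) ->
  ((rI (fun x => normsq (G0 x) + normsq (G1 x)))%:E <= C%:E * norm2sq vol v)%E.
Proof.
have [C C0 HC] := integral_box_le_vol eta_orthonormal vol_h r0 bU.
exists C => // v G0 G1 vm G0c G1c v0 v1.
pose q p := normsq (v p 0 0) + normsq (v p 1 0).
have qm : measurable_fun [set: borel Sigma] q.
  by apply: measurable_funD; apply: measurable_normsq; exact: vm.
have q0 p : 0 <= q p by rewrite addr_ge0 // normsq_ge0.
have gc : ccon U (fun x => normsq (G0 x) + normsq (G1 x)).
  by apply: cconD; exact: ccon_normsq.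
have gi := integrable_ccon r0 oU bU gc.
have fin := integrable_fin_num (measurable_box3 x0 r) gi.
rewrite /rI /Rintegral fineK; last exact: fin.
apply: (@le_trans _ _ (C%:E * \int[vol]_p (q p)%:E)%E).
  apply: le_trans (HC q qm q0); rewrite le_eqVlt; apply/orP; left; apply/eqP.
  by apply: eq_integral => t /set_mem bt; rewrite /q /= v0 // v1.
apply: lee_wpmul2l; first by rewrite lee_fin ltW.
apply: ge0_le_integral => //.
- by move=> p _; rewrite lee_fin.
- exact/measurable_EFinP.
- apply/measurable_EFinP; apply: measurable_sum => a.
  by apply: measurable_normsq; exact: vm.
- move=> p _; rewrite lee_fin 2!big_ord_recl addrA.
  rewrite (_ : lift ord0 ord0 = 1 :> 'I_4); last exact: val_inj.
  by rewrite lerDl sumr_ge0 // => a _; exact: normsq_ge0.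
Qed.

(** The pair (f0, f1), extended by 0 off the cube and with lower components 0, is an L^2 spinor on
    Sigma. The partial sums of its expansion pair to 0 with K, and the remainder, small in L^2 of
    Sigma, is small in L^2 of the cube. *)
Lemma dense_span K0 K1 : Cc U K0 -> Cc U K1 ->
  (forall z, cI (fun x => K0 x * chart_mode 0 z x + K1 x * chart_mode 1 z x) = 0) ->
  forall f0 f1, Cc U f0 -> Cc U f1 -> cI (fun x => K0 x * f0 x + K1 x * f1 x) = 0.
Proof.
move=> K0c K1c Kz f0 f1 f0c f1c.
have cuc a z : Cc U (chart_mode a z) := C1c_Cc (C1c_chart_mode a z).
apply: (@cI_eq0_of_Re R x0 r U K0 K1 (fun L0 L1 => [/\ Cc U L0, Cc U L1 &
  forall z, cI (fun x => L0 x * chart_mode 0 z x + L1 x * chart_mode 1 z x) = 0]) f0 f1) => //.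
  move=> L0 L1 a [L0c L1c Lz]; split.
  - exact: (CcM (@Cc_cst R U a) L0c).
  - exact: (CcM (@Cc_cst R U a) L1c).
  move=> z; rewrite -[RHS](mulr0 a) -[in RHS](Lz z) -(cIZ r0 oU bU a).
    by apply: eq_cI => x _; rewrite mulrDr !mulrA.
  exact: (CcD (CcM L0c (cuc 0 z)) (CcM L1c (cuc 1 z))).
move=> {K0 K1 K0c K1c Kz} L0 L1 L0c L1c [_ _ Lz].
have [C C0 HC] := rI_le_vol.
have uL2 := in_L2_chart_spinor f0c f1c; set u := chart_spinor f0 f1 in uL2.
have tot := onb_total chi_onb uL2.
(* A remainder of squared norm below e^2 contributes e^-1 C e^2 = e C to the weighted estimate; this
   explains the summand C and the threshold e^2. *)
apply: (@small_eq0 _ _ (rI (fun x => normsq (L0 x) + normsq (L1 x)) + C)) => e e0.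
have e20 : 0 < e ^+ 2 by rewrite exprn_gt0.
pose a z := inner2 vol (chi (mode_index z)) u.
pose v N p := u p - \sum_(n < N) (a (true, n : nat) *: chi (mode_index (true, n : nat)) p
  + a (false, n : nat) *: chi (mode_index (false, n : nat)) p).
have [N HN] : exists N, (norm2sq vol (v N) < (e ^+ 2)%:E)%E.
  have : \forall N \near \oo, (norm2sq vol (v N) < (e ^+ 2)%:E)%E.
    apply: (tot [set x : \bar R | (x < (e ^+ 2)%:E)%E]).
    apply: open_nbhs_nbhs; split; first exact: open_ereal_lt_ereal.
    by rewrite /= lte_fin.
  by move=> [N _ HN]; exists N; apply: HN => /=.
(* From here on the coefficients can be any numbers: only the smallness of the remainder matters. *)
clearbody a.
pose W z x := L0 x * chart_mode 0 z x + L1 x * chart_mode 1 z x.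
have Wc z : Cc U (W z) := CcD (CcM L0c (cuc 0 z)) (CcM L1c (cuc 1 z)).
pose S b x := \sum_(n < N) (a (true, n : nat) * chart_mode b (true, n : nat) x
  + a (false, n : nat) * chart_mode b (false, n : nat) x).
have Sc b : Cc U (S b).
  by apply: Cc_sum => n; exact: (CcD (CcM (@Cc_cst R U _) (cuc b _)) (CcM (@Cc_cst R U _) (cuc b _))).
pose G0 x := f0 x - S 0 x; pose G1 x := f1 x - S 1 x.
have G0c : Cc U G0 := CcB f0c (Sc 0).
have G1c : Cc U G1 := CcB f1c (Sc 1).
have vE b p : v N p b 0 = u p b 0 - \sum_(n < N) (a (true, n : nat) * chi (mode_index (true, n : nat)) p b 0
  + a (false, n : nat) * chi (mode_index (false, n : nat)) p b 0).
  have subE (w z : 'cV[R[i]]_4) i : (w - z) i 0 = w i 0 - z i 0 by rewrite !mxE.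
  have linE (k l : R[i]) (w z : 'cV[R[i]]_4) i : (k *: w + l *: z) i 0 = k * w i 0 + l * z i 0.
    by rewrite !mxE.
  rewrite /v subE summxE; congr (_ - _).
  by apply: eq_bigr => n _; exact: linE.
have v0 x : box x0 r x -> v N (psi c x) 0 0 = G0 x.
  by move=> bx; rewrite vE /G0 /u mxE /= chart_ext_psi.
have v1 x : box x0 r x -> v N (psi c x) 1 0 = G1 x.
  by move=> bx; rewrite vE /G1 /u mxE /= chart_ext_psi.
have vm b : cmeas (fun p => v N p b 0).
  under eq_fun do rewrite vE.
  under eq_fun do rewrite -mulN1r.
  apply: cmeasD; first exact: cmeas_chart_spinor.
  apply: cmeasZ; apply: cmeas_sum => n.
  apply: cmeasD; apply: cmeasZ; exact: ((onb_L2 chi_onb (mode_index_neq0 _)).1 b).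
have HG : rI (fun x => normsq (G0 x) + normsq (G1 x)) <= C * e ^+ 2.
  have := HC (v N) G0 G1 vm G0c G1c v0 v1; rewrite -lee_fin => /le_trans; apply.
  by rewrite EFinM; apply: lee_wpmul2l; [rewrite lee_fin ltW|exact: ltW].
have TE : cI (fun x => L0 x * f0 x + L1 x * f1 x) = cI (fun x => L0 x * G0 x + L1 x * G1 x).
  pose Q n x := a (true, n) * W (true, n) x + a (false, n) * W (false, n) x.
  have Qc n : Cc U (Q n).
    exact: (CcD (CcM (@Cc_cst R U _) (Wc _)) (CcM (@Cc_cst R U _) (Wc _))).
  have Q0 n : cI (Q n) = 0.
    have W0 z : cI (W z) = 0 := Lz z.
    have Z1 := cIZ r0 oU bU (a (true, n)) (Wc (true, n)).
    have Z2 := cIZ r0 oU bU (a (false, n)) (Wc (false, n)).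
    apply: (etrans (cID r0 oU bU (CcM (@Cc_cst R U (a (true, n))) (Wc (true, n)))
      (CcM (@Cc_cst R U (a (false, n))) (Wc (false, n))))).
    apply: (etrans (congr2 +%R Z1 Z2)).
    by rewrite (W0 (true, n)) (W0 (false, n)) !mulr0 addr0.
  transitivity (cI (fun x => (L0 x * G0 x + L1 x * G1 x) + \sum_(n < N) Q n x)).
    apply: eq_cI => x _; rewrite /G0 /G1 /S !mulrBr !mulr_sumr.
    have -> : \sum_(n < N) Q n x =
      \sum_(n < N) L0 x * (a (true, n : nat) * chart_mode 0 (true, n : nat) x
        + a (false, n : nat) * chart_mode 0 (false, n : nat) x)
      + \sum_(n < N) L1 x * (a (true, n : nat) * chart_mode 1 (true, n : nat) x
        + a (false, n : nat) * chart_mode 1 (false, n : nat) x).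
      by rewrite -big_split; apply: eq_bigr => n _; rewrite /Q /W /=; ring.
    ring.
  rewrite (cID r0 oU bU (CcD (CcM L0c G0c) (CcM L1c G1c)) (Cc_sum _ (fun n : 'I_N => Qc n))).
  rewrite (cI_sum r0 oU bU _ (fun n : 'I_N => Qc n)) big1 ?addr0 //.
have -> : rI (fun x => complex.Re (L0 x * f0 x + L1 x * f1 x)) =
    rI (fun x => complex.Re (L0 x * G0 x + L1 x * G1 x)) by case: TE.
apply: le_trans (normr_rI_ReM r0 oU bU e0 L0c L1c G0c G1c) _.
rewrite mulrDr lerD2l; apply: (@le_trans _ _ (e^-1 * (C * e ^+ 2))).
  by rewrite ler_pM2l ?invr_gt0.
by rewrite le_eqVlt; apply/orP; left; apply/eqP; field; rewrite gt_eqF.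
Qed.
End DenseSpan.

(** * Eigenvalues above the mass *)

Section SpectralGap.
Variables (R : realType) (Sigma : ptopologicalType) (M : atlas3 R Sigma).
Variables (h : metric M) (eta : 'I_3 -> vector_field M).
Hypothesis eta_orthonormal : orthonormal_frame h eta.
Variable vol : {finite_measure set (borel Sigma) -> \bar R}.
Hypothesis vol_h : riemannian_measure h vol.
Variables (m : R) (chi : int -> Sigma -> 'cV[R[i]]_4) (lam : int -> R).
Hypothesis m_gt0 : 0 < m.
Hypothesis chi_basis : dirac_eigenbasis vol h eta m chi lam.

Definition lower_density (u : 'cV[R[i]]_4) : R := \sum_(a < 4) (if (a < 2)%N then 0 else normsq (u a 0)).

Lemma gamma0_row (v : 'cV[R[i]]_4) a :
  (gamma0 *m v) a 0 = if (a < 2)%N then v a 0 else - v a 0.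
Proof.
rewrite -{1}(@vsubmxK _ 2 2 1 v) /gamma0 (@mul_block_col _ 2 2 2 2 1) !mul0mx !mul1mx addr0 add0r.
case: (@split_ordP 2 2 a) => b ->.
  by rewrite (@col_mxEu _ 2 2) mxE.
by rewrite (@col_mxEd _ 2 2) mulNmx mul1mx !mxE.
Qed.

Lemma adj_gamma0 (u : 'cV[R[i]]_4) :
  (adj u *m (gamma0 *m u)) 0 0 = (\sum_(a < 4) normsq (u a 0) - 2 * lower_density u)%:C.
Proof.
rewrite mxE /lower_density mulr_sumr -sumrB rmorph_sum; apply: eq_bigr => a _.
have adjE : adj u 0 a = conjc (u a 0) by rewrite !mxE.
rewrite adjE gamma0_row; case: ifP => _; first by rewrite conjcM_self mulr0 subr0.
by rewrite mulrN conjcM_self -rmorphN; congr (_%:C); ring.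
Qed.

(** Both the squared norm and the expectation m / lam_n of [gamma0] are 1, and they differ by twice
    the squared L^2 norm of the lower components. *)
Lemma chi_lower_null n : lam n.+1%:Z = m ->
  (\int[vol]_p (normsq (chi n.+1%:Z p 2%:R 0))%:E = 0)%E.
Proof.
move=> lm; set z : int := n.+1%:Z.
have z0 : z != 0 by [].
have L2 := onb_L2 (deb_basis chi_basis) z0.
pose N (p : borel Sigma) : R := \sum_(a < 4) normsq (chi z p a 0).
pose q (p : borel Sigma) : R := lower_density (chi z p).
have nz a p : 0 <= normsq (chi z p a 0) by exact: normsq_ge0.
have Nm : measurable_fun [set: borel Sigma] N := measurable_density L2.
have qm : measurable_fun [set: borel Sigma] q.
  apply: measurable_sum => a; case: (a < 2)%N; first exact: measurable_cst.
  by apply: measurable_normsq; exact: (L2.1 a).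
have N0 p : 0 <= N p by rewrite sumr_ge0.
have q0 p : 0 <= q p by rewrite sumr_ge0 // => a _; case: ifP.
have qN p : q p <= N p.
  by rewrite /q /N /lower_density; apply: ler_sum => a _; case: ifP => // _; exact: nz.
have Ni : vol.-integrable setT (EFin \o N).
  apply/integrableP; split; first exact/measurable_EFinP.
  under eq_integral do rewrite gee0_abs ?lee_fin //.
  by case: L2.
have qi : vol.-integrable setT (EFin \o q).
  apply: (le_integrable measurableT _ _ Ni); first exact/measurable_EFinP.
  by move=> p _; rewrite /= lee_fin !ger0_norm.
have E1 : Rintegral vol setT N = 1.
  have := congr1 (@complex.Re R) (onb_ortho (deb_basis chi_basis) z0 z0).
  rewrite eqxx /inner2 /cint /= => <-.
  by apply: eq_Rintegral => p _; rewrite adj_self.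
have E2 : Rintegral vol setT (fun p => N p - 2 * q p) = 1.
  have := congr1 (@complex.Re R) (deb_gamma0 chi_basis z0 z0).
  rewrite eqxx lm divff ?gt_eqF // /inner2 /cint /= => H; rewrite -[RHS]H.
  apply: eq_Rintegral => p _.
  exact: (esym (congr1 (@complex.Re R) (adj_gamma0 (chi z p)))).
have q2i : vol.-integrable setT (EFin \o (fun p => 2 * q p)).
  have := integrableZl measurableT 2 qi; congr (integrable _ _ _).
have E3 : Rintegral vol setT q = 0.
  have E5 : Rintegral vol setT (fun p => 2 * q p) = 2 * Rintegral vol setT q.
    by apply: RintegralZl.
  move: E2; rewrite (RintegralB measurableT Ni q2i) E5 E1; lra.
have E4 : (\int[vol]_p (q p)%:E = 0)%E.
  by rewrite -(fineK (integrable_fin_num measurableT qi)); congr EFin.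
apply/eqP; rewrite eq_le; apply/andP; split; last first.
  by apply: integral_ge0 => p _; rewrite lee_fin.
rewrite -E4; apply: ge0_le_integral => //.
- by move=> p _; rewrite lee_fin.
- by apply/measurable_EFinP; apply: measurable_normsq; exact: (L2.1 2%:R).
- exact/measurable_EFinP.
- move=> p _; rewrite lee_fin /q /lower_density (bigD1 (2%:R : 'I_4)) //= lerDl.
  by apply: sumr_ge0 => a _; case: ifP.
Qed.

Variables (c : chart M) (x0 : 'rV[R]_3) (r : R).
Hypothesis r0 : 0 < r.
Local Notation U := (img c).
Hypothesis bU : box x0 r `<=` U.
Hypothesis lamE : forall n : nat, lam n.+1%:Z = m.
Local Notation cI := (cI x0 r).
Local Notation rI := (rI x0 r).
Local Notation chart_mode := (chart_mode c chi).
Let oU : open U := @open_img _ _ _ c.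
Let cuc a z : Cc U (chart_mode a z) := C1c_Cc (C1c_chart_mode c (deb_smooth chi_basis) a z).

Lemma rI_chi_lower n : rI (fun x => normsq (chart_mode 2%:R (true, n) x)) = 0.
Proof.
have [C C0 HC] := integral_box_le_vol eta_orthonormal vol_h r0 bU.
have mq : measurable_fun [set: borel Sigma] (fun p => normsq (chi n.+1%:Z p 2%:R 0)).
  by apply: measurable_normsq; exact: ((onb_L2 (deb_basis chi_basis) (mode_index_neq0 (true, n))).1 2%:R).
have := HC _ mq (fun p => normsq_ge0 _); rewrite chi_lower_null // mule0 => H.
have E : (\int[@leb3 R]_(t in box3 x0 r) (normsq (chi n.+1%:Z (psi c (vec3 t)) 2%:R 0))%:E = 0)%E.
  by apply/eqP; rewrite eq_le H; apply: integral_ge0 => t _; rewrite lee_fin normsq_ge0.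
exact: (congr1 fine E).
Qed.

Definition mass_term (z : bool * nat) (x : 'rV[R]_3) : R[i] :=
  'i%C * (lam (mode_index z) + m)%:C * chart_mode 2%:R z x.

Lemma Cc_mass_term z : Cc U (mass_term z).
Proof. exact: (CcM (@Cc_cst R U _) (cuc 2%:R z)). Qed.

(** For a positive mode the third component is null in L^2; for a negative one the factor lam + m is
    0. *)
Lemma cI_mass_term K z : Cc U K -> cI (fun x => K x * mass_term z x) = 0.
Proof.
move=> Kc; apply: (cI_null r0 oU bU Kc (Cc_mass_term z)).
transitivity (rI (fun x => normsq ('i%C * (lam (mode_index z) + m)%:C : R[i]) * normsq (chart_mode 2%:R z x))).
  by apply: eq_rI => x _; rewrite -normsqM.
rewrite (rIZ r0 oU bU _ (ccon_normsq (cuc 2%:R z))).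
case: z => [[] n]; first by rewrite rI_chi_lower mulr0.
rewrite /mode_index /= (deb_opp chi_basis) // lamE addNr.
by rewrite mulr0 normsq0 mul0r.
Qed.

(** The zeroth order terms cancel at each point, with [b0] and [b1] common to the three modes,
    before the integral is taken; three mass terms with continuous coefficients remain. *)
Lemma cI_det3 f z v w : Cc U f ->
  cI (fun x => f x * det3 (symb0 eta c) (symb1 eta c) (chart_mode 0) (chart_mode 1) z v w x) = 0.
Proof.
move=> fc; pose W := wedge (chart_mode 0) (chart_mode 1).
have Wc v' w' : Cc U (fun x => f x * W v' w' x).
  exact: (CcM fc (CcB (CcM (cuc 0 v') (cuc 1 w')) (CcM (cuc 1 v') (cuc 0 w')))).
have e1 := cI_mass_term z (Wc v w); have c1 := CcM (Wc v w) (Cc_mass_term z).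
have e2 := cI_mass_term v (Wc z w); have c2 := CcM (Wc z w) (Cc_mass_term v).
have e3 := cI_mass_term w (Wc z v); have c3 := CcM (Wc z v) (Cc_mass_term w).
transitivity (cI (fun x => (f x * W v w x * mass_term z x + - (f x * W z w x * mass_term v x))
   + f x * W z v x * mass_term w x)).
  apply: eq_cI => x bx.
  have [b0 [b1 H]] := dirac_row2 h eta (bU bx).
  have L y : principal_part (symb0 eta c) (symb1 eta c) (chart_mode 0) (chart_mode 1) y x =
      mass_term y x - b0 * chart_mode 0 y x - b1 * chart_mode 1 y x.
    exact: (H m (lam (mode_index y)) (chi (mode_index y)) (deb_smooth chi_basis (mode_index_neq0 y))
      (deb_eigen chi_basis (mode_index_neq0 y))).
  rewrite /det3 !L /W /wedge.
  move: (mass_term z x) (mass_term v x) (mass_term w x) (f x) => ez ev ew fx.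
  move: (chart_mode 0 z x) (chart_mode 0 v x) (chart_mode 0 w x) (chart_mode 1 z x) (chart_mode 1 v x) (chart_mode 1 w x) => a1 a2 a3 a4 a5 a6.
  ring.
rewrite (cID r0 oU bU (CcD c1 (CcN c2)) c3) (cID r0 oU bU c1 (CcN c2)) (cIN r0 oU bU c2).
by rewrite e1 e2 e3 oppr0 !addr0.
Qed.

(** The expression is the sum of the squares of the first coordinates of the three frame vectors,
    that is, of a column of an invertible matrix. *)
Lemma symb_nondeg x : U x -> 0 < normsq (symb0 eta c 0 x) + normsq (symb1 eta c 0 x).
Proof.
move=> Ux; rewrite lt_neqAle addr_ge0 ?normsq_ge0 // andbT eq_sym.
apply/negP; rewrite /symb0 /symb1 /normsq /= => /eqP.
set a := vf (eta 0) c x 0 0; set b := vf (eta 1) c x 0 0; set d := vf (eta 2%:R) c x 0 0.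
move=> E.
have S : a ^+ 2 + (b ^+ 2 + d ^+ 2) = 0 by rewrite -[RHS]E; ring.
have := S => /eqP; rewrite paddr_eq0 ?addr_ge0 ?sqr_ge0 // sqrf_eq0 => /andP[/eqP a0].
rewrite paddr_eq0 ?sqr_ge0 // !sqrf_eq0 => /andP[/eqP b0 /eqP d0].
(* A right inverse of the frame matrix is also a left inverse, and in that order the entry (0, 0)
   involves only the first column of the frame matrix, which is 0. *)
have := eta_orthonormal Ux; rewrite -mulmxA => /mulmx1C /matrixP /(_ 0 0).
rewrite mxE big1 ?mxE /=; first by move/eqP; rewrite eq_sym oner_eq0.
move=> j _; rewrite [X in _ * X]mxE.
have -> : vf (eta j) c x 0 0 = 0 by elim/ord3P: j.
by rewrite mulr0.
Qed.

Lemma not_all_lam_eq_mass : False.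
Proof.
have vfU i k : C1r U (fun x => vf (eta i) c x 0 k) := vf_smooth (eta i) c k 1%N.
have s0U k : C1c U (symb0 eta c k) := C1c_real (vfU 2%:R k).
have s1U k : C1c U (symb1 eta c k).
  have H : C1c U (fun x => - 'i%C * (vf (eta 1) c x 0 k)%:C).
    apply: (C1cM oU _ (C1c_real (vfU 1 k))).
    by split; exact: C1r_cst.
  rewrite (_ : symb1 eta c k = fun x => (vf (eta 0) c x 0 k)%:C + - 'i%C * (vf (eta 1) c x 0 k)%:C).
    exact: (C1cD oU (C1c_real (vfU 0 k)) H).
  by apply/funext => x; rewrite /symb1 mulNr.
have uU a z := C1c_chart_mode c (deb_smooth chi_basis) a z.
apply: (elimination_absurd r0 oU bU s0U s1U (uU 0) (uU 1)).
- by move=> f z v w; exact: cI_det3.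
- move=> K0 K1 K0c K1c Kz f0 f1 f0c f1c.
  exact: (dense_span eta_orthonormal vol_h r0 bU (deb_basis chi_basis)
    (deb_smooth chi_basis) K0c K1c Kz f0c f1c).
- exact: symb_nondeg.
Qed.
End SpectralGap.

Lemma exists_lam_gt_mass (R : realType) (Sigma : ptopologicalType) (M : atlas3 R Sigma)
    (h : metric M) (eta : 'I_3 -> vector_field M)
    (vol : {finite_measure set (borel Sigma) -> \bar R})
    (m : R) (chi : int -> Sigma -> 'cV[R[i]]_4) (lam : int -> R) :
  orthonormal_frame h eta -> riemannian_measure h vol -> 0 < m ->
  dirac_eigenbasis vol h eta m chi lam -> exists n : nat, m < lam n.+1%:Z.
Proof.
move=> on vh m0 B; apply: contrapT => no.
have lamE n : lam n.+1%:Z = m.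
  apply/eqP; rewrite eq_le; apply/andP; split.
    by rewrite leNgt; apply/negP => H; apply: no; exists n.
  by elim: n => [|n IH]; [exact: deb_ge_m B|exact: le_trans IH (deb_mono B n)].
(* The contradiction is local, so a small cube around any point serves. *)
pose p0 : Sigma := point; pose c := chart_at M p0.
have Ux : img c (phi c p0) by exists p0 => //; exact: chart_atP.
have [r r0 bU] := near_box (@open_img _ _ _ c) Ux.
exact: (not_all_lam_eq_mass on vh m0 B r0 bU lamE).
Qed.

(** * Fluctuations in the FP-states *)

Section Modes.
Variable R : realType.

Lemma Re_fourier_indic (b l : R) : 0 < b -> l != 0 ->
  complex.Re (fourier \1_(`]-b, b[ : set R) l) = 2 * sin (l * b) / l.
Proof.
move=> b0 l0; pose D : set R := `]-b, b[%classic.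
rewrite /fourier /cint /=.
transitivity (Rintegral lebesgue_measure D (fun t => cos (l * t))).
  rewrite [RHS]Rintegral_mkcond; apply: eq_Rintegral => t _.
  rewrite patchE indicE -/D /cis /= !mul0r subr0.
  by case: (t \in D); rewrite ?mul1r ?mul0r.
have bb : - b < b by rewrite gtrN.
rewrite /Rintegral -(integral_itv_bndoo true false); last first.
  by apply/measurable_EFinP; apply: measurable_funTS; apply: continuous_measurable_fun => t;
    apply: continuous_comp; [exact: mulrl_continuous|exact: continuous_cos].
by rewrite integral_cos //= mulrN sinN; field.
Qed.

(** Here s is sin (2 theta)^2, F and N are the squared moduli of the Fourier transform at 2 l and at
    0, and q is sin (2 l b). Since s <= 1/2, the term F P s with P = 1 - m^2 / l^2 is absorbed on
    the left, so F P <= 2 N m^2 s / l^2. The decay 1/l of the Fourier transform is why l^2 s, and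
    not just s, has to be small. *)
Lemma mode_estimate (l m s F N q d : R) : 0 < m -> m <= l -> 0 <= s ->
  l ^+ 2 * s <= m ^+ 2 / 2 -> 0 <= N -> 0 <= d -> d <= 1 - m ^+ 2 / l ^+ 2 ->
  (q / l) ^+ 2 <= F ->
  F * (1 - m ^+ 2 / l ^+ 2) = (F * (1 - m ^+ 2 / l ^+ 2) + N * m ^+ 2 / l ^+ 2) * s ->
  q ^+ 2 * d <= 2 * N * (l ^+ 2 * s).
Proof.
move=> m0 ml s0 ts N0 d0 dP qF FE.
have l0 : 0 < l by exact: lt_le_trans ml.
have l2 : 0 < l ^+ 2 by rewrite exprn_gt0.
have m2 : 0 < m ^+ 2 by rewrite exprn_gt0.
have ml2 : m ^+ 2 <= l ^+ 2 by rewrite ler_sqr // nnegrE ltW.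
have F0 : 0 <= F by apply: le_trans qF; exact: sqr_ge0.
have s12 : s <= 2^-1.
  rewrite -(ler_pM2l l2); apply: le_trans ts _; lra.
set P := 1 - m ^+ 2 / l ^+ 2 in dP FE.
have P0 : 0 <= P by exact: le_trans dP.
have FP0 : 0 <= F * P by rewrite mulr_ge0.
have lN : l ^+ 2 * (N * m ^+ 2 / l ^+ 2) = N * m ^+ 2 by field; rewrite gt_eqF.
have E : l ^+ 2 * (F * P) = l ^+ 2 * (F * P) * s + N * m ^+ 2 * s.
  by rewrite {1}FE mulrA mulrDr lN mulrDl.
have lFP0 : 0 <= l ^+ 2 * (F * P) by rewrite mulr_ge0 // ltW.
have B1 : l ^+ 2 * (F * P) <= 2 * (N * m ^+ 2 * s).
  have := ler_wpM2l lFP0 s12; lra.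
have B2 : 2 * (N * m ^+ 2 * s) <= 2 * N * (l ^+ 2 * s).
  have : (N * s) * m ^+ 2 <= (N * s) * l ^+ 2 by rewrite ler_wpM2l // mulr_ge0.
  lra.
have q2 : q ^+ 2 = l ^+ 2 * (q / l) ^+ 2 by field; rewrite gt_eqF.
have B3 : q ^+ 2 * d <= l ^+ 2 * (F * P).
  rewrite q2 -mulrA ler_pM2l //; apply: ler_pM => //; exact: sqr_ge0.
exact: le_trans (le_trans B3 B1) B2.
Qed.

(** Squared moduli of the off-diagonal entries of the two forms of [A_mx]; the phase drops out. *)
Lemma FP_angles_normsq (m : R) (f : R -> R) (lam : int -> R) (theta ph : nat -> R) n :
  0 < m -> m <= lam n.+1%:Z -> FP_angles m f lam theta ph ->
  let l := lam n.+1%:Z in let F := normsq (fourier f (2 * l)) in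
  F * (1 - m ^+ 2 / l ^+ 2) =
  (F * (1 - m ^+ 2 / l ^+ 2) + normsq (fourier f 0) * m ^+ 2 / l ^+ 2) * sin (2 * theta n) ^+ 2.
Proof.
move=> m0 ml /(_ n) [_ _]; set l := lam _ in ml *; cbv zeta => /matrixP /(_ 0 1) E.
have l0 : 0 < l by exact: lt_le_trans ml.
have P0 : 0 <= 1 - m ^+ 2 / l ^+ 2.
  rewrite subr_ge0 ler_pdivrMr ?exprn_gt0 // mul1r ler_sqr ?nnegrE //; exact: ltW.
have e1 : A_mx m f l 0 1 = fourier f (2 * l) * (Num.sqrt (1 - m ^+ 2 / l ^+ 2))%:C.
  by rewrite /A_mx /mx2 mxE.
have e2 (x : R) (M2 : 'M[R[i]]_2) : (x%:C *: M2) 0 1 = x%:C * M2 0 1 by rewrite mxE.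
have e3 (a b c d : R[i]) : mx2 a b c d 0 1 = b by rewrite mxE.
move: E; rewrite e1 e2 e3 => /(congr1 (@normsq R)).
rewrite !normsqM !normsq_real normsq_cis mul1r sqr_sqrtr // => EE.
rewrite [LHS]EE /Xi sqr_sqrtr //; apply: addr_ge0.
  exact: mulr_ge0 (normsq_ge0 _) P0.
by rewrite divr_ge0 ?sqr_ge0 // mulr_ge0 ?sqr_ge0 ?normsq_ge0.
Qed.
End Modes.

Lemma Ck_on_cst (R : realType) k (U : set 'rV[R]_3) (a : R) : Ck_on k U (fun=> a).
Proof.
elim: k a => [|k IH] a; (split; first by move=> x _; exact: cst_continuous) => //.
move=> j; split; first by move=> x _; exact: derivable_cst.
rewrite (_ : partial j _ = fun=> 0); first exact: IH.
by apply/funext => x; rewrite /partial derive_cst.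
Qed.

Section FiniteFluctuations.
Variables (R : realType) (Sigma : ptopologicalType) (M : atlas3 R Sigma).
Variables (h : metric M) (eta : 'I_3 -> vector_field M).
Variable vol : {finite_measure set (borel Sigma) -> \bar R}.
Variables (m : R) (chi : int -> Sigma -> 'cV[R[i]]_4) (lam : int -> R).
Hypothesis m_gt0 : 0 < m.
Hypothesis chi_basis : dirac_eigenbasis vol h eta m chi lam.

Lemma lam_nondecreasing : {homo (fun n : nat => lam n.+1%:Z) : n k / (n <= k)%N >-> n <= k}.
Proof.
by apply: homo_leq => [x|y x z|n]; [exact: lexx|exact: le_trans|exact: deb_mono chi_basis n].
Qed.

Lemma lam_ge_mass n : m <= lam n.+1%:Z.
Proof. exact: le_trans (deb_ge_m chi_basis) (lam_nondecreasing (leq0n n)). Qed.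

Variables (theta ph : nat -> R) (b : R).
Hypothesis b_gt0 : 0 < b.
Hypothesis fin : finite_fluctuations M vol chi lam theta ph b.

Lemma lam_sin_angle_cvg0 :
  lam n.+1%:Z ^+ 2 * sin (2 * theta n) ^+ 2 @[n --> \oo] --> (0 : R).
Proof.
have [f [ft f0 fc fI]] := exists_test_function b_gt0.
have g1 : smooth_cfun M (fun=> 1 : R[i]) by split => c k; exact: Ck_on_cst.
have H := finite_fluctuations_cvg0 fin ft g1.
pose I := Rintegral lebesgue_measure `]-b, b[ f.
have I0 : I != 0 by rewrite gt_eqF.
have E n : normsq (rho_coef chi lam theta ph vol b (fun t => (f t)%:C) (fun=> 1) true false n n) =
    lam n.+1%:Z ^+ 2 * sin (2 * theta n) ^+ 2 * I ^+ 2.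
  have B := deb_basis chi_basis.
  apply: normsq_rho_coef_diag => //.
  - exact: (deb_opp chi_basis).
  - exact: (onb_L2 B).
  - exact: (onb_L2 B).
  - by rewrite (onb_ortho B) // eqxx.
  - by rewrite (onb_ortho B) // eqxx.
have H2 : (fun n : nat => (I ^+ 2)^-1 * normsq (rho_coef chi lam theta ph vol b
    (fun t => (f t)%:C) (fun=> 1) true false n n)) @ \oo --> (I ^+ 2)^-1 * 0.
  by apply: cvgM; [exact: cvg_cst|exact: H].
rewrite mulr0 in H2.
rewrite (_ : (fun n => _) = (fun n : nat => (I ^+ 2)^-1 * normsq (rho_coef chi lam theta ph vol b
    (fun t => (f t)%:C) (fun=> 1) true false n n))) //.
by apply/funext => n; rewrite E; field.
Qed.

Hypothesis angles : FP_angles m \1_(`]-b, b[ : set R) lam theta ph.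
Variable n0 : nat.
Hypothesis lam_n0 : m < lam n0.+1%:Z.

Lemma sin_lam_cvg0 : sin (2 * lam n.+1%:Z * b) @[n --> \oo] --> (0 : R).
Proof.
pose F0 := normsq (fourier (\1_(`]-b, b[ : set R) : R -> R) 0).
have F00 : 0 <= F0 by exact: normsq_ge0.
pose l n := lam n.+1%:Z.
have lm n : m <= l n := lam_ge_mass n.
have l0 n : 0 < l n by exact: lt_le_trans (lm n).
(* By monotonicity of the eigenvalues this bounds 1 - m^2 / l_n^2 from below for all n >= n0. *)
pose d := 1 - m ^+ 2 / l n0 ^+ 2.
have d0 : 0 < d.
  rewrite subr_gt0 ltr_pdivrMr ?exprn_gt0 // mul1r ltr_sqr ?nnegrE //; exact: ltW.
apply/cvgrPdist_lt => e e0.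
(* 2 F0 / d is the constant that [mode_estimate] yields after division by d; the summand 1 makes K
   positive in any case. *)
pose K := 2 * F0 / d + 1.
have K0 : 0 < K by rewrite ltr_wpDl // divr_ge0 ?mulr_ge0 // ltW.
have t0 := lam_sin_angle_cvg0.
(* The first threshold is the smallness assumed in [mode_estimate]; the second one turns its
   conclusion into sin^2 < e^2. *)
have /cvgrPdist_lt /(_ (m ^+ 2 / 2)) n1 := t0.
have /cvgrPdist_lt /(_ (e ^+ 2 / K)) n2 := t0.
have {}n1 := n1 (ltac:(by rewrite divr_gt0 // exprn_gt0)).
have {}n2 := n2 (ltac:(by rewrite divr_gt0 // exprn_gt0)).
near=> n.
have nn0 : (n0 <= n)%N by near: n; exact: nbhs_infty_ge.
have tp k : 0 <= lam k.+1%:Z ^+ 2 * sin (2 * theta k) ^+ 2 by rewrite mulr_ge0 ?sqr_ge0.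
have h1 : lam n.+1%:Z ^+ 2 * sin (2 * theta n) ^+ 2 < m ^+ 2 / 2.
  have : `|0 - lam n.+1%:Z ^+ 2 * sin (2 * theta n) ^+ 2| < m ^+ 2 / 2 by near: n; exact: n1.
  by rewrite sub0r normrN ger0_norm.
have h2 : lam n.+1%:Z ^+ 2 * sin (2 * theta n) ^+ 2 < e ^+ 2 / K.
  have : `|0 - lam n.+1%:Z ^+ 2 * sin (2 * theta n) ^+ 2| < e ^+ 2 / K by near: n; exact: n2.
  by rewrite sub0r normrN ger0_norm.
rewrite sub0r normrN.
have := @mode_estimate R (l n) m (sin (2 * theta n) ^+ 2)
  (normsq (fourier (\1_(`]-b, b[ : set R) : R -> R) (2 * l n))) F0 (sin (2 * l n * b)) d
  m_gt0 (lm n) (sqr_ge0 _) (ltW h1) F00 (ltW d0).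
have dn : d <= 1 - m ^+ 2 / l n ^+ 2.
  rewrite lerD2l lerN2 ler_pM2l ?exprn_gt0 // lef_pV2 ?posrE ?exprn_gt0 //.
  by rewrite ler_sqr ?nnegrE ?(ltW (l0 _)) //; exact: (lam_nondecreasing nn0).
have qF : (sin (2 * l n * b) / l n) ^+ 2 <=
    normsq (fourier (\1_(`]-b, b[ : set R) : R -> R) (2 * l n)).
  rewrite /normsq Re_fourier_indic //; last by rewrite mulf_neq0 // gt_eqF.
  rewrite (_ : 2 * sin (2 * l n * b) / (2 * l n) = sin (2 * l n * b) / l n).
    by rewrite lerDl sqr_ge0.
  by field; rewrite gt_eqF.
move=> /(_ dn qF (FP_angles_normsq m_gt0 (lm n) angles)) H.
suff : `|sin (2 * l n * b)| ^+ 2 < e ^+ 2 by rewrite ltr_sqr ?nnegrE ?normr_ge0 ?(ltW e0).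
rewrite real_normK ?num_real //.
have H3 : sin (2 * l n * b) ^+ 2 <= 2 * F0 / d * (l n ^+ 2 * sin (2 * theta n) ^+ 2).
  by rewrite [leRHS]mulrAC ler_pdivlMr.
apply: le_lt_trans H3 _; rewrite ltr_pdivlMr // in h2.
apply: le_lt_trans h2; rewrite mulrC; apply: ler_wpM2l; first exact: tp.
by rewrite /K lerDl.
Unshelve. all: by end_near. Qed.
End FiniteFluctuations.

Local Close Scope complex_scope.

Theorem theorem3p9 (R : realType) (Sigma : ptopologicalType)
  (M : atlas3 R Sigma)
  (Sigma_hausdorff : hausdorff_space Sigma)
  (Sigma_second_countable : @second_countable Sigma)
  (Sigma_compact : compact [set: Sigma])
  (Sigma_connected : connected [set: Sigma])
  (h : metric M) (Om : volume_form M)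
  (eta : 'I_3 -> vector_field M)
  (eta_orthonormal : orthonormal_frame h eta)
  (eta_oriented : oriented_frame Om eta)
  (vol : {finite_measure set (borel Sigma) -> \bar R})
  (vol_h : riemannian_measure h vol)
  (m : R) (m_gt0 : 0 < m)
  (chi : int -> Sigma -> 'cV[R[i]]_4) (lam : int -> R)
  (chi_basis : dirac_eigenbasis vol h eta m chi lam)
  (theta ph : R -> nat -> R)
  (angles : forall b : R, 0 < b ->
     FP_angles m \1_(`]-b, b[ : set R) lam (theta b) (ph b)) :
  (@lebesgue_measure R).-negligible
    [set b : R | 0 < b /\ finite_fluctuations M vol chi lam (theta b) (ph b) b].
Proof.
have [n0 mn0] := exists_lam_gt_mass eta_orthonormal vol_h m_gt0 chi_basis.
have l0 : 0 < lam 1 by exact: lt_le_trans m_gt0 (lam_ge_mass chi_basis 0).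
apply: negligibleS (negligible_sin_cvg0 l0 (lam_nondecreasing chi_basis)).
move=> b [b0 fin]; exact: (sin_lam_cvg0 m_gt0 chi_basis b0 fin (angles b b0) mn0).
Qed.
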